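(* Let $V$ be a sequentially complete locally convex space with defining system of seminorms $\mathcal{Q}$, and let $\boldsymbol m$ be an order and $\boldsymbol\rho$ a type for $\mathcal Q$ with $-1<\boldsymbol\rho\le1$. For an order $\boldsymbol m'>\boldsymbol m$ and a type $-1<\boldsymbol\rho'\le\boldsymbol\rho$ for $\mathcal Q$ let $I^{\boldsymbol m,\boldsymbol\rho}_{\boldsymbol m',\boldsymbol\rho'}\colon\mathrm S^{\boldsymbol m,\boldsymbol\rho}(\mathbb{R}^{2n},V)\to V$ be the restriction to $\mathrm S^{\boldsymbol m,\boldsymbol\rho}(\mathbb{R}^{2n},V)$ of the extension of $I_0$ from $C_0^\infty(\mathbb{R}^{2n},V)$ by continuity in the $\mathrm S^{\boldsymbol m',\boldsymbol\rho'}$-topology. Then: (i) The maps $I^{\boldsymbol m,\boldsymbol\rho}:=I^{\boldsymbol m,\boldsymbol\rho}_{\boldsymbol m',\boldsymbol\rho'}$ are independent of the order $\boldsymbol m'$ and the type $\boldsymbol\rho'$ as long as $\boldsymbol m'>\boldsymbol m$ and $-1<\boldsymbol\rho'\le\boldsymbol\rho$. (ii) $I^{\boldsymbol m,\boldsymbol\rho}\colon\mathrm S^{\boldsymbol m,\boldsymbol\rho}(\mathbb{R}^{2n},V)\to V$ is linear and continuous. (iii) For $F\in C_0^\infty(\mathbb{R}^{2n},V)$ one has $I^{\boldsymbol m,\boldsymbol\rho}(F)=I_0(F)$. (iv) For orders $\boldsymbol m,\boldsymbol m'$ and types $-1<\boldsymbol\rho,\boldsymbol\rho'\le1$ for $\mathcal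 Q$, and $F\in\mathrm S^{\boldsymbol m,\boldsymbol\rho}(\mathbb{R}^{2n},V)\cap\mathrm S^{\boldsymbol m',\boldsymbol\rho'}(\mathbb{R}^{2n},V)$, one has $I^{\boldsymbol m,\boldsymbol\rho}(F)=I^{\boldsymbol m',\boldsymbol\rho'}(F)$.
   Context: All locally convex spaces are complex and Hausdorff. A defining system of seminorms $\mathcal{Q}$ for $V$ is a set of continuous seminorms generating the topology. An order (resp. type) for $\mathcal{Q}$ is a map $\boldsymbol{m}\colon\mathcal{Q}\to\mathbb{R}$ (resp. $\boldsymbol{\rho}\colon\mathcal{Q}\to\mathbb{R}$); all (in)equalities between orders, types and numbers are meant pointwise, i.e. for every $\mathrm q\in\mathcal{Q}$. For $F\in C^\infty(\mathbb{R}^{k},V)$, $\mathrm{q}\in\mathcal{Q}$, $\mu\in\mathbb{N}_0^{k}$ put $$\|F\|^{\boldsymbol m,\boldsymbol\rho}_{\mathrm q,\mu}=\sup_{x\in\mathbb{R}^k}(1+\|x\|^2)^{-\frac12(\boldsymbol m(\mathrm q)-\boldsymbol\rho(\mathrm q)|\mu|)}\,\mathrm q(\partial^\mu F(x))\in[0,\infty].$$ $\mathrm S^{\boldsymbol m,\boldsymbol\rho}(\mathbb{R}^k,V)$ is the space of all $F\in C^\infty(\mathbb R^k,V)$ for which all these are finite, with the locally convex topology they generate (the $\mathrm S^{\boldsymbol m,\boldsymbol\rho}$-topology). Fix a non-degenerate bilinear form $\langle\cdot,\cdot\rangle$ on $\mathbb{R}^n$, and for $F\in C_0^\infty(\mathbb{R}^{2n},V)$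 (smooth, compactly supported) let $I_0(F):=(2\pi)^{-n}\int_{\mathbb{R}^{2n}}dp\,dx\,e^{i\langle p,x\rangle}F(p,x)\in V$ (Riemann integral). Explanation of the extension: for $\boldsymbol m'>\boldsymbol m$ and $-1<\boldsymbol\rho'\le\boldsymbol\rho\le1$, the space $\mathrm S^{\boldsymbol m,\boldsymbol\rho}(\mathbb{R}^{2n},V)$ is contained in $\mathrm S^{\boldsymbol m',\boldsymbol\rho'}(\mathbb{R}^{2n},V)$, every element of $\mathrm S^{\boldsymbol m,\boldsymbol\rho}(\mathbb{R}^{2n},V)$ is a limit, in the $\mathrm S^{\boldsymbol m',\boldsymbol\rho'}$-topology, of a sequence in $C_0^\infty(\mathbb{R}^{2n},V)$, and $I_0\colon C_0^\infty(\mathbb{R}^{2n},V)\to V$ is continuous for the $\mathrm S^{\boldsymbol m',\boldsymbol\rho'}$-topology. Hence $I_0$ extends continuously to the sequential closure of $C_0^\infty(\mathbb{R}^{2n},V)$ in $\mathrm S^{\boldsymbol m',\boldsymbol\rho'}(\mathbb{R}^{2n},V)$; concretely $I^{\boldsymbol m,\boldsymbol\rho}_{\boldsymbol m',\boldsymbol\rho'}(F)=\lim_{j\to\infty}I_0(F_j)$ for any sequence $F_j\in C_0^\infty(\mathbb{R}^{2n},V)$ with $F_j\to F$ in the $\mathrm S^{\boldsymbol m',\boldsymbol\rho'}$-topology. *)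

(* Defs.v *)
From HB Require Import structures.
From mathcomp Require Import all_boot all_order all_algebra.
From mathcomp Require Import all_classical all_reals all_analysis.
From mathcomp Require Export complex.

Set Implicit Arguments.
Unset Strict Implicit.
Unset Printing Implicit Defensive.

Import Order.TTheory GRing.Theory Num.Theory.
Import numFieldNormedType.Exports.

Local Open Scope classical_set_scope.
Local Open Scope ring_scope.
Local Open Scope complex_scope.

(* The trace on A of the neighbourhood filter of f for the topology generated
   by the seminorms p. The values of p may be infinite outside A. *)
Definition seminorm_nbhs (R : realType) (E : zmodType) (I : Type)
    (p : I -> E -> \bar R) (A : set E) (f : E) : set_system E :=
  filter_from
    [set D : set I * R | finite_set D.1 /\ 0 < D.2]
    (fun D => [set g | A g /\ forall i, D.1 i -> (p i (g - f)%R < D.2%:E)%E]).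

Section LocallyConvex.
Context (R : realType) (V : tvsType R[i]).

(* The library does not require the uniform structure of a tvsType to be the
   translation-invariant one, so that its predicate cauchy may differ from the
   Cauchy property of the topological vector space. *)
Definition cauchy_seq (u : nat -> V) : Prop :=
  (fun jl : nat * nat => u jl.1 - u jl.2) @ (\oo, \oo) --> (0 : V).

Definition sequentially_complete : Prop :=
  forall u : nat -> V, cauchy_seq u -> exists v : V, u @ \oo --> v.

Definition is_seminorm (p : V -> R) : Prop :=
  (forall u v, p (u + v) <= p u + p v) /\
  (forall (c : R[i]) v, p (c *: v) = complex.Re `|c| * p v).

Definition defining_system (Q : set (V -> R)) : Prop :=
  [/\ forall q, Q q -> is_seminorm q,
      forall q, Q q -> continuous q &
      forall v : V, nbhs v =
        seminorm_nbhs (fun (q : Q) (u : V) => (\val q u)%:E) setT v].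

End LocallyConvex.

Section Smooth.
Context (R : realType) (V : tvsType R[i]) (k : nat).
Implicit Types (F : 'rV[R]_k -> V) (i : 'I_k).

Definition diff_quotient i F (x : 'rV[R]_k) (h : R) : V :=
  (h^-1)%:C *: (F (x + h *: delta_mx 0 i) - F x).

Definition partial i F (x : 'rV[R]_k) : V :=
  xget 0 [set v : V | diff_quotient i F x h @[h --> (0 : R)^'] --> v].

Fixpoint Ck (r : nat) F : Prop :=
  continuous F /\
  if r is r'.+1 then
    forall i, (forall x, exists v : V,
                 diff_quotient i F x h @[h --> (0 : R)^'] --> v) /\
              Ck r' (partial i F)
  else True.

Definition smooth F : Prop := forall r, Ck r F.

Definition multi_index := {ffun 'I_k -> nat}.

Definition pderiv (mu : multi_index) F : 'rV[R]_k -> V :=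
  foldr (fun i G => iter (mu i) (partial i) G) F (enum 'I_k).

Definition C0inf : set ('rV[R]_k -> V) :=
  [set F | smooth F /\ compact (closure [set x | F x != 0])].

End Smooth.

Section Integral.
Context (R : realType) (V : tvsType R[i]) (k : nat).
Implicit Types (F : 'rV[R]_k -> V) (a : R) (N : nat).

(* Degenerate cells are allowed, which does not change the set of Riemann sums
   but permits using the same number N of cells in all coordinates. *)
Definition is_partition a N (t : nat -> R) : Prop :=
  [/\ t 0%N = - a, t N = a & forall j, (j < N)%N -> t j <= t j.+1].

(* A cell of the product partition is given by c : {ffun 'I_k -> 'I_N}, its
   tag is xi c. *)
Definition riemann_sum N (t : 'I_k -> nat -> R)
    (xi : {ffun 'I_k -> 'I_N} -> 'rV[R]_k) F : V :=
  \sum_(c : {ffun 'I_k -> 'I_N})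
    (\prod_(i < k) (t i (c i).+1 - t i (c i)))%:C *: F (xi c).

(* v is the Riemann integral of F over the cube [-a, a]^k. *)
Definition is_cube_integral a F (v : V) : Prop :=
  forall U : set V, nbhs v U -> exists2 d : R, 0 < d &
    forall N (t : 'I_k -> nat -> R) (xi : {ffun 'I_k -> 'I_N} -> 'rV[R]_k),
      (forall i, is_partition a N (t i)) ->
      (forall i j, (j < N)%N -> t i j.+1 - t i j < d) ->
      (forall (c : {ffun 'I_k -> 'I_N}) i,
         t i (c i) <= xi c 0 i <= t i (c i).+1) ->
      U (riemann_sum t xi F).

Definition integral_Rk F : V :=
  xget 0 [set v | exists2 a : R,
    0 < a /\ [set x | F x != 0] `<=` [set x | forall i, `|x 0 i| <= a] &
    is_cube_integral a F v].

End Integral.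

Section Symbols.
Context (R : realType) (V : tvsType R[i]) (Q : set (V -> R)) (k : nat).
Implicit Types (m rho : Q -> R) (F : 'rV[R]_k -> V).

(* The norm on 'rV[R]_k provided by the library is the maximum norm. *)
Definition eucl_norm (x : 'rV[R]_k) : R := Num.sqrt (\sum_(i < k) x 0 i ^+ 2).

Definition symbol_norm m rho (qmu : Q * multi_index k) F : \bar R :=
  let: (q, mu) := qmu in
  ereal_sup (range (fun x : 'rV[R]_k =>
    ((1 + eucl_norm x ^+ 2)
       `^ (- (1 / 2) * (m q - rho q * (\sum_(i < k) mu i)%N%:R))
     * \val q (pderiv mu F x))%:E)).

Definition symbols m rho : set ('rV[R]_k -> V) :=
  [set F | smooth F /\ forall qmu, (symbol_norm m rho qmu F < +oo)%E].

Definition symbol_nbhs m rho F : set_system ('rV[R]_k -> V) :=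
  seminorm_nbhs (symbol_norm m rho) (symbols m rho) F.

Definition approximates m rho (u : nat -> ('rV[R]_k -> V)) F : Prop :=
  (forall j, C0inf (u j)) /\ u @ \oo `=>` symbol_nbhs m rho F.

End Symbols.

Definition is_type (R : realType) (V : tvsType R[i]) (Q : set (V -> R))
    (rho : Q -> R) : Prop :=
  forall q, -1 < rho q <= 1.

Definition admissible (R : realType) (V : tvsType R[i]) (Q : set (V -> R))
    (m rho m' rho' : Q -> R) : Prop :=
  (forall q, m q < m' q) /\ (forall q, -1 < rho' q <= rho q).

Definition nondegenerate_form (R : realType) (n : nat)
    (B : {biscalar 'rV[R]_n}) : Prop :=
  (forall p, (forall x, B p x = 0) -> p = 0) /\
  (forall x, (forall p, B p x = 0) -> x = 0).

Section Oscillatory.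
Context (R : realType) (V : tvsType R[i]) (n : nat) (B : {biscalar 'rV[R]_n}).
Implicit Types F : 'rV[R]_(n + n) -> V.

(* exp(i<p, x>) at z = (p, x) *)
Definition phase (z : 'rV[R]_(n + n)) : R[i] :=
  let: s := B (lsubmx z) (rsubmx z) in cos s +i* sin s.

Definition I0 F : V :=
  ((2 * pi) ^- n)%:C *: integral_Rk (fun z => phase z *: F z).

(* The value at F of the extension of I0 by continuity in the topology of the
   symbols of order m' and type rho'. *)
Definition osc_integral (Q : set (V -> R)) (m' rho' : Q -> R) F : V :=
  xget 0 [set v | exists2 u, approximates m' rho' u F & (I0 \o u) @ \oo --> v].

End Oscillatory.

(* Main.v *)
(* Everything rests on one estimate: for each q there are N and K such that
   q (I0 F) <= K A for every F in C0inf whose symbol seminorms for q with at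
   most N derivatives are bounded by A. The phase is a non-degenerate quadratic
   form of z = (p, x), so its gradient is an invertible linear function of z and
   multiplication of exp(i <p, x>) by a coordinate z_l is a constant coefficient
   derivation D_l. Dividing by 1 + |z|^2 and integrating 1 + sum_l z_l D_l by
   parts turns F into L F, where L lowers the order by 1 + rho > 0 and costs one
   derivative; after sufficiently many steps the integrand is dominated by
   prod_i 1 / (1 + z_i^2). That the integral of a derivative vanishes is seen on
   lattice Riemann sums, where the difference quotient telescopes.

   With chi_J (z) = e exp(-1 / (1 - |z|^2 / J)) the functions
   J^(d/2) (chi_J - 1) are bounded among the scalar symbols of order d > 0.
   Hence chi_J F tends to F in all the larger symbol spaces at once, and this
   one sequence computes every extension of I0 at F. *)

(* Values in [V] are compared one seminorm at a time: a mean value inequality and explicit Riemann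
   sums replace functionals and measure theory, and sequential completeness supplies the limits.
   Since each estimate involves a single q, orders and types may vary with q, and so may the number
   of integrations by parts.

   The gain 1 + rho has two sources: z_l / (1 + |z|^2) has order -1, and a derivative lowers the
   order by rho. This is where rho > -1 enters. The bound rho <= 1 makes scalar symbols of type 1
   act on symbols of type rho, and makes the undifferentiated term, of order -2, no worse than the
   others.

   Compactly supported functions are in general not dense in the symbols of order m, whence the gap
   m' > m: a part d <= m' - m of it pays for the factor J^(-d/2) in chi_J F - F. The functions chi_J
   F nevertheless stay bounded in the original symbol space, so that the estimate for m and rho
   themselves passes to the limit and gives continuity in the original topology. *)
Require Import Defs.
From mathcomp Require Import all_boot all_order all_algebra.
From mathcomp Require Import all_classical all_reals all_analysis.
From mathcomp Require Import ring lra.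

Set Implicit Arguments.
Unset Strict Implicit.
Unset Printing Implicit Defensive.

Import Order.TTheory GRing.Theory Num.Theory.
Import numFieldNormedType.Exports.

Local Open Scope classical_set_scope.
Local Open Scope ring_scope.
Local Open Scope complex_scope.

(** * Seminorms and convergence *)

Section Seminorms.
Context (R : realType) (V : tvsType R[i]) (q : V -> R).
Hypothesis q_seminorm : is_seminorm q.

Lemma seminorm_subadd u v : q (u + v) <= q u + q v.
Proof. exact: q_seminorm.1. Qed.

Lemma seminormZ (c : R[i]) v : q (c *: v) = complex.Re `|c| * q v.
Proof. exact: q_seminorm.2. Qed.

Lemma seminormZr (r : R) v : q (r%:C *: v) = `|r| * q v.
Proof. by rewrite seminormZ normc_def /= expr0n addr0 sqrtr_sqr. Qed.

Lemma seminorm0 : q 0 = 0.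
Proof. by rewrite -(scale0r (0 : V)) -[0 : R[i]]/(0%:C) seminormZr normr0 mul0r. Qed.

Lemma seminormN v : q (- v) = q v.
Proof. by rewrite -scaleN1r seminormZ normrN normr1 mul1r. Qed.

Lemma seminorm_distC u v : q (u - v) = q (v - u).
Proof. by rewrite -seminormN opprB. Qed.

Lemma seminorm_ge0 v : 0 <= q v.
Proof.
have := seminorm_subadd v (- v).
by rewrite subrr seminorm0 seminormN -mulr2n pmulrn_lge0.
Qed.

Lemma seminormB u v : q (u - v) <= q u + q v.
Proof. by rewrite -(seminormN v) seminorm_subadd. Qed.

Lemma seminorm_dist v u w : q (u - w) <= q (u - v) + q (v - w).
Proof. by rewrite -[u - w](subrKA v) seminorm_subadd. Qed.

Lemma seminorm_sum (I : Type) (s : seq I) (P : pred I) (f : I -> V) :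
  q (\sum_(i <- s | P i) f i) <= \sum_(i <- s | P i) q (f i).
Proof.
elim/big_ind2 : _ => [|u a v b ua vb|//]; first by rewrite seminorm0.
by rewrite (le_trans (seminorm_subadd _ _))// lerD.
Qed.

End Seminorms.

Lemma complex_scale_comm (R : realType) (V : tvsType R[i]) (a b : R[i]) (v : V) :
  a *: (b *: v) = b *: (a *: v).
Proof. by rewrite !scalerA mulrC. Qed.

Lemma normc_Re_ge0 (R : realType) (c : R[i]) : 0 <= complex.Re `|c|.
Proof. by rewrite normc_def /= sqrtr_ge0. Qed.

Lemma nbhs_rVP (R : realType) k (x : 'rV[R]_k) (P : set 'rV[R]_k) :
  nbhs x P <-> exists2 d : R, 0 < d &
    forall y : 'rV[R]_k, (forall i, `|y 0 i - x 0 i| < d) -> P y.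
Proof.
split=> [/nbhs_ballP[d d0 xdP]|[d d0 dP]].
  exists d => // y xy; apply: xdP; split=> // i j.
  by rewrite ord1 /ball /= distrC; exact: xy.
apply/nbhs_ballP; exists d => //= y [_ xy]; apply: dP => i.
by have := xy 0 i; rewrite /ball /= distrC.
Qed.

Section LocallyConvexTopology.
Context (R : realType) (V : tvsType R[i]) (Q : set (V -> R)).

Lemma seminorm_nbhs_filter (E : zmodType) (I : Type)
    (p : I -> E -> \bar R) (A : set E) (f : E) :
  A f -> Filter (seminorm_nbhs p A f).
Proof.
move=> Af; apply: filter_from_filter => [|[D d] [D' d'] /= [fD d0] [fD' d'0]].
  by exists (set0, 1); split => /=.
exists (D `|` D', Num.min d d') => /=.
  by split; [rewrite finite_setU|rewrite lt_min d0].
move=> g [Ag gDD']; split; split=> // i Di.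
  have /lt_le_trans := gDD' i (or_introl Di); apply.
  by rewrite lee_fin ge_min lexx.
have /lt_le_trans := gDD' i (or_intror Di); apply.
by rewrite lee_fin ge_min lexx orbT.
Qed.

Hypothesis defQ : defining_system Q.

Let seminormQ q : Q q -> is_seminorm q. Proof. by case: defQ => + _ _; apply. Qed.

Lemma nbhsVE v : nbhs v =
  seminorm_nbhs (fun (q : Q) (u : V) => (\val q u)%:E) setT v.
Proof. by case: defQ. Qed.

Lemma nbhs_seminorm (q : V -> R) v (e : R) : Q q -> 0 < e ->
  nbhs v [set u | q (u - v) < e].
Proof.
move=> Qq e0; rewrite nbhsVE.
exists ([set (exist _ q (mem_set Qq) : Q)], e) => /=.
  by split.
by move=> u [_ /(_ _ erefl)] /=; rewrite lte_fin.
Qed.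

(** A basic neighbourhood involves only finitely many seminorms, and a filter is stable under finite
    intersections. *)
Lemma cvg_seminormP (T : Type) (F : set_system T) (FF : Filter F)
    (f : T -> V) (v : V) :
  f @ F --> v <-> forall q, Q q -> forall e : R, 0 < e ->
    \forall t \near F, q (f t - v) < e.
Proof.
split=> [fv q Qq e e0|fv]; first exact: (fv _ (nbhs_seminorm v Qq e0)).
rewrite nbhsVE => U [[D d]] /= [finD d0 DU].
have : F (\bigcap_(q in D) [set t | \val q (f t - v) < d]).
  have [X ->] := finite_fsetP.1 finD.
  apply: filter_bigI => q _; apply: fv => //.
  by have := valP q; rewrite inE.
apply: (@filterS _ F FF) => t tD; by apply: DU; split=> //.
Qed.

Lemma continuous_seminormP k (F : 'rV[R]_k -> V) : continuous F <->
  forall (x : 'rV[R]_k) q, Q q -> forall e : R, 0 < e -> exists2 d : R, 0 < d &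
    forall y : 'rV[R]_k, (forall i, `|y 0 i - x 0 i| < d) -> q (F y - F x) < e.
Proof.
split=> [cF x q Qq e e0|cF x].
  have /(cvg_seminormP (nbhs_filter x))/(_ _ Qq _ e0)/nbhs_rVP := cF x.
  exact.
apply/(cvg_seminormP (nbhs_filter x)) => q Qq e e0.
by apply/nbhs_rVP; exact: cF.
Qed.

Hypothesis hV : hausdorff_space V.

(** If all seminorms vanish at [v], then 0 lies in every neighbourhood of [v], so that 0 and [v]
    cannot be separated. *)
Lemma seminorm_eq0 (v : V) : (forall q, Q q -> q v = 0) -> v = 0.
Proof.
move=> qv; apply/esym/hV => A B /nbhs_singleton A0.
rewrite nbhsVE => -[[D d] /= [_ d0]]; apply: contraPP => /= AB DB.
apply: AB; exists 0; split => //; apply: DB; split => // q _.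
by rewrite sub0r (seminormN (seminormQ _)) ?qv ?lte_fin//;
  have := valP q; rewrite inE.
Qed.

Lemma seminorm_small_eq (u v : V) :
  (forall q, Q q -> forall e : R, 0 < e -> q (u - v) <= e) -> u = v.
Proof.
move=> uv; apply/eqP; rewrite -subr_eq0; apply/eqP/seminorm_eq0 => q Qq.
apply/eqP; rewrite eq_le (seminorm_ge0 (seminormQ Qq)) andbT.
by apply/ler_addgt0Pl => e e0; rewrite addr0 uv.
Qed.

Lemma cvg_seminorm_unique (T : Type) (F : set_system T) (FF : ProperFilter F)
  (f : T -> V) (u v : V) : f @ F --> u -> f @ F --> v -> u = v.
Proof.
move=> /cvg_seminormP fu /cvg_seminormP fv.
apply: seminorm_small_eq => q Qq e e0.
have e20 : 0 < e / 2 by rewrite divr_gt0.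
have [t [ut vt]] := filter_ex (filterI (fu q Qq _ e20) (fv q Qq _ e20)).
rewrite (le_trans (seminorm_dist (seminormQ Qq) (f t) _ _))//.
by rewrite [leRHS]splitr lerD// ltW// (seminorm_distC (seminormQ Qq)).
Qed.

Lemma cvg_seminorm_le (T : Type) (F : set_system T) (FF : ProperFilter F)
    (f : T -> V) (v : V) q (M : R) : Q q -> f @ F --> v ->
  (\forall t \near F, q (f t) <= M) -> q v <= M.
Proof.
move=> Qq /cvg_seminormP fv fM; apply/ler_addgt0Pl => e e0.
have [t [tv tM]] := filter_ex (filterI (fv q Qq _ e0) fM).
rewrite -[v](subrK (f t)) (le_trans (seminorm_subadd (seminormQ Qq) _ _))//.
by rewrite lerD// ltW// (seminorm_distC (seminormQ Qq)).
Qed.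

Lemma cvg_seminormD (T : Type) (F : set_system T) (FF : Filter F)
  (f g : T -> V) (u v : V) : f @ F --> u -> g @ F --> v -> 
  (fun t => f t + g t) @ F --> u + v.
Proof.
move=> /cvg_seminormP fu /cvg_seminormP gv; apply/cvg_seminormP => q Qq e e0.
have e20 : 0 < e / 2 by rewrite divr_gt0.
apply: filterS (filterI (fu q Qq _ e20) (gv q Qq _ e20)) => t [/= ut vt].
rewrite opprD addrACA (le_lt_trans (seminorm_subadd (seminormQ Qq) _ _))//.
by rewrite [ltRHS]splitr ltrD.
Qed.

Lemma cvg_seminormZ (T : Type) (F : set_system T) (FF : Filter F)
  (f : T -> V) (c : R[i]) (u : V) : f @ F --> u -> (fun t => c *: f t) @ F --> c *: u.
Proof.
move=> /cvg_seminormP fu; apply/cvg_seminormP => q Qq e e0.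
have c0 := normc_Re_ge0 c.
have c1 : 0 < complex.Re `|c| + 1 by rewrite ltr_wpDl.
apply: filterS (fu q Qq _ (divr_gt0 e0 c1)) => t /= ut.
rewrite -scalerBr (seminormZ (seminormQ Qq)).
have : (complex.Re `|c| + 1) * q (f t - u) < e by rewrite mulrC -ltr_pdivlMr.
by apply: le_lt_trans; rewrite ler_wpM2r ?(seminorm_ge0 (seminormQ Qq))// lerDl.
Qed.

Lemma seminorm_cauchyP (u : nat -> V) :
  (forall q, Q q -> forall e : R, 0 < e -> exists N, forall i j,
     (N <= i)%N -> (N <= j)%N -> q (u i - u j) < e) -> cauchy_seq u.
Proof.
move=> uC; apply/cvg_seminormP => q Qq e e0; have [N NP] := uC q Qq e e0.
exists ([set i | (N <= i)%N], [set i | (N <= i)%N]) => /=.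
  by split; exact: nbhs_infty_ge.
by move=> [i j] [/= iN jN]; rewrite subr0; exact: NP.
Qed.

End LocallyConvexTopology.

(** * The mean value inequality *)

Section Lines.
Context (R : realType) (k : nat).
Implicit Types (x : 'rV[R]_k) (i j : 'I_k).

Definition line x i (h : R) : 'rV[R]_k := x + h *: delta_mx 0 i.

Lemma lineE x i h j : line x i h 0 j = x 0 j + h * (j == i)%:R.
Proof. by rewrite !mxE eqxx. Qed.

Lemma line0 x i : line x i 0 = x.
Proof. by rewrite /line scale0r addr0. Qed.

Lemma line_line x i s t : line (line x i s) i t = line x i (s + t).
Proof. by rewrite /line scalerDl addrA. Qed.

Lemma lineC x i j s t : line (line x i s) j t = line (line x j t) i s.
Proof. by rewrite /line addrAC. Qed.

Lemma dist_line x i h j : `|line x i h 0 j - x 0 j| <= `|h|.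
Proof.
rewrite lineE addrAC subrr add0r normrM; case: eqP => _.
  by rewrite normr1 mulr1.
by rewrite normr0 mulr0.
Qed.

End Lines.

Section Derivatives.
Context (R : realType) (V : tvsType R[i]) (Q : set (V -> R)).
Hypotheses (defQ : defining_system Q) (hV : hausdorff_space V).

Let seminormQ q : Q q -> is_seminorm q. Proof. by case: defQ => + _ _; apply. Qed.

(** Differentiability in its little-o form. There is no division by [h], and the weak inequality
    covers [h = 0], so that remainders can simply be added. *)
Definition has_d (f : R -> V) (t : R) (v : V) : Prop :=
  forall q, Q q -> forall e : R, 0 < e -> exists2 d : R, 0 < d &
    forall h, `|h| < d -> q (f (t + h) - f t - h%:C *: v) <= e * `|h|.

Lemma has_dD f g t u v : has_d f t u -> has_d g t v ->
  has_d (f \+ g) t (u + v).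
Proof.
move=> df dg q Qq e e0; have e20 : 0 < e / 2 by rewrite divr_gt0.
have [d d0 fd] := df q Qq _ e20; have [d' d'0 gd] := dg q Qq _ e20.
exists (Num.min d d'); first by rewrite lt_min d0.
move=> h; rewrite lt_min => /andP[/fd hf /gd hg].
rewrite [e]splitr mulrDl (le_trans _ (lerD hf hg))//.
rewrite (le_trans _ (seminorm_subadd (seminormQ Qq) _ _))//.
rewrite le_eqVlt; apply/orP; left; apply/eqP; congr q => /=.
by rewrite scalerDr !opprD [f _ + _ + (_ + _)]addrACA [RHS]addrACA.
Qed.

Lemma has_dZ (c : R[i]) f t v : has_d f t v -> has_d (c \*: f) t (c *: v).
Proof.
move=> df q Qq e e0; have c0 := normc_Re_ge0 c.
have c1 : 0 < complex.Re `|c| + 1 by rewrite ltr_wpDl.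
have [d d0 fd] := df q Qq _ (divr_gt0 e0 c1); exists d => // h /fd hd /=.
rewrite complex_scale_comm -!scalerBr (seminormZ (seminormQ Qq)).
have := ler_wpM2l c0 hd; move/le_trans; apply.
rewrite mulrCA mulrA ler_wpM2r// mulrAC ler_pdivrMr//.
by rewrite ler_wpM2l// ?lerDl// ltW.
Qed.

Lemma has_d_linear t v : has_d (fun s : R => s%:C *: v) t v.
Proof.
move=> q Qq e e0; exists 1 => // h _.
rewrite rmorphD scalerDl [_ + h%:C *: _]addrC addrK subrr.
by rewrite (seminorm0 (seminormQ Qq)) mulr_ge0// ltW.
Qed.

Lemma has_dB f g t u v : has_d f t u -> has_d g t v ->
  has_d (f \- g) t (u - v).
Proof.
move=> df /(has_dZ (-1)) dg; rewrite -scaleN1r.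
suff -> : f \- g = f \+ ((-1) \*: g) by exact: has_dD.
by apply/funext => s /=; rewrite scaleN1r.
Qed.

Lemma has_d_unique f t u v : has_d f t u -> has_d f t v -> u = v.
Proof.
move=> fu fv; apply: (seminorm_small_eq defQ hV) => q Qq e e0.
have e20 : 0 < e / 2 by rewrite divr_gt0.
have [d d0 ud] := fu q Qq _ e20; have [d' d'0 vd] := fv q Qq _ e20.
pose h := Num.min d d' / 2.
have m0 : 0 < Num.min d d' by rewrite lt_min d0.
have h0 : 0 < h by rewrite divr_gt0.
have : `|h| < Num.min d d' by rewrite gtr0_norm// /h ltr_pdivrMr// mulr_natr mulr2n ltrDl.
rewrite lt_min => /andP[/ud hu /vd hv].
have E : h%:C *: (u - v) =
    (f (t + h) - f t - h%:C *: v) - (f (t + h) - f t - h%:C *: u).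
  by rewrite scalerBr opprB [RHS]addrC subrKA.
rewrite -(ler_pM2l h0) -[X in X * _ <= _](gtr0_norm h0).
rewrite -(seminormZr (seminormQ Qq)) E. 
apply: le_trans (seminormB (seminormQ Qq) _ _) _.
rewrite gtr0_norm// in hu hv; rewrite [e]splitr mulrDr ![h * _]mulrC.
exact: lerD.
Qed.

(** A continuity argument along the segment: the slack [e] absorbs the remainder of the derivative
    at each point, so the set where the bound holds reaches up to [b]. *)
Lemma mean_value_le q (f D : R -> V) (b M : R) : Q q -> 0 <= b ->
    (forall t, 0 <= t <= b -> has_d f t (D t)) ->
    (forall t, 0 <= t <= b -> q (D t) <= M) ->
  q (f b - f 0) <= M * b.
Proof.
move=> Qq b0 fD DM; have sq := seminormQ Qq.
suff H e : 0 < e -> q (f b - f 0) <= (M + e) * b.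
  apply/ler_addgt0Pl => e e0.
  have b1 : 0 < b + 1 by rewrite ltr_wpDl.
  rewrite (le_trans (H _ (divr_gt0 e0 b1)))// mulrDl addrC lerD2r.
  by rewrite mulrAC ler_pdivrMr// ler_wpM2l ?lerDl// ltW.
move=> e0.
have loc c : 0 <= c <= b -> exists2 d, 0 < d & forall h, `|h| < d ->
    q (f (c + h) - f c) <= (M + e) * `|h|.
  move=> cb; have [d d0 dP] := fD _ cb q Qq e e0; exists d => // h /dP hP.
  rewrite -[f _ - f c](subrK (h%:C *: D c)) (le_trans (seminorm_subadd sq _ _))//.
  by rewrite addrC mulrDl lerD// (seminormZr sq) mulrC ler_wpM2r// DM.
(* The supremum [c] of [S] belongs to [S], and if [c < b] the local bound at [c] produces a larger
   element. *)
pose S := [set t | 0 <= t <= b /\ q (f t - f 0) <= (M + e) * t].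
have S0 : S 0 by split; rewrite ?lexx// subrr (seminorm0 sq) mulr0.
have Sb : ubound S b by move=> t [/andP[]].
have supS : has_sup S by split; [exists 0|exists b].
set c := sup S.
have c0 : 0 <= c by apply: ub_le_sup => //; exists b.
have cb : c <= b by apply: ge_sup => //; exists 0.
have c0b : 0 <= c <= b by rewrite c0.
have [d d0 dP] := loc c c0b.
have Sc : S c.
  split => //.
  have [t St ct] := sup_adherent d0 supS.
  have tc : t <= c by apply: ub_le_sup => //; exists b.
  have td : `|t - c| < d by rewrite ler0_norm ?subr_le0// opprB ltrBlDr -ltrBlDl.
  have := dP _ td; rewrite [c + _]addrC subrK ler0_norm ?subr_le0// opprB => tP.
  rewrite (le_trans (seminorm_dist sq (f t) _ _))// -[in leRHS](subrK t c) mulrDr.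
  by rewrite lerD//; [rewrite (seminorm_distC sq)|case: St].
have [cltb|] := ltP c b; last first.
  by move=> bc; have <- : c = b; [apply/eqP; rewrite eq_le cb|exact: Sc.2].
pose h := Num.min (b - c) (d / 2).
have h0 : 0 < h by rewrite lt_min subr_gt0 cltb divr_gt0.
have hd : `|h| < d.
  by rewrite gtr0_norm// gt_min ltr_pdivrMr// mulr_natr mulr2n ltrDl d0 orbT.
have : S (c + h).
  split; first by rewrite addr_ge0 ?(ltW h0)//= -lerBrDl ge_min lexx.
  rewrite (le_trans (seminorm_dist sq (f c) _ _))// addrC mulrDr lerD//.
    exact: Sc.2.
  by have := dP _ hd; rewrite gtr0_norm.
move=> /(ub_le_sup (ex_intro _ b Sb)); rewrite -/c gerDl => /(lt_le_trans h0).
by rewrite ltxx.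
Qed.

Lemma mean_value_diff_le q (f D : R -> V) (v : V) (b M : R) : Q q -> 0 <= b ->
    (forall t, 0 <= t <= b -> has_d f t (D t)) ->
    (forall t, 0 <= t <= b -> q (D t - v) <= M) ->
  q (f b - f 0 - b%:C *: v) <= M * b.
Proof.
move=> Qq b0 fD DM.
have := @mean_value_le q (f \- (fun s => s%:C *: v)) (fun t => D t - v) b M.
rewrite /= scale0r subr0 addrAC; apply => // t tb.
by apply: has_dB; [exact: fD|exact: has_d_linear].
Qed.

End Derivatives.

(** * Partial derivatives *)

Section PartialDerivatives.
Context (R : realType) (V : tvsType R[i]) (Q : set (V -> R)) (k : nat).
Hypotheses (defQ : defining_system Q) (hV : hausdorff_space V).
Implicit Types (F G : 'rV[R]_k -> V) (x : 'rV[R]_k) (i j : 'I_k).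

Let seminormQ q : Q q -> is_seminorm q. Proof. by case: defQ => + _ _; apply. Qed.

Definition has_pd i F x (v : V) : Prop :=
  has_d Q (fun h => F (line x i h)) 0 v.

Lemma has_pd_line i F x t v :
  has_pd i F (line x i t) v -> has_d Q (fun s => F (line x i s)) t v.
Proof.
move=> dF q Qq e e0; have [d d0 dP] := dF q Qq e e0; exists d => // h /dP.
by rewrite add0r line_line line0.
Qed.

Lemma has_pdP i F x (v : V) :
  (diff_quotient i F x h @[h --> (0 : R)^'] --> v) <-> has_pd i F x v.
Proof.
have eqq (h : R) q : Q q -> h != 0 ->
    `|h| * q (diff_quotient i F x h - v) = q (F (line x i h) - F x - h%:C *: v).
  move=> Qq h0; rewrite -(seminormZr (seminormQ Qq)) scalerBr scalerA -rmorphM.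
  by rewrite divff// scale1r.
have fil := @dnbhs_filter _ (0 : R).
split=> [/(cvg_seminormP defQ fil) dF q Qq e e0|dF].
  have := dF q Qq e e0; rewrite near_withinE => /nbhs_ballP[d /= d0 dP].
  exists d => // h hd; rewrite add0r line0.
  have [->|h0] := eqVneq h 0.
    rewrite line0 subrr scale0r subr0 (seminorm0 (seminormQ Qq)).
    by rewrite normr0 mulr0.
  rewrite -eqq// mulrC ler_wpM2r// ltW//; apply: dP => //.
  by rewrite /ball /= sub0r normrN.
apply/(cvg_seminormP defQ fil) => q Qq e e0.
(* Half of [e], because [has_pd] gives a weak inequality and the limit asks for a strict one. *)
have [d d0 dP] := dF q Qq _ (divr_gt0 e0 (ltr0n _ 2)).
rewrite near_withinE; apply/nbhs_ballP; exists d => //= h.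
rewrite /ball /= sub0r normrN => /dP + h0; rewrite add0r line0 -eqq//.
rewrite mulrC ler_pM2r ?normr_gt0// => /le_lt_trans; apply.
by rewrite ltr_pdivrMr// mulr_natr mulr2n ltrDl.
Qed.

Lemma partialE i F x v : has_pd i F x v -> partial i F x = v.
Proof.
move=> dF; rewrite /partial; apply: xget_subset1; first exact/has_pdP.
by move=> u w /has_pdP du /has_pdP dw; exact: has_d_unique du dw.
Qed.

Lemma ex_has_pd i F x :
  (exists v : V, diff_quotient i F x h @[h --> (0 : R)^'] --> v) ->
  has_pd i F x (partial i F x).
Proof. by move=> [v /has_pdP dF]; rewrite (partialE dF). Qed.

Lemma Ck_continuous r F : Ck r F -> continuous F.
Proof. by case: r => [|r] []. Qed.

Lemma Ck_has_pd r F i x : Ck r.+1 F -> has_pd i F x (partial i F x).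
Proof. by move=> [_ /(_ i)[/(_ x)]] /ex_has_pd. Qed.

Lemma Ck_partial r F i : Ck r.+1 F -> Ck r (partial i F).
Proof. by move=> [_ /(_ i)[]]. Qed.

(** Since [partial] is a chosen limit, regularity is established by exhibiting candidates [G] for
    the derivatives. *)
Lemma CkS r F (G : 'I_k -> 'rV[R]_k -> V) : continuous F ->
  (forall i x, has_pd i F x (G i x)) -> (forall i, Ck r (G i)) -> Ck r.+1 F.
Proof.
move=> cF dF CG; split=> // i; split=> [x|].
  by exists (G i x); exact/has_pdP.
have -> : partial i F = G i by apply/funext => x; exact: partialE.
exact: CG.
Qed.

Lemma Ck_pred r F : Ck r.+1 F -> Ck r F.
Proof.
elim: r F => [|r IH] F CF; first by split=> //; exact: Ck_continuous CF.
apply: (CkS (Ck_continuous CF)) => [i x|i]; first exact: Ck_has_pd CF.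
exact/IH/Ck_partial.
Qed.

Lemma smooth_continuous F : smooth F -> continuous F.
Proof. by move=> /(_ 0%N); exact: Ck_continuous. Qed.

Lemma smooth_has_pd F i x : smooth F -> has_pd i F x (partial i F x).
Proof. by move=> /(_ 1%N); exact: Ck_has_pd. Qed.

Lemma smooth_partial F i : smooth F -> smooth (partial i F).
Proof. by move=> sF r; exact: Ck_partial. Qed.

Lemma has_pd_linear (c : R[i]) F G i x u v :
  has_pd i F x u -> has_pd i G x v -> has_pd i (c *: F + G) x (c *: u + v).
Proof. by move=> /(has_dZ defQ c) dF /(has_dD defQ dF). Qed.

Lemma partial_linear (c : R[i]) F G i :
    (forall x, has_pd i F x (partial i F x)) ->
    (forall x, has_pd i G x (partial i G x)) ->
  partial i (c *: F + G) = c *: partial i F + partial i G.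
Proof. by move=> dF dG; apply/funext => x; exact/partialE/has_pd_linear. Qed.

Lemma continuous_linear (c : R[i]) F G :
  continuous F -> continuous G -> continuous (c *: F + G).
Proof.
move=> cF cG x.
have cZ := cvg_seminormZ defQ (nbhs_filter x) (c := c) (cF x).
exact: (cvg_seminormD defQ (nbhs_filter x) cZ (cG x)).
Qed.

Lemma Ck_linear r (c : R[i]) F G : Ck r F -> Ck r G -> Ck r (c *: F + G).
Proof.
elim: r F G => [|r IH] F G CF CG.
  by split=> //; apply: continuous_linear; exact: (@Ck_continuous 0).
apply: (@CkS _ _ (fun i => c *: partial i F + partial i G)).
- by apply: continuous_linear; [exact: Ck_continuous CF|exact: Ck_continuous CG].
- by move=> i x; apply: has_pd_linear; [exact: Ck_has_pd CF|exact: Ck_has_pd CG].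
- by move=> i; apply: IH; exact: Ck_partial.
Qed.

Lemma smooth_linear (c : R[i]) F G : smooth F -> smooth G -> smooth (c *: F + G).
Proof. by move=> sF sG r; exact: Ck_linear. Qed.

Lemma has_pd0 i x : has_pd i 0 x 0.
Proof.
move=> q Qq e e0; exists 1 => // h _.
by rewrite scaler0 !subr0 (seminorm0 (seminormQ Qq)) mulr_ge0// ltW.
Qed.

Lemma partial0 i : partial i (0 : 'rV[R]_k -> V) = 0.
Proof. by apply/funext => x; apply/partialE; exact: has_pd0. Qed.

Lemma smooth0 : smooth (0 : 'rV[R]_k -> V).
Proof.
have c0 : continuous (0 : 'rV[R]_k -> V).
  apply/(continuous_seminormP defQ) => x q Qq e e0; exists 1 => // y _.
  by rewrite subrr (seminorm0 (seminormQ Qq)).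
elim=> [//|r IH]; apply: (@CkS _ _ (fun=> 0)) => // i x; exact: has_pd0.
Qed.

Lemma smoothZ (c : R[i]) F : smooth F -> smooth (c *: F).
Proof. by move=> sF; rewrite -[c *: F]addr0; exact: smooth_linear smooth0. Qed.

Lemma smoothD F G : smooth F -> smooth G -> smooth (F + G).
Proof. by move=> sF sG; rewrite -[F]scale1r; exact: smooth_linear. Qed.

Lemma smoothB F G : smooth F -> smooth G -> smooth (F - G).
Proof. by move=> sF sG; rewrite addrC -scaleN1r; exact: smooth_linear. Qed.

Lemma smooth_sum (I : Type) (s : seq I) (P : pred I) (f : I -> 'rV[R]_k -> V) :
  (forall l, smooth (f l)) -> smooth (\sum_(l <- s | P l) f l).
Proof.
move=> sf; elim/big_rec : _ => [|l F _]; first exact: smooth0.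
exact: smoothD.
Qed.

(** The mean value inequality is used twice: in direction [j] for the increment of [F] in direction
    [i], then in direction [i] for the increment of [partial j F]. *)
Lemma second_difference q F i j x (e : R) : Q q -> Ck 2 F -> 0 < e ->
  exists2 d : R, 0 < d & forall h, 0 <= h < d ->
    q (F (line (line x i h) j h) - F (line x j h) - (F (line x i h) - F x)
       - h%:C *: (h%:C *: partial i (partial j F) x)) <= e * h * h.
Proof.
move=> Qq CF e0.
have cD : continuous (partial i (partial j F)).
  by apply: (@Ck_continuous 0); do 2!apply: Ck_partial.
have [d d0 dP] := (continuous_seminormP defQ _).1 cD x q Qq e e0.
(* The point at which the mixed derivative is evaluated is displaced twice, by at most [h] each
   time. *)
exists (d / 2); first by rewrite divr_gt0.
move=> h /andP[h0 hd].
pose g t := F (line (line x i h) j t) - F (line x j t).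
pose g' t := partial j F (line (line x i h) j t) - partial j F (line x j t).
have -> : F (line (line x i h) j h) - F (line x j h) - (F (line x i h) - F x) =
  g h - g 0 by rewrite /g !line0.
apply: (mean_value_diff_le defQ (D := g')) => // t /andP[t0 th].
  by apply: (has_dB defQ); apply: has_pd_line; exact: Ck_has_pd CF.
rewrite /g' lineC -{2}(line0 (line x j t) i).
apply: (mean_value_diff_le defQ
  (f := fun s => partial j F (line (line x j t) i s))
  (D := fun s => partial i (partial j F) (line (line x j t) i s))) => //.
  by move=> s _; apply: has_pd_line; exact: Ck_has_pd (Ck_partial j CF).
move=> s /andP[s0 sh]; apply/ltW/dP => l.
rewrite -[_ - x 0 l](subrKA (line x j t 0 l)) (le_lt_trans (ler_normD _ _))//.
rewrite (le_lt_trans (lerD (dist_line _ _ _ _) (dist_line _ _ _ _)))//.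
by rewrite !ger0_norm// [d]splitr ltrD// (le_lt_trans _ hd).
Qed.

(** The second difference over a square of side [h] is symmetric in [i] and [j], and it approximates
    [h * h] times either mixed derivative. *)
Lemma partialC F i j : Ck 2 F ->
  partial i (partial j F) = partial j (partial i F).
Proof.
move=> CF; apply/funext => x.
apply: (seminorm_small_eq defQ hV) => q Qq e e0.
have e20 : 0 < e / 2 by rewrite divr_gt0.
have [d d0 dP] := second_difference i j x Qq CF e20.
have [d' d'0 d'P] := second_difference j i x Qq CF e20.
pose h := Num.min d d' / 2.
have m0 : 0 < Num.min d d' by rewrite lt_min d0.
have h0 : 0 < h by rewrite divr_gt0.
have : h < Num.min d d' by rewrite /h ltr_pdivrMr// mulr_natr mulr2n ltrDl.
rewrite lt_min => /andP[hd hd'].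
have {}dP := dP h; have {}d'P := d'P h.
rewrite (ltW h0) /= in dP d'P; move: (dP hd) (d'P hd') => {dP d'P}.
have swap (a b c f : V) : a - c - (b - f) = a - b - (c - f).
  by rewrite !opprB addrACA [RHS]addrACA [- c - b]addrC.
rewrite (lineC x j i) swap.
set X := _ - _ - (_ - _) => H1 H2.
have hh0 : 0 < h * h by rewrite mulr_gt0.
rewrite -(ler_pM2l hh0) -[X in X * _ <= _](gtr0_norm hh0).
rewrite -(seminormZr (seminormQ Qq)).
have -> : (h * h)%:C *: (partial i (partial j F) x - partial j (partial i F) x) =
    (X - h%:C *: (h%:C *: partial j (partial i F) x)) -
    (X - h%:C *: (h%:C *: partial i (partial j F) x)).
  by rewrite rmorphM -scalerA !scalerBr opprB [RHS]addrC subrKA.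
apply: le_trans (seminormB (seminormQ Qq) _ _) _.
rewrite [leRHS](_ : _ = e / 2 * h * h + e / 2 * h * h); last by field.
exact: (lerD H2 H1).
Qed.

Lemma smooth_iter_partial n F i : smooth F -> smooth (iter n (partial i) F).
Proof. by move=> sF; elim: n => //= n; exact: smooth_partial. Qed.

Lemma partial_iterC n F i j : smooth F ->
  partial i (iter n (partial j) F) = iter n (partial j) (partial i F).
Proof.
move=> sF; elim: n => //= n <-; apply: partialC.
exact: (smooth_iter_partial _ _ sF).
Qed.

Definition incr_index (mu : multi_index k) i : multi_index k :=
  [ffun l => (mu l + (l == i))%N].

Lemma sum_incr_index (mu : multi_index k) i :
  (\sum_(l < k) incr_index mu i l = (\sum_(l < k) mu l).+1)%N.
Proof.
under eq_bigr do rewrite ffunE.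
rewrite big_split /= -addn1; congr addn.
by rewrite (bigD1 i)//= eqxx big1 ?addn0// => l /negPf ->.
Qed.

Let pd (mu : multi_index k) (s : seq 'I_k) F :=
  foldr (fun i G => iter (mu i) (partial i) G) F s.

Let smooth_pd mu s F : smooth F -> smooth (pd mu s F).
Proof. by move=> sF; elim: s => //= i s; exact: smooth_iter_partial. Qed.

(** The new derivative is commuted inwards to the block of its own direction, which occurs exactly
    once in the enumeration. *)
Lemma partial_pderiv mu F i : smooth F ->
  partial i (pderiv mu F) = pderiv (incr_index mu i) F.
Proof.
move=> sF; rewrite /pderiv.
have : i \in enum 'I_k by rewrite mem_enum.
have : uniq (enum 'I_k) by rewrite enum_uniq.
elim: (enum 'I_k) => //= j s IH /andP[js us].
rewrite inE; have [ij _|ij /= si] := eqVneq i j.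
  rewrite -ij in js *.
  rewrite ffunE eqxx addn1 iterS; congr (partial _ (iter _ _ _)).
  elim: s js {IH us} => //= l s IH; rewrite inE negb_or => /andP[il /IH ->].
  by rewrite ffunE eq_sym (negPf il) addn0.
rewrite ffunE [j == i]eq_sym (negPf ij) addn0 partial_iterC ?IH//.
exact: (smooth_pd mu s sF).
Qed.

Lemma pderiv0 mu : pderiv mu (0 : 'rV[R]_k -> V) = 0.
Proof.
rewrite /pderiv; elim: (enum 'I_k) => //= i s ->.
by elim: (mu i) => //= n ->; exact: partial0.
Qed.

End PartialDerivatives.

(** * Comparison of Riemann sums *)

Section Overlap.
Context (R : realType).
Implicit Types (s t u v y : R).

(* The length of the intersection of [s, t] and [u, v] is written as an
   increment of the clamping function of [s, t], so that its sums over a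
   partition telescope. *)
Definition clamp s t y : R := Num.min (Num.max s y) t.
Definition overlap s t u v : R := clamp s t v - clamp s t u.

Lemma clamp_le s t y : y <= s -> s <= t -> clamp s t y = s.
Proof. by move=> ys st; rewrite /clamp max_l// min_l. Qed.

Lemma clamp_ge s t y : t <= y -> clamp s t y = t.
Proof. by move=> ty; rewrite /clamp min_r// le_max ty orbT. Qed.

(** Reduces statements on clamped values to the positions of [u] and [v] relative to the interval
    from [s] to [t], where only linear arithmetic remains. *)
Let cases s t u v (P : Prop) : s <= t -> u <= v ->
  (forall m1 m2 : R, clamp s t v = m1 -> clamp s t u = m2 ->
     ((m1 = s /\ v <= s) \/ (m1 = v /\ s <= v <= t) \/ (m1 = t /\ t <= v)) ->
     ((m2 = s /\ u <= s) \/ (m2 = u /\ s <= u <= t) \/ (m2 = t /\ t <= u)) -> P) ->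
  P.
Proof.
move=> st uv; apply; [reflexivity|reflexivity| |].
  have [vs|/ltW sv] := leP v s; first by left; rewrite clamp_le.
  have [tv|/ltW vt] := leP t v; first by right; right; rewrite clamp_ge.
  by right; left; rewrite /clamp max_r// min_l// sv vt.
have [vs|/ltW sv] := leP u s; first by left; rewrite clamp_le.
have [tv|/ltW vt] := leP t u; first by right; right; rewrite clamp_ge.
by right; left; rewrite /clamp max_r// min_l// sv vt.
Qed.

Lemma overlap_ge0 s t u v : s <= t -> u <= v -> 0 <= overlap s t u v.
Proof.
move=> st uv; rewrite /overlap; apply: (cases st uv) => m1 m2 -> -> H1 H2.
by case: H1 => [[-> ?]|[[-> /andP[? ?]]|[-> ?]]];
  case: H2 => [[-> ?]|[[-> /andP[? ?]]|[-> ?]]]; lra.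
Qed.

Lemma overlap_le s t u v : s <= t -> u <= v -> overlap s t u v <= v - u.
Proof.
move=> st uv; rewrite /overlap; apply: (cases st uv) => m1 m2 -> -> H1 H2.
by case: H1 => [[-> ?]|[[-> /andP[? ?]]|[-> ?]]];
  case: H2 => [[-> ?]|[[-> /andP[? ?]]|[-> ?]]]; lra.
Qed.

Lemma overlap_gt0 s t u v : s <= t -> u <= v -> 0 < overlap s t u v ->
  s <= v /\ u <= t.
Proof.
move=> st uv; rewrite /overlap; apply: (cases st uv) => m1 m2 -> -> H1 H2.
by case: H1 => [[-> ?]|[[-> /andP[? ?]]|[-> ?]]];
  case: H2 => [[-> ?]|[[-> /andP[? ?]]|[-> ?]]]; split; lra.
Qed.

Lemma overlapC s t u v : s <= t -> u <= v -> overlap s t u v = overlap u v s t.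
Proof.
move=> st uv; rewrite /overlap; apply: (cases st uv) => m1 m2 -> -> H1 H2.
apply: (cases uv st) => m3 m4 -> -> H3 H4.
by case: H1 => [[-> ?]|[[-> /andP[? ?]]|[-> ?]]];
  case: H2 => [[-> ?]|[[-> /andP[? ?]]|[-> ?]]];
  case: H3 => [[-> ?]|[[-> /andP[? ?]]|[-> ?]]];
  case: H4 => [[-> ?]|[[-> /andP[? ?]]|[-> ?]]]; lra.
Qed.

Lemma sum_overlap s t N (p : nat -> R) :
  \sum_(j < N) overlap s t (p j) (p j.+1) = clamp s t (p N) - clamp s t (p 0%N).
Proof.
rewrite -(big_mkord xpredT (fun j => overlap s t (p j) (p j.+1))).
by rewrite (telescope_sumr (fun j => clamp s t (p j))).
Qed.

Lemma partition_le a N (p : nat -> R) j : is_partition a N p ->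
  (j <= N)%N -> - a <= p j <= a.
Proof.
move=> [p0 pN pS] jN.
have mono i l : (i <= l)%N -> (l <= N)%N -> p i <= p l.
  elim: l => [|l IH]; first by rewrite leqn0 => /eqP ->.
  rewrite leq_eqVlt => /orP[/eqP -> //|il] lN.
  by rewrite (le_trans (IH il (ltnW lN)))// pS.
by have := mono 0%N j (leq0n j) jN; have := mono j N jN (leqnn N);
  rewrite p0 pN => -> ->.
Qed.

End Overlap.

(** * Overlaps of the cells of two cube partitions *)

Section CubePartitions.
Context (R : realType) (k N N' : nat) (a a' : R).
Context (t t' : 'I_k -> nat -> R).
Hypotheses (tP : forall i, is_partition a N (t i)).
Hypotheses (t'P : forall i, is_partition a' N' (t' i)).
Hypothesis aa' : a <= a'.
Implicit Types (c : {ffun 'I_k -> 'I_N}) (b : {ffun 'I_k -> 'I_N'}).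

Definition cell_volume n (p : 'I_k -> nat -> R) (c : {ffun 'I_k -> 'I_n}) : R :=
  \prod_(i < k) (p i (c i).+1 - p i (c i)).

Definition cell_overlap c b : R :=
  \prod_(i < k) overlap (t i (c i)) (t i (c i).+1) (t' i (b i)) (t' i (b i).+1).

Let tS c i : t i (c i) <= t i (c i).+1.
Proof. by case: (tP i) => _ _; apply. Qed.

Let t'S b i : t' i (b i) <= t' i (b i).+1.
Proof. by case: (t'P i) => _ _; apply. Qed.

Lemma cell_overlap_ge0 c b : 0 <= cell_overlap c b.
Proof. by apply: prodr_ge0 => i _; exact: overlap_ge0. Qed.

(** The sum of products factors over the coordinates, and in each of them the overlaps telescope.
    The larger cube contains the whole cell [c]. *)
Lemma sum_cell_overlap c : \sum_(b : {ffun 'I_k -> 'I_N'}) cell_overlap c b = cell_volume t c.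
Proof.
rewrite -(bigA_distr_bigA (fun i (j : 'I_N') =>
  overlap (t i (c i)) (t i (c i).+1) (t' i j) (t' i j.+1))).
apply: eq_bigr => i _; rewrite sum_overlap.
have /andP[h1 h2] := partition_le (tP i) (ltnW (ltn_ord (c i))).
have /andP[h3 h4] := partition_le (tP i) (ltn_ord (c i)).
have h5 : - a' <= t i (c i) by rewrite (le_trans _ h1)// lerN2.
have h6 : t i (c i).+1 <= a' by rewrite (le_trans h4).
by case: (t'P i) => -> -> _; rewrite clamp_ge ?clamp_le.
Qed.

Lemma sum_cell_overlap_le b : \sum_(c : {ffun 'I_k -> 'I_N}) cell_overlap c b <= cell_volume t' b.
Proof.
rewrite -(bigA_distr_bigA (fun i (j : 'I_N) =>
  overlap (t i j) (t i j.+1) (t' i (b i)) (t' i (b i).+1))).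
have tjS i (j : 'I_N) : t i j <= t i j.+1 by case: (tP i) => _ _; apply.
apply: ler_prod => i _; apply/andP; split.
  by apply: sumr_ge0 => j _; exact: overlap_ge0.
under eq_bigr do rewrite overlapC//.
rewrite (sum_overlap _ _ _ (t i)).
have : t i 0%N <= t i N.
  have /andP[] := partition_le (tP i) (leq0n N).
  by case: (tP i) => -> -> _ _; lra.
by move=> tN; rewrite -/(overlap _ _ _ _) overlapC// overlap_le.
Qed.

(** Only cells that stick out of the smaller cube are not exhausted by its cells. Near such a cell
    there are points outside the smaller cube, where a function supported in it vanishes. *)
Lemma cell_overlap_deficit b :
  \sum_(c : {ffun 'I_k -> 'I_N}) cell_overlap c b != cell_volume t' b ->
  exists i, t' i (b i) < - a \/ a < t' i (b i).+1.
Proof.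
apply: contraPP => /forallNP H; apply/negP; rewrite negbK.
rewrite -(bigA_distr_bigA (fun i (j : 'I_N) =>
  overlap (t i j) (t i j.+1) (t' i (b i)) (t' i (b i).+1))).
have tjS i (j : 'I_N) : t i j <= t i j.+1 by case: (tP i) => _ _; apply.
apply/eqP/eq_bigr => i _; under eq_bigr do rewrite overlapC//.
rewrite (sum_overlap _ _ _ (t i)); have /not_orP[/negP + /negP] := H i.
by case: (tP i) => -> -> _; rewrite -!leNgt => h1 h2; rewrite clamp_ge// clamp_le.
Qed.

Lemma sum_cell_volume : \sum_(b : {ffun 'I_k -> 'I_N'}) cell_volume t' b = (2 * a') ^+ k.
Proof.
rewrite -(bigA_distr_bigA (fun i (j : 'I_N') => t' i j.+1 - t' i j)).
rewrite -[in RHS](card_ord k) -prodr_const; apply: eq_bigr => i _.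
rewrite -(big_mkord xpredT (fun j => t' i j.+1 - t' i j)) telescope_sumr//.
by case: (t'P i) => -> -> _; rewrite opprK mulr2n mulrDl mul1r.
Qed.

End CubePartitions.

(** * Riemann sums and lattice sums *)

Section RiemannSums.
Context (R : realType) (V : tvsType R[i]) (Q : set (V -> R)) (k : nat).
Hypotheses (defQ : defining_system Q) (hV : hausdorff_space V).
Hypothesis complV : sequentially_complete V.
Implicit Types (F G : 'rV[R]_k -> V) (x : 'rV[R]_k) (a : R).

Let seminormQ q : Q q -> is_seminorm q. Proof. by case: defQ => + _ _; apply. Qed.

Definition supported_in a F : Prop :=
  [set x | F x != 0] `<=` [set x | forall i, `|x 0 i| <= a].

Lemma supported_eq0 a F x i : supported_in a F -> a < `|x 0 i| -> F x = 0.
Proof.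
move=> sF ax; apply/eqP/negP => /negP /sF /= /(_ i).
by rewrite leNgt ax.
Qed.

Lemma supported_le a b F : a <= b -> supported_in a F -> supported_in b F.
Proof. by move=> ab sF x /sF /= xa i; rewrite (le_trans (xa i)). Qed.

(** Compactness of the cube enlarged by 1 gives a common radius for [x] in that cube. For the other
    [x] both values vanish. *)
Lemma uniformly_continuous_supported q F a (e : R) : Q q -> continuous F ->
  supported_in a F -> 0 < e ->
  exists2 d : R, 0 < d & forall x y : 'rV[R]_k,
    (forall i, `|x 0 i - y 0 i| < d) -> q (F x - F y) <= e.
Proof.
move=> Qq cF sF e0; have sq := seminormQ Qq.
have cK : compact [set x : 'rV[R]_k | forall i, `[- (a + 1), a + 1]%classic (x 0 i)].
  by apply: (@rV_compact _ _ (fun=> `[- (a + 1), a + 1]%classic)) => i; exact: segment_compact.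
pose P (d : R) (x : 'rV[R]_k) := forall y : 'rV[R]_k,
  (forall i, `|x 0 i - y 0 i| < d) -> q (F x - F y) <= e.
have /compact_near_coveringP/(_ R (0^'+) P) := cK.
have fil : Filter (at_right (0 : R)) by typeclasses eauto.
case/(_ fil) => [x _|d /= d0 dP].
  have e20 : 0 < e / 2 by rewrite divr_gt0.
  have [d d0 dP] := (continuous_seminormP defQ _).1 cF x q Qq _ e20.
  have d20 : 0 < d / 2 by rewrite divr_gt0.
  exists ([set z : 'rV[R]_k | forall i, `|z 0 i - x 0 i| < d / 2], [set r | r < d / 2]).
    split => /=; first by apply/nbhs_rVP; exists (d / 2).
    exact: nbhs_right_lt.
  move=> [z r] [/= zx rd] y zy.
  rewrite (le_trans (seminorm_dist sq (F x) _ _))// [e]splitr lerD//.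
    apply/ltW/dP => i; apply: (lt_trans (zx i)).
    by rewrite ltr_pdivrMr// mulr_natr mulr2n ltrDl.
  rewrite (seminorm_distC sq); apply/ltW/dP => i.
  rewrite -[_ - x 0 i](subrKA (z 0 i)) (le_lt_trans (ler_normD _ _))//.
  by rewrite [d]splitr ltrD// distrC (lt_trans (zy i)).
(* The bound 1 keeps [y] off the cube of radius [a] whenever [x] lies off the enlarged one. *)
pose r := Num.min (d / 2) 1.
have r0 : 0 < r by rewrite lt_min divr_gt0//=.
have rd : r < d by rewrite gt_min ltr_pdivrMr// mulr_natr mulr2n ltrDl d0.
exists r => // x y xy.
have [xK|/existsNP[i /negP]] := pselect (forall i, `[- (a + 1), a + 1]%classic (x 0 i)).
  apply: (dP r) => //; rewrite /ball /= sub0r normrN gtr0_norm//.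
rewrite /= in_itv /= -ler_norml -ltNge => ax.
have ay : a < `|y 0 i|.
  have := ler_normD (x 0 i - y 0 i) (y 0 i); rewrite subrK.
  have r1 : r <= 1 by rewrite ge_min lexx orbT.
  have := xy i; lra.
rewrite (supported_eq0 sF ay) (@supported_eq0 a F x i sF).
  by rewrite subrr (seminorm0 sq) ltW.
by rewrite (le_lt_trans _ ax)// lerDl.
Qed.

(** Instead of passing to a common refinement, both sums are written over pairs of cells weighted by
    their overlap. Tags of overlapping cells are closer than [2 * d]; the remaining volume belongs
    to cells on which [q] of [F] is at most [e]. *)
Lemma riemann_sum_compare q F a a' N N' (t t' : 'I_k -> nat -> R)
    (xi : {ffun 'I_k -> 'I_N} -> 'rV[R]_k) (xi' : {ffun 'I_k -> 'I_N'} -> 'rV[R]_k)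
    (d e : R) : Q q -> a <= a' -> supported_in a F ->
    (forall i, is_partition a N (t i)) ->
    (forall i, is_partition a' N' (t' i)) ->
    (forall i j, (j < N)%N -> t i j.+1 - t i j < d) ->
    (forall i j, (j < N')%N -> t' i j.+1 - t' i j < d) ->
    (forall (c : {ffun 'I_k -> 'I_N}) i, t i (c i) <= xi c 0 i <= t i (c i).+1) ->
    (forall (b : {ffun 'I_k -> 'I_N'}) i, t' i (b i) <= xi' b 0 i <= t' i (b i).+1) ->
    (forall x y : 'rV[R]_k, (forall i, `|x 0 i - y 0 i| < 2 * d) ->
      q (F x - F y) <= e) ->
  q (riemann_sum t' xi' F - riemann_sum t xi F) <= e * (2 * a') ^+ k.
Proof.
move=> Qq aa' sF tP t'P td t'd txi t'xi Fe; have sq := seminormQ Qq.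
have tS i (j : 'I_N) : t i j <= t i j.+1 by case: (tP i) => _ _; apply.
have t'S i (j : 'I_N') : t' i j <= t' i j.+1 by case: (t'P i) => _ _; apply.
pose W (c : {ffun 'I_k -> 'I_N}) (b : {ffun 'I_k -> 'I_N'}) :=
  cell_overlap t t' c b.
have W0 c b : 0 <= W c b by exact: cell_overlap_ge0 tP t'P _ _.
have sW b : \sum_c W c b <= cell_volume t' b by exact: sum_cell_overlap_le tP t'P _.
have SE : riemann_sum t xi F = \sum_b \sum_c (W c b)%:C *: F (xi c).
  rewrite exchange_big; apply: eq_bigr => c _ /=.
  by rewrite -scaler_suml -rmorph_sum /= (sum_cell_overlap tP t'P aa').
(* The volume of [b] is split into the part met by the smaller partition and the deficit. *)
have S'E : riemann_sum t' xi' F =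
    \sum_b (\sum_c (W c b)%:C *: F (xi' b) +
            (cell_volume t' b - \sum_c W c b)%:C *: F (xi' b)).
  apply: eq_bigr => b _; rewrite -scaler_suml -rmorph_sum /= -scalerDl -rmorphD.
  by rewrite addrC subrK.
rewrite SE S'E -sumrB (le_trans (seminorm_sum sq _ _ _))//.
rewrite -(sum_cell_volume t'P) mulr_sumr ler_sum// => b _.
rewrite addrAC -sumrB.
rewrite [leRHS](_ : _ = \sum_c W c b * e + (cell_volume t' b - \sum_c W c b) * e);
  last by rewrite -mulr_suml -mulrDl addrC subrK mulrC.
rewrite (le_trans (seminorm_subadd sq _ _))// lerD//.
  rewrite (le_trans (seminorm_sum sq _ _ _))// ler_sum// => c _.
  rewrite -scalerBr (seminormZr sq) ger0_norm//.
  have := W0 c b; rewrite le_eqVlt => /orP[/eqP <-|Wgt]; first by rewrite !mul0r.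
  rewrite ler_pM2l//; apply: Fe => i.
  have [h1 h2] : t i (c i) <= t' i (b i).+1 /\ t' i (b i) <= t i (c i).+1.
    apply: overlap_gt0 => //; rewrite lt_neqAle overlap_ge0// andbT eq_sym.
    by apply: contraTneq Wgt => o0; rewrite /W /cell_overlap (bigD1 i)//= o0 mul0r ltxx.
  have /andP[h3 h4] := txi c i; have /andP[h5 h6] := t'xi b i.
  have h7 := td i _ (ltn_ord (c i)); have h8 := t'd i _ (ltn_ord (b i)).
  by rewrite ltr_norml; apply/andP; split; lra.
rewrite (seminormZr sq) ger0_norm ?subr_ge0//.
have [->|/(cell_overlap_deficit tP t'P)[i ab]] :=
  eqVneq (\sum_c W c b) (cell_volume t' b); first by rewrite subrr !mul0r.
rewrite ler_wpM2l ?subr_ge0//.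
(* A cell with a deficit has a point closer than [d] to its tag at which [F] vanishes. *)
suff [h hd ha] : exists2 h, `|h| < d & a < `|line (xi' b) i h 0 i|.
  rewrite -[F _]subr0 -(supported_eq0 sF ha); apply: Fe => l.
  rewrite distrC (le_lt_trans (dist_line _ _ _ _))// (lt_trans hd)//.
  by rewrite mulr2n mulrDl mul1r ltrDl (le_lt_trans _ hd).
have /andP[h5 h6] := t'xi b i; have h8 := t'd i _ (ltn_ord (b i)).
case: ab => ab.
  exists (t' i (b i) - xi' b 0 i); first by rewrite ltr_norml; apply/andP; split; lra.
  by rewrite lineE eqxx mulr1 addrC subrK lter_normr ltrNr ab orbT.
exists (t' i (b i).+1 - xi' b 0 i); first by rewrite ltr_norml; apply/andP; split; lra.
by rewrite lineE eqxx mulr1 addrC subrK lter_normr ab.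
Qed.

(** There are [N.+1] cells, so that the mesh is defined for every [N]. *)
Definition uniform_partition a N (j : nat) : R := - a + j%:R * (2 * a / N.+1%:R).

(** The tag is the lower corner of the cell, so that a shift by one mesh width carries tags to
    tags. *)
Definition lattice_point a N (c : {ffun 'I_k -> 'I_N.+1}) : 'rV[R]_k :=
  \row_i uniform_partition a N (c i).

Definition lattice_sum F a N : V :=
  riemann_sum (fun=> uniform_partition a N) (@lattice_point a N) F.

Lemma uniform_partitionS a N j :
  uniform_partition a N j.+1 - uniform_partition a N j = 2 * a / N.+1%:R.
Proof. by rewrite /uniform_partition -natr1; ring. Qed.

Lemma uniform_partitionP a N : 0 <= a ->
  is_partition a N.+1 (uniform_partition a N).
Proof.
move=> a0; split=> [||j _]; rewrite /uniform_partition.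
- by rewrite mul0r addr0.
- by rewrite mulrC divfK ?pnatr_eq0//; lra.
- by rewrite lerD2l ler_wpM2r ?ler_nat// divr_ge0// mulr_ge0.
Qed.

Lemma lattice_pointP a N (c : {ffun 'I_k -> 'I_N.+1}) i : 0 <= a ->
  uniform_partition a N (c i) <= lattice_point a c 0 i <=
  uniform_partition a N (c i).+1.
Proof.
move=> a0; rewrite mxE lexx /=; case: (uniform_partitionP N a0) => _ _; exact.
Qed.

Lemma lattice_sumE F a N : lattice_sum F a N =
  ((2 * a / N.+1%:R) ^+ k)%:C *: \sum_c F (@lattice_point a N c).
Proof.
rewrite scaler_sumr; apply: eq_bigr => c _; congr (_%:C *: _).
rewrite -[in RHS](card_ord k) -prodr_const; apply: eq_bigr => i _.
exact: uniform_partitionS.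
Qed.

Lemma uniform_mesh_small a (d : R) : 0 < d ->
  \forall N \near \oo, 2 * a / N.+1%:R < d.
Proof.
move=> d0; near=> N; rewrite ltr_pdivrMr// -ltr_pdivrMl//.
near: N; exists (Num.bound `|d^-1 * (2 * a)|) => // N /= NP.
rewrite (le_lt_trans (ler_norm _))// (lt_le_trans (archi_boundP _))//.
by rewrite ler_nat ltnW.
Unshelve. all: by end_near. Qed.

Lemma lattice_sum_compare q F a a' (e : R) : Q q -> 0 <= a -> a <= a' ->
    continuous F -> supported_in a F -> 0 < e ->
  exists N0 : nat, forall N N', (N0 <= N)%N -> (N0 <= N')%N ->
    q (lattice_sum F a' N' - lattice_sum F a N) < e.
Proof.
move=> Qq a0 aa' cF sF e0; have a'0 := le_trans a0 aa'.
have K0 : 0 < (2 * a') ^+ k + 1 by rewrite ltr_wpDl// exprn_ge0// mulr_ge0.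
have [d d0 dP] := uniformly_continuous_supported Qq cF sF (divr_gt0 e0 K0).
have d20 : 0 < d / 2 by rewrite divr_gt0.
have [N1 _ N1P] := uniform_mesh_small a d20.
have [N2 _ N2P] := uniform_mesh_small a' d20.
exists (maxn N1 N2) => N N'; rewrite !geq_max => /andP[h1 h2] /andP[h3 h4].
apply: (@le_lt_trans _ _ (e / ((2 * a') ^+ k + 1) * (2 * a') ^+ k)); last first.
  rewrite mulrAC ltr_pdivrMr// ltr_pM2l// ltrDl//.
apply: (@riemann_sum_compare q F a a' N.+1 N'.+1 _ _ _ _ (d / 2) _ Qq aa' sF).
- by move=> i; exact: uniform_partitionP.
- by move=> i; exact: uniform_partitionP.
- by move=> i j _; rewrite uniform_partitionS; exact: N1P.
- by move=> i j _; rewrite uniform_partitionS; exact: N2P.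
- by move=> c i; exact: lattice_pointP.
- by move=> c i; exact: lattice_pointP.
- by move=> x y; rewrite mulrC divfK// => /dP.
Qed.

Lemma cube_integral_lattice F a v : 0 <= a -> is_cube_integral a F v ->
  lattice_sum F a @ \oo --> v.
Proof.
move=> a0 Fv U /Fv[d d0 dP].
suff : \forall N \near \oo, U (lattice_sum F a N) by [].
near=> N; have := dP N.+1 (fun=> uniform_partition a N) (@lattice_point a N); apply.
- by move=> i; exact: uniform_partitionP.
- by move=> i j _; rewrite uniform_partitionS; near: N; exact: uniform_mesh_small.
- by move=> c i; exact: lattice_pointP.
Unshelve. all: by end_near. Qed.

(** One sequence of Riemann sums decides for all of them, because any two sums of small mesh are
    close. *)
Lemma lattice_sum_cube_integral F a v : 0 <= a -> continuous F ->
  supported_in a F -> lattice_sum F a @ \oo --> v -> is_cube_integral a F v.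
Proof.
move=> a0 cF sF Fv U.
have K0 : 0 < (2 * a) ^+ k + 1 by rewrite ltr_wpDl// exprn_ge0// mulr_ge0.
(* All Riemann sums of mesh below [d]. These sets form a filter base, whose convergence to [v] is
   the defining property of the integral and can be tested on single seminorms. *)
pose Sm (d : R) := [set S : V | exists N (t : 'I_k -> nat -> R)
    (xi : {ffun 'I_k -> 'I_N} -> 'rV[R]_k),
  [/\ (forall i, is_partition a N (t i)),
      (forall i j, (j < N)%N -> t i j.+1 - t i j < d),
      (forall (c : {ffun 'I_k -> 'I_N}) i, t i (c i) <= xi c 0 i <= t i (c i).+1) &
      S = riemann_sum t xi F]].
have fil : Filter (filter_from [set d : R | 0 < d] Sm).
  apply: filter_from_filter; first by exists 1 => /=.
  move=> d d' /= d0 d'0; exists (Num.min d d'); first by rewrite /= lt_min d0.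
  move=> S [N [t [xi [h1 h2 h3 h4]]]].
  by split; exists N, t, xi; split=> // i j jN;
    have := h2 i j jN; rewrite lt_min => /andP[].
suff : filter_from [set d : R | 0 < d] Sm --> v.
  move=> /[apply] -[d /= d0 dU]; exists d => // N t xi h1 h2 h3.
  by apply: dU; exists N, t, xi.
apply/(@cvg_seminormP _ _ _ defQ _ _ fil id) => q Qq e e0; have sq := seminormQ Qq.
have e20 : 0 < e / 2 by rewrite divr_gt0.
have [d d0 dP] := uniformly_continuous_supported Qq cF sF (divr_gt0 e20 K0).
have d20 : 0 < d / 2 by rewrite divr_gt0.
exists (d / 2) => // S [N [t [xi [h1 h2 h3 ->]]]] /=.
have /(cvg_seminormP defQ _)/(_ q Qq _ e20) Fv' := Fv.
have [M [M1 M2]] := filter_ex (filterI Fv' (uniform_mesh_small a d20)).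
rewrite (le_lt_trans (seminorm_dist sq (lattice_sum F a M) _ _))//.
rewrite [e]splitr ler_ltD// (seminorm_distC sq).
apply: (@le_trans _ _ (e / 2 / ((2 * a) ^+ k + 1) * (2 * a) ^+ k)); last first.
  by rewrite mulrAC ler_pdivrMr// ler_pM2l// lerDl.
apply: (@riemann_sum_compare q F a a N M.+1 _ _ _ _ (d / 2) _ Qq _ sF) => //.
- by move=> i; exact: uniform_partitionP.
- by move=> i j _; rewrite uniform_partitionS.
- by move=> c i; exact: lattice_pointP.
- by move=> x y; rewrite mulrC divfK// => /dP.
Qed.

(** The value chosen by [integral_Rk] comes with a cube of its own, of radius [b]; comparing the
    lattice sums of the two cubes identifies the limits. *)
Lemma lattice_sum_cvg F a : 0 < a -> continuous F -> supported_in a F ->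
  lattice_sum F a @ \oo --> integral_Rk F.
Proof.
move=> a0 cF sF.
have [v Fv] : exists v : V, lattice_sum F a @ \oo --> v.
  apply/complV/(seminorm_cauchyP defQ) => q Qq e e0.
  have [N NP] := lattice_sum_compare Qq (ltW a0) (lexx a) cF sF e0.
  by exists N => i j iN jN; exact: NP.
have /(xgetPex 0)[b [b0 sb] Fb] : exists v, [set v | exists2 a : R,
    0 < a /\ supported_in a F & is_cube_integral a F v] v.
  exists v; exists a => //; exact: lattice_sum_cube_integral (ltW a0) _ _ _.
have {}Fb := cube_integral_lattice (ltW b0) Fb.
suff E : v = integral_Rk F by rewrite -E.
have close q (e : R) : Q q -> 0 < e ->
  \forall N \near \oo, q (lattice_sum F a N - lattice_sum F b N) < e.
  move=> Qq e0; have [ab|/ltW ba] := leP a b.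
    have [N NP] := lattice_sum_compare Qq (ltW a0) ab cF sF e0.
    exists N => // M /= MN; rewrite (seminorm_distC (seminormQ Qq)).
    exact: NP.
  have [N NP] := lattice_sum_compare Qq (ltW b0) ba cF sb e0.
  by exists N => // M /= MN; exact: NP.
apply: (cvg_seminorm_unique defQ hV) Fv _.
apply/(cvg_seminormP defQ) => q Qq e e0; have sq := seminormQ Qq.
have e20 : 0 < e / 2 by rewrite divr_gt0.
have /(cvg_seminormP defQ)/(_ q Qq _ e20) Fb' := Fb.
apply: filterS (filterI (close q _ Qq e20) Fb') => N [/= h1 h2].
rewrite (le_lt_trans (seminorm_dist sq (lattice_sum F b N) _ _))//.
by rewrite [e]splitr ltrD.
Qed.

End RiemannSums.

(** * Integration *)

Section AtanSums.
Context (R : realType).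

(** By the mean value theorem the increment is [h / (1 + c ^+ 2)]. The 3 comes from
    [1 + c ^+ 2 <= 3 * (1 + x ^+ 2)], valid when [c] and [x] differ by at most 1. *)
Lemma atan_increment (x h : R) : 0 < h <= 1 ->
  h * (1 + x ^+ 2)^-1 <= 3 * (atan (x + h) - atan x).
Proof.
move=> /andP[h0 h1].
have cx : {within `[x, x + h], continuous (@atan R)}.
  by apply: continuous_subspaceT => y; exact: continuous_atan.
have xh : x <= x + h by rewrite lerDl ltW.
have [c] := MVT_segment xh (fun y _ => is_derive1_atan y) cx.
rewrite in_itv /= => /andP[xc ch] ->; rewrite [x + h]addrC addrK.
have x1 : 0 < 1 + x ^+ 2 by rewrite ltr_pwDl// sqr_ge0.
have c1 : 0 < 1 + c ^+ 2 by rewrite ltr_pwDl// sqr_ge0.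
rewrite mulrA [leRHS]mulrC ler_pM2l// ler_pdivlMr// mulrC ler_pdivrMr//.
have : (c - x) ^+ 2 <= 1 by rewrite expr_le1//; lra.
by nra.
Qed.

(** The increments of [atan] telescope, which makes the bound independent of the size of the
    cube. *)
Lemma atan_sum_le a N : 0 < a -> 2 * a / N.+1%:R <= 1 :> R ->
  \sum_(j < N.+1) 2 * a / N.+1%:R * (1 + uniform_partition a N j ^+ 2)^-1 <=
  3 * pi.
Proof.
move=> a0 h1; set h : R := 2 * a / N.+1%:R.
have h0 : 0 < h by rewrite divr_gt0// mulr_gt0.
apply: (@le_trans _ _ (\sum_(j < N.+1) 3 *
    (atan (uniform_partition a N j.+1) - atan (uniform_partition a N j)))).
  apply: ler_sum => j _.
  have -> : uniform_partition a N j.+1 = uniform_partition a N j + h.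
    by rewrite /h -(uniform_partitionS a N j) addrC subrK.
  by apply: atan_increment; rewrite h0.
rewrite -mulr_sumr -(big_mkord xpredT (fun j =>
  atan (uniform_partition a N j.+1) - atan (uniform_partition a N j))).
rewrite telescope_sumr// ler_wpM2l//.
have := @atan_ltpi2 R (uniform_partition a N N.+1).
have := @atan_gtNpi2 R (uniform_partition a N 0).
by lra.
Qed.

Lemma atan_lattice_sum_le k a N : 0 < a -> 2 * a / N.+1%:R <= 1 :> R ->
  (2 * a / N.+1%:R) ^+ k *
    (\sum_(c : {ffun 'I_k -> 'I_N.+1})
       \prod_i (1 + lattice_point a c 0 i ^+ 2)^-1) <= (3 * pi) ^+ k.
Proof.
move=> a0 h1.
have -> : (2 * a / N.+1%:R) ^+ k *
    (\sum_(c : {ffun 'I_k -> 'I_N.+1})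
       \prod_i (1 + lattice_point a c 0 i ^+ 2)^-1) =
  \prod_(i < k) \sum_(j < N.+1)
    2 * a / N.+1%:R * (1 + uniform_partition a N j ^+ 2)^-1.
  rewrite bigA_distr_bigA mulr_sumr; apply: eq_bigr => c _.
  rewrite -{1}(card_ord k) -prodr_const -big_split/=; apply: eq_bigr => i _.
  by rewrite mxE.
rewrite -[in leRHS](card_ord k) -prodr_const; apply: ler_prod => i _.
rewrite atan_sum_le// andbT sumr_ge0// => j _.
by rewrite mulr_ge0 ?divr_ge0 ?mulr_ge0 ?(ltW a0)// invr_ge0 addr_ge0 ?sqr_ge0.
Qed.

End AtanSums.

(** * Linearity, domination and integrals of derivatives *)

Section Integration.
Context (R : realType) (V : tvsType R[i]) (Q : set (V -> R)) (k : nat).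
Hypotheses (defQ : defining_system Q) (hV : hausdorff_space V).
Hypothesis complV : sequentially_complete V.
Implicit Types (F G : 'rV[R]_k -> V) (x : 'rV[R]_k) (a : R).

Let seminormQ q : Q q -> is_seminorm q. Proof. by case: defQ => + _ _; apply. Qed.

Lemma supported_linear a (c : R[i]) F G : supported_in a F -> supported_in a G ->
  supported_in a (c *: F + G).
Proof.
move=> sF sG x /= FG0 i; rewrite leNgt; apply/negP => ax; move/negP: FG0; apply.
apply/eqP; rewrite -[LHS]/(c *: F x + G x).
by rewrite (supported_eq0 sF ax) (supported_eq0 sG ax) scaler0 addr0.
Qed.

Lemma integral_linear a (c : R[i]) F G : 0 < a ->
    continuous F -> supported_in a F -> continuous G -> supported_in a G ->
  integral_Rk (c *: F + G) = c *: integral_Rk F + integral_Rk G.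
Proof.
move=> a0 cF sF cG sG.
have cFG := continuous_linear defQ (c := c) cF cG.
have sFG := supported_linear (c := c) sF sG.
apply: (cvg_seminorm_unique defQ hV) (lattice_sum_cvg defQ hV complV a0 cFG sFG) _.
have Fc := lattice_sum_cvg defQ hV complV a0 cF sF.
have Gc := lattice_sum_cvg defQ hV complV a0 cG sG.
have -> : lattice_sum (c *: F + G) a =
    (fun N => c *: lattice_sum F a N + lattice_sum G a N).
  apply/funext => N; rewrite scaler_sumr -big_split; apply: eq_bigr => b _ /=.
  by rewrite complex_scale_comm -scalerDr.
exact: (cvg_seminormD defQ _ (cvg_seminormZ defQ _ (c := c) Fc) Gc).
Qed.

(** The domination holds for all lattice sums of mesh at most 1 and passes to the limit. The
    constant does not involve [a], which is what makes the later estimates uniform in the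
    support. *)
Lemma integral_bound q a F (A : R) : Q q -> 0 < a -> continuous F ->
    supported_in a F -> (forall x, q (F x) <= A * \prod_i (1 + x 0 i ^+ 2)^-1) ->
  q (integral_Rk F) <= A * (3 * pi) ^+ k.
Proof.
move=> Qq a0 cF sF FA; have sq := seminormQ Qq.
have A0 : 0 <= A.
  have := le_trans (seminorm_ge0 sq _) (FA 0).
  rewrite pmulr_lge0//; apply: prodr_gt0 => i _.
  by rewrite invr_gt0 ltr_pwDl// sqr_ge0.
apply: (cvg_seminorm_le defQ _ Qq (lattice_sum_cvg defQ hV complV a0 cF sF)).
apply: filterS (uniform_mesh_small a ltr01) => N /ltW h1.
have h0 : 0 <= 2 * a / N.+1%:R by rewrite divr_ge0// mulr_ge0// ltW.
rewrite lattice_sumE (seminormZr sq) ger0_norm ?exprn_ge0//.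
apply: le_trans (ler_wpM2l A0 (atan_lattice_sum_le k a0 h1)).
rewrite mulrCA ler_wpM2l ?exprn_ge0// mulr_sumr.
by rewrite (le_trans (seminorm_sum sq _ _ _))// ler_sum.
Qed.

(** The cube is closed: around a point outside of it [F] vanishes, hence so does its derivative
    there. *)
Lemma supported_pd a F (D : 'rV[R]_k -> V) j : supported_in a F ->
  (forall x, has_pd Q j F x (D x)) -> supported_in a D.
Proof.
move=> sF dF x /= Dx i; rewrite leNgt; apply/negP => ax; move/negP: Dx; apply.
apply/eqP; apply: (has_d_unique defQ hV (dF x)) => q Qq e e0.
exists (`|x 0 i| - a); first by rewrite subr_gt0.
move=> h hd; rewrite add0r line0 (supported_eq0 sF ax) scaler0 !subr0.
rewrite (@supported_eq0 _ _ _ a F _ i sF).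
  by rewrite (seminorm0 (seminormQ Qq)) mulr_ge0// ltW.
have := dist_line x j h i.
have := ler_distD (line x j h 0 i) (x 0 i) 0; rewrite !subr0 distrC.
by lra.
Qed.

Lemma uniform_diff_quotient q a F (D : 'rV[R]_k -> V) j (e : R) : Q q ->
    (forall x, has_pd Q j F x (D x)) -> continuous D -> supported_in a D ->
    0 < e ->
  exists2 d : R, 0 < d & forall h x, 0 <= h < d ->
    q (F (line x j h) - F x - h%:C *: D x) <= e * h.
Proof.
move=> Qq dF cD sD e0.
have [d d0 dP] := uniformly_continuous_supported defQ Qq cD sD e0.
exists d => // h x /andP[h0 hd]; rewrite -{2}(line0 x j).
apply: (mean_value_diff_le defQ (f := fun s => F (line x j s))
  (D := fun s => D (line x j s))) => // t /andP[t0 th].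
  exact/has_pd_line.
apply: dP => i; rewrite (le_lt_trans (dist_line _ _ _ _))//.
by rewrite ger0_norm// (le_lt_trans th).
Qed.

(** A shift by one mesh width permutes the lattice cyclically in direction [j], up to the points
    that wrap around. *)
Lemma lattice_shift a b F j N : a < b -> supported_in a F ->
  \sum_(c : {ffun 'I_k -> 'I_N.+1})
    F (line (lattice_point b c) j (2 * b / N.+1%:R)) =
  \sum_(c : {ffun 'I_k -> 'I_N.+1}) F (lattice_point b c).
Proof.
move=> ab sF.
pose s (c : {ffun 'I_k -> 'I_N.+1}) : {ffun 'I_k -> 'I_N.+1} :=
  [ffun i => if i == j then ordS (c i) else c i].
have sI : injective s.
  move=> c c' /ffunP cc; apply/ffunP => i; have := cc i; rewrite !ffunE.
  by case: ifP => // _; exact: (bij_inj (@ordS_bij _)).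
rewrite [RHS](reindex_inj sI); apply: eq_bigr => c _ /=.
(* At the wrap the [j]-th coordinates are [b] and [- b], both outside the support because
   [a < b]. *)
have [cN|cN] := eqVneq (c j) ord_max.
  rewrite (@supported_eq0 _ _ _ a F _ j sF); last first.
    rewrite lineE eqxx mulr1 mxE -(uniform_partitionS b N (c j)) addrC subrK cN.
    rewrite /uniform_partition mulrC divfK ?pnatr_eq0// lter_normr.
    by apply/orP; left; lra.
  rewrite (@supported_eq0 _ _ _ a F _ j sF)// mxE !ffunE eqxx cN /=.
  by rewrite modnn /uniform_partition mul0r addr0 normrN lter_normr ab.
congr F; apply/rowP => i; rewrite lineE !mxE !ffunE.
have [->|] := eqVneq i j; last by rewrite mulr0 addr0.
rewrite mulr1 -(uniform_partitionS b N (c j)) addrC subrK /= modn_small//.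
by rewrite ltnS ltn_neqAle -ltnS ltn_ord andbT; apply: contra_neq cN => cN; apply/val_inj.
Qed.

Lemma integral_partial_eq0 a F (D : 'rV[R]_k -> V) j : 0 < a ->
    supported_in a F -> (forall x, has_pd Q j F x (D x)) -> continuous D ->
  integral_Rk D = 0.
Proof.
move=> a0 sF dF cD.
have sD := supported_pd sF dF.
(* A margin around the support, as the cyclic shift requires. *)
pose b := a + 1; have ab : a < b by rewrite ltrDl.
have b0 : 0 < b by rewrite (lt_trans a0).
have sDb := supported_le (ltW ab) sD.
apply: (cvg_seminorm_unique defQ hV) (lattice_sum_cvg defQ hV complV b0 cD sDb) _.
apply/(cvg_seminormP defQ) => q Qq e e0; have sq := seminormQ Qq.
have K0 : 0 < (2 * b) ^+ k + 1 by rewrite ltr_wpDl// exprn_ge0// mulr_ge0// ltW.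
have [d d0 dP] := uniform_diff_quotient Qq dF cD sD (divr_gt0 e0 K0).
apply: filterS (uniform_mesh_small b d0) => N hd.
set h := 2 * b / N.+1%:R in hd.
have h0 : 0 < h by rewrite divr_gt0// mulr_gt0.
rewrite subr0; apply: (@le_lt_trans _ _ (e / ((2 * b) ^+ k + 1) * (2 * b) ^+ k)); last first.
  by rewrite mulrAC ltr_pdivrMr// ltr_pM2l// ltrDl.
rewrite -(ler_pM2l h0) -[X in X * _ <= _](gtr0_norm h0) -(seminormZr sq).
rewrite lattice_sumE complex_scale_comm (seminormZr sq) -/h.
rewrite ger0_norm ?exprn_ge0 ?(ltW h0)// scaler_sumr.
(* By [lattice_shift] the increments of [F] add up to 0, so only the remainders of the difference
   quotients are left. *)
have -> : \sum_(c : {ffun 'I_k -> 'I_N.+1}) h%:C *: D (lattice_point b c) =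
  - \sum_(c : {ffun 'I_k -> 'I_N.+1}) (F (line (lattice_point b c) j h) -
     F (lattice_point b c) - h%:C *: D (lattice_point b c)).
  rewrite sumrB sumrB (lattice_shift _ _ ab sF) subrr sub0r opprK//.
rewrite (seminormN sq); apply: (@le_trans _ _ (h ^+ k *
    \sum_(c : {ffun 'I_k -> 'I_N.+1}) (e / ((2 * b) ^+ k + 1) * h))).
  rewrite ler_wpM2l ?exprn_ge0 ?(ltW h0)// (le_trans (seminorm_sum sq _ _ _))//.
  by apply: ler_sum => c _; apply: dP; rewrite (ltW h0).
rewrite sumr_const card_ffun !card_ord -[_ *+ (_ ^ _)%N]mulr_natl natrX mulrA -exprMn.
have -> : h * N.+1%:R = 2 * b by rewrite /h divfK ?pnatr_eq0.
by rewrite [_ * h]mulrC mulrCA [_ ^+ k * _]mulrC.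
Qed.

End Integration.

(** * Scalar symbols *)

Section ContinuousScalars.
Context (R : realType) (T : topologicalType).
Implicit Types a b : T -> R.

Lemma continuous_addr a b : continuous a -> continuous b ->
  continuous (fun x => a x + b x).
Proof. by move=> ca cb x; exact: (continuousD (ca x) (cb x)). Qed.

Lemma continuous_mulr a b : continuous a -> continuous b ->
  continuous (fun x => a x * b x).
Proof. by move=> ca cb x; exact: (continuousM (ca x) (cb x)). Qed.

Lemma continuous_sumr (I : Type) (s : seq I) (a : I -> T -> R) :
  (forall i, continuous (a i)) -> continuous (fun x => \sum_(i <- s) a i x).
Proof.
move=> ca; elim: s => [|i s IH].
  by under eq_fun do rewrite big_nil; exact: cst_continuous.
by under eq_fun do rewrite big_cons; exact: continuous_addr.
Qed.

End ContinuousScalars.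

Section Weights.
Context (R : realType) (k : nat).
Implicit Types (x : 'rV[R]_k) (s t : R).

Definition bracket2 x : R := 1 + eucl_norm x ^+ 2.

Lemma bracket2E x : bracket2 x = 1 + \sum_i x 0 i ^+ 2.
Proof. by rewrite /bracket2 sqr_sqrtr// sumr_ge0// => i _; exact: sqr_ge0. Qed.

Lemma bracket2_ge1 x : 1 <= bracket2 x.
Proof. by rewrite lerDl sqr_ge0. Qed.

Lemma bracket2_gt0 x : 0 < bracket2 x.
Proof. exact: lt_le_trans ltr01 (bracket2_ge1 x). Qed.

Lemma bracket2_coord x i : 1 + x 0 i ^+ 2 <= bracket2 x.
Proof.
rewrite bracket2E lerD2l (bigD1 i)//= lerDl sumr_ge0// => j _; exact: sqr_ge0.
Qed.

Definition weight s x : R := bracket2 x `^ (s / 2).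

Lemma weight_gt0 s x : 0 < weight s x.
Proof. by rewrite powR_gt0// bracket2_gt0. Qed.

Lemma weight_ge0 s x : 0 <= weight s x. Proof. exact/ltW/weight_gt0. Qed.

Lemma weightD s t x : weight (s + t) x = weight s x * weight t x.
Proof.
by rewrite /weight mulrDl powRD//; apply/implyP => _; rewrite gt_eqF// bracket2_gt0.
Qed.

Lemma weight_le s t x : s <= t -> weight s x <= weight t x.
Proof. by move=> st; rewrite ler_powR ?bracket2_ge1// ler_pM2r. Qed.

Lemma weight0 x : weight 0 x = 1.
Proof. by rewrite /weight mul0r powRr0. Qed.

Lemma weight2 x : weight 2 x = bracket2 x.
Proof. by rewrite /weight divff// powRr1// ltW// bracket2_gt0. Qed.

Lemma weightN s x : weight (- s) x = (weight s x)^-1.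
Proof. by rewrite /weight mulNr powRN. Qed.

Lemma coord_le_weight1 x i : `|x 0 i| <= weight 1 x.
Proof.
rewrite /weight div1r powR12_sqrt ?(ltW (bracket2_gt0 x))// -sqrtr_sqr.
by rewrite ler_wsqrtr// (le_trans _ (bracket2_coord x i))// lerDr.
Qed.

(** Each of the [k] factors [1 + x 0 i ^+ 2] is at most [bracket2 x], and order [2 * k%:R] is the
    [k]-th power of [bracket2]. *)
Lemma weight_le_prod x : weight (- (2 * k%:R)) x <= \prod_i (1 + x 0 i ^+ 2)^-1.
Proof.
rewrite weightN prodfV lef_pV2 ?posrE ?weight_gt0//; last first.
  by apply: prodr_gt0 => i _; rewrite ltr_pwDl// sqr_ge0.
rewrite /weight mulrC mulKf// powR_mulrn ?(ltW (bracket2_gt0 x))//.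
rewrite -[in leRHS](card_ord k) -prodr_const; apply: ler_prod => i _.
by rewrite bracket2_coord andbT addr_ge0// sqr_ge0.
Qed.

Lemma bracket2_line x i h :
  bracket2 (line x i h) = bracket2 x + h * (2 * x 0 i) + h ^+ 2.
Proof.
rewrite !bracket2E (bigD1 i)//= [in RHS](bigD1 i)//= lineE eqxx mulr1.
rewrite (eq_bigr (fun j => x 0 j ^+ 2)); last first.
  by move=> j /negPf ji; rewrite lineE ji mulr0 addr0.
ring.
Qed.

Lemma continuous_bracket2 : continuous (@bracket2).
Proof.
have -> : @bracket2 = fun x => 1 + \sum_i x 0 i * x 0 i.
  by apply/funext => x; rewrite bracket2E.
apply: continuous_addr; first exact: cst_continuous.
by apply: continuous_sumr => i; apply: continuous_mulr => x; exact: coord_continuous.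
Qed.

End Weights.

Section ScalarSymbols.
Context (R : realType) (k : nat).
Implicit Types (x : 'rV[R]_k) (a b : 'rV[R]_k -> R).

Definition has_spd i a x (v : R) : Prop :=
  is_derive (0 : R) (1 : R) (fun h => a (line x i h)) v.

(* Scalar symbols of order d and type 1, up to r derivatives, with seminorms
   at most C. *)
Fixpoint ssym (r : nat) (d : R) a (C : R) : Prop :=
  [/\ continuous a, forall x, `|a x| <= C * weight d x &
   if r is r'.+1 then exists2 D : 'I_k -> 'rV[R]_k -> R,
     forall i x, has_spd i a x (D i x) & forall i, ssym r' (d - 1) (D i) C
   else True].

Lemma ssym_continuous r d a C : ssym r d a C -> continuous a.
Proof. by case: r => [|r] []. Qed.

Lemma ssym_bound r d a C x : ssym r d a C -> `|a x| <= C * weight d x.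
Proof. by case: r => [|r] []. Qed.

Lemma ssym_ge0 r d a C : ssym r d a C -> 0 <= C.
Proof.
move=> /(ssym_bound 0)/(le_trans (normr_ge0 _)).
by rewrite pmulr_lge0// weight_gt0.
Qed.

Lemma ssym_le r d d' a C C' : d <= d' -> C <= C' ->
  ssym r d a C -> ssym r d' a C'.
Proof.
move=> dd' CC'; elim: r d d' a dd' => [|r IH] d d' a dd' sa;
  have C0 := ssym_ge0 sa; case: sa => ca ba H; split=> //.
- by move=> x; rewrite (le_trans (ba x))// ler_pM// ?weight_ge0// weight_le.
- by move=> x; rewrite (le_trans (ba x))// ler_pM// ?weight_ge0// weight_le.
- by case: H => D hD sD; exists D => // i; apply: IH (sD i); rewrite lerB.
Qed.

Lemma ssym_pred r d a C : ssym r.+1 d a C -> ssym r d a C.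
Proof.
elim: r d a => [|r IH] d a [ca ba [D hD sD]]; split=> //.
by exists D => // i; apply: IH; exact: sD.
Qed.

Lemma ssym0 r d C : 0 <= C -> ssym r d (fun=> 0) C.
Proof.
move=> C0; elim: r d => [|r IH] d; split=> //; try exact: cst_continuous.
- by move=> x; rewrite normr0 mulr_ge0 ?weight_ge0.
- by move=> x; rewrite normr0 mulr_ge0 ?weight_ge0.
- by exists (fun _ _ => 0) => // i x; exact: is_derive_cst.
Qed.

Lemma ssym_cst r c : ssym r 0 (fun=> c) `|c|.
Proof.
case: r => [|r]; split=> //; try exact: cst_continuous.
- by move=> x; rewrite weight0 mulr1.
- by move=> x; rewrite weight0 mulr1.
- exists (fun _ _ => 0) => [i x|i]; first exact: is_derive_cst.
  exact: ssym0.
Qed.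

Lemma ssymD r d a b C C' : ssym r d a C -> ssym r d b C' ->
  ssym r d (fun x => a x + b x) (C + C').
Proof.
elim: r d a b => [|r IH] d a b [ca ba Ha] [cb bb Hb]; split=> //;
  try exact: continuous_addr.
- by move=> x; rewrite mulrDl (le_trans (ler_normD _ _))// lerD.
- by move=> x; rewrite mulrDl (le_trans (ler_normD _ _))// lerD.
- case: Ha Hb => D hD sD [E hE sE]; exists (fun i x => D i x + E i x).
    by move=> i x; apply: is_deriveD; [exact: hD|exact: hE].
  by move=> i; exact: IH (sD i) (sE i).
Qed.

(** The Leibniz rule produces two terms for each derivative, whence the factor [2 ^+ r]. *)
Lemma ssymM r d d' a b C C' : ssym r d a C -> ssym r d' b C' ->
  ssym r (d + d') (fun x => a x * b x) (2 ^+ r * C * C').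
Proof.
elim: r d d' a b C C' => [|r IH] d d' a b C C' sa sb;
  have C0 := ssym_ge0 sa; have C'0 := ssym_ge0 sb;
  case: (sa) => ca ba Ha; case: (sb) => cb bb Hb.
  split=> //; first exact: continuous_mulr.
  by move=> x; rewrite expr0 mul1r weightD mulrACA normrM ler_pM.
split.
- exact: continuous_mulr.
- move=> x; rewrite weightD normrM.
  rewrite [leRHS](_ : _ = 2 ^+ r.+1 * (C * weight d x * (C' * weight d' x)));
    last by ring.
  apply: (@le_trans _ _ (C * weight d x * (C' * weight d' x))).
    by rewrite ler_pM.
  by rewrite ler_peMl ?mulr_ge0 ?weight_ge0// exprn_ege1// ler1n.
- case: Ha Hb => D hD sD [E hE sE].
  exists (fun i x => a x * E i x + b x * D i x).
    move=> i x; rewrite /has_spd.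
    have := is_deriveM (hD i x) (hE i x); rewrite line0.
    exact.
  move=> i.
  rewrite (_ : 2 ^+ r.+1 * C * C' = 2 ^+ r * C * C' + 2 ^+ r * C' * C); last first.
    by rewrite exprS; ring.
  apply: ssymD.
    rewrite -addrA; apply: IH (sE i); exact: ssym_pred.
  rewrite [d + d']addrC -addrA; apply: IH (sD i); exact: ssym_pred.
Qed.

Lemma ssymZ r d c a C : ssym r d a C ->
  ssym r d (fun x => c * a x) (2 ^+ r * `|c| * C).
Proof. by move=> /(ssymM (ssym_cst r c)); rewrite add0r. Qed.

Lemma ssym_coord r i : ssym r 1 (fun x => x 0 i) 1.
Proof.
have cc : continuous (fun x : 'rV[R]_k => x 0 i) by exact: coord_continuous.
case: r => [|r]; split=> //; try by move=> x; rewrite mul1r coord_le_weight1.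
exists (fun j _ => (i == j)%:R) => [j x|j].
  rewrite /has_spd (_ : (fun h => _) = cst (x 0 i) \+ (fun h => (i == j)%:R *: h)).
    by apply: is_derive_eq; rewrite add0r scaler1.
  by apply/funext => h; rewrite lineE /= mulrC.
rewrite subrr; apply: ssym_le (ssym_cst r _) => //.
by case: (i == j); rewrite ?normr1 ?normr0 ?ler01.
Qed.

Lemma is_derive_bracket2 i x : has_spd i (@bracket2 R k) x (2 * x 0 i).
Proof.
rewrite /has_spd (_ : (fun h => _) =
  cst (bracket2 x) \+ (fun h => (2 * x 0 i) *: h) \+ (fun h => h ^+ 2)).
  apply: is_derive_eq.
  by rewrite !scale0r !addr0 add0r scaler1.
by apply/funext => h; rewrite bracket2_line /= mulrC.
Qed.

(** The derivative is -2 times a coordinate times the square of the function itself, of order 1 - 2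
    - 2 = -3; so [r] controlled derivatives yield one more. *)
Lemma ssym_bracket2V r : exists C, ssym r (- 2) (fun x => (bracket2 x)^-1) C.
Proof.
have b0 x : bracket2 x != 0 by rewrite gt_eqF// bracket2_gt0.
have cW : continuous (fun x : 'rV[R]_k => (bracket2 x)^-1).
  by move=> x; apply: continuousV; [exact: b0|exact: continuous_bracket2].
have bW x : `|(bracket2 x)^-1| <= 1 * weight (- 2) x.
  by rewrite mul1r weightN weight2 ger0_norm// invr_ge0 ltW// bracket2_gt0.
elim: r => [|r [C sW]]; first by exists 1.
pose C' := 2 ^+ r * `|- 2| * (2 ^+ r * 1 * (2 ^+ r * C * C)).
exists (1 + C').
have C0 := ssym_ge0 sW.
have C'0 : 0 <= C' by rewrite !mulr_ge0.
split=> //.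
  by move=> x; rewrite (le_trans (bW x))// ler_wpM2r ?weight_ge0// lerDl.
exists (fun i x => -2 * (x 0 i * ((bracket2 x)^-1 * (bracket2 x)^-1))) => [i x|i].
  have := is_derive_bracket2 i x => /(is_deriveV _).
  rewrite line0 => /(_ (b0 x)) H; rewrite /has_spd; apply: is_derive_eq.
  by rewrite -exprVn -[LHS]/(_ * _); ring.
apply: (ssym_le _ _ (ssymZ (- 2) (ssymM (ssym_coord r i) (ssymM sW sW)))).
  by lra.
by rewrite lerDr.
Qed.

End ScalarSymbols.

(** * Cutoff functions *)

(** The same little-o form as in [has_d], so that scalar and vector derivatives can be combined in
    one product rule. *)
Lemma is_derive_epsP (R : realType) (f : R -> R) (t r : R) :
  is_derive t (1 : R) f r <-> forall e : R, 0 < e -> exists2 d : R, 0 < d &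
    forall h, `|h| < d -> `|f (t + h) - f t - h * r| <= e * `|h|.
Proof.
have eqq (h : R) : h != 0 ->
    `|h| * `|h^-1 *: ((f \o shift t) (h *: 1) - f t) - r| =
    `|f (t + h) - f t - h * r|.
  move=> h0; rewrite -normrM mulrBr -[_ *: (_ - _)]/(_ * (_ - _)) mulVKf//.
  by rewrite /= -[h *: 1]/(h * 1) mulr1 (addrC h).
split=> [[df dv] e e0|H].
  move: df; rewrite /derivable -[lim _]/('D_1 f t) dv.
  move=> /cvgrPdist_le/(_ e e0); rewrite near_withinE => /nbhs_ballP[d /= d0 dP].
  exists d => // h hd; have [->|h0] := eqVneq h 0.
    by rewrite addr0 subrr mul0r subr0 normr0 mulr0.
  rewrite -eqq// mulrC ler_wpM2r// distrC; apply: dP => //.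
  by rewrite /ball /= sub0r normrN.
have df : (fun h : R => h^-1 *: ((f \o shift t) (h *: 1) - f t)) @ 0^' --> r.
  apply/cvgrPdist_le => e /H[d d0 dP]; rewrite near_withinE.
  apply/nbhs_ballP; exists d => //= h.
  rewrite /ball /= sub0r normrN => /dP + h0; rewrite -eqq// mulrC.
  by rewrite ler_pM2r ?normr_gt0// distrC.
split; first by apply/cvg_ex; exists r.
exact/cvg_lim.
Qed.

(** * A smooth function that is flat at 0 *)

Section FlatFunction.
Context (R : realType).
Implicit Types (t : R) (n : nat).

(* The functions t^-n exp(-1/t), extended by 0 to t <= 0, form a family stable
   under differentiation. *)
Definition flat n t : R := if 0 < t then t ^- n * expR (- t^-1) else 0.

Lemma flat_ge0 n t : 0 <= flat n t.
Proof.
rewrite /flat; case: ifPn => // t0.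
by rewrite mulr_ge0 ?expR_ge0// invr_ge0 exprn_ge0// ltW.
Qed.

(** With y = 1/t the bound reads y^n / n! <= exp y, a single term of the exponential series. *)
Lemma flat_le n t : flat n t <= n`!%:R.
Proof.
rewrite /flat; case: ifPn => // t0.
rewrite -exprVn; set y := t^-1; have y0 : 0 < y by rewrite invr_gt0.
rewrite expRN ler_pdivrMr ?expR_gt0//.
case: n => [|n]; first by rewrite expr0 fact0 mul1r -expR0 ler_expR ltW.
rewrite mulrC -ler_pdivrMr ?ltr0n ?fact_gt0//.
apply: le_trans (expR_ge1Dxn n (ltW y0)).
by rewrite lerDr.
Qed.

Lemma flatS n t : t * flat n.+1 t = flat n t.
Proof.
rewrite /flat; case: ifPn => t0; last by rewrite mulr0.
by rewrite exprS invfM !mulrA divff ?mul1r// gt_eqF.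
Qed.

Lemma is_derive_flat n t :
  is_derive t (1 : R) (flat n) (flat n.+2 t - n%:R * flat n.+1 t).
Proof.
have [t0|t0|->] := ltgtP t 0.
- rewrite {1}/flat [flat n.+1 t]/flat !ltNge !ltW// mulr0 subr0 /=.
  apply/is_derive_epsP => e e0; exists (- t); first by rewrite oppr_gt0.
  move=> h ht; rewrite /flat !ltNge.
  have -> : t + h <= 0.
    by rewrite (le_trans (lerD (lexx t) (ler_norm h)))// -lerBrDl sub0r ltW.
  by rewrite (ltW t0)/= mulr0 !subr0 normr0 mulr_ge0// ltW.
- have : is_derive t (1 : R) (fun s => (s ^+ n)^-1 * expR (- s^-1))
      (flat n.+2 t - n%:R * flat n.+1 t).
    have tn0 : t ^+ n != 0 by rewrite expf_neq0// gt_eqF.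
    have tn1 : t != 0 by rewrite gt_eqF.
    have eX : (fun s : R => s ^+ n) = id ^+ n.
      apply/funext => s; elim: (n) => [|l IH]; first by rewrite !expr0.
      by rewrite !exprS IH.
    have dX : is_derive t (1 : R) (fun s : R => s ^+ n) (n%:R * t ^+ n.-1).
      by rewrite eX; apply: is_derive_eq; rewrite scaler1.
    have d1 := @is_deriveV R (fun s => s ^+ n) t _ _ tn0 dX.
    have d2 := @is_deriveV R id t _ _ tn1 (is_derive_id t (1 : R)).
    have d3 := @is_derive1_comp R expR (fun s => - s^-1) t _ _
      (is_derive_expR (- t^-1)) (is_deriveN d2).
    have d4 := is_deriveM d1 d3.
    apply: is_derive_eq.
    rewrite /flat t0 -[LHS]/(t ^- n * (expR (- t^-1) * - (- t ^- 2 * 1)) +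
      expR (- t^-1) * (- t ^+ n ^- 2 * (n%:R * t ^+ n.-1))).
    case: (n) => [|m]; first by rewrite !mul0r !mulr0 expr0; field.
    have T1 : t^-1 ^+ m * t ^+ m = 1 by rewrite -exprMn mulVf// expr1n.
    rewrite -!exprVn !exprS expr0; move: T1; set P := t^-1 ^+ m; set T := t ^+ m.
    set u := t^-1 => T1; set E := expR _; rewrite !mulr1 /=.
    rewrite (_ : u * P * (u * P) = u * u * P * P); last by ring.
    rewrite (_ : - (u * u * P * P) * (m.+1%:R * T) = - (u * u * P) * m.+1%:R * (P * T));
      last by ring.
    by rewrite T1; ring.
  move=> /is_derive_epsP H; apply/is_derive_epsP => e /H[d d0 dP].
  exists (Num.min d t); first by rewrite lt_min d0.
  move=> h; rewrite lt_min => /andP[/dP + ht].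
  rewrite [flat n (t + h)]/flat [flat n t]/flat t0.
  have -> // : 0 < t + h by have := ler_norm (- h); rewrite normrN; lra.
(* At 0, extracting two factors [h] from [flat n h] leaves the bounded function [flat n.+2], which
   makes the remainder quadratic. *)
- rewrite {2 3}/flat ltxx mulr0 subr0; apply/is_derive_epsP => e e0.
  have M0 : 0 < (n.+2)`!%:R :> R by rewrite ltr0n fact_gt0.
  exists (e / (n.+2)`!%:R); first by rewrite divr_gt0.
  move=> h hd; rewrite add0r {2}/flat ltxx mulr0 !subr0.
  rewrite -flatS -flatS !normrM [`|flat _ _|]ger0_norm ?flat_ge0// mulrC.
  rewrite ler_wpM2r// (le_trans (ler_wpM2l _ (flat_le _ _)))//.
  by rewrite -ler_pdivlMr// ltW.
Qed.

Lemma continuous_flat n : continuous (flat n).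
Proof.
move=> t; apply/differentiable_continuous/derivable1_diffP.
exact: (@ex_derive _ _ _ _ _ _ _ (is_derive_flat n t)).
Qed.

End FlatFunction.

Section Cutoff.
Context (R : realType) (k : nat).
Implicit Types (x : 'rV[R]_k) (J d p : R).

Definition cutoff_arg J x : R := 1 - (bracket2 x - 1) / J.

Lemma cutoff_arg_gt0 J x : 0 < J -> (0 < cutoff_arg J x) = (bracket2 x < 1 + J).
Proof. by move=> J0; rewrite subr_gt0 ltr_pdivrMr// mul1r ltrBlDl. Qed.

Lemma continuous_flat_cutoff n J : continuous (fun x => flat n (cutoff_arg J x)).
Proof.
have c : continuous (cutoff_arg J).
  have -> : cutoff_arg J = fun x => (1 + J^-1) + (- J^-1) * bracket2 x.
    by apply/funext => x; rewrite /cutoff_arg; ring.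
  apply: continuous_addr; first exact: cst_continuous.
  apply: continuous_mulr; first exact: cst_continuous.
  exact: continuous_bracket2.
move=> x; apply: (@continuous_comp _ _ _ (cutoff_arg J) (flat n)); first exact: c.
exact: continuous_flat.
Qed.

Lemma has_spd_flat_cutoff n J i x : has_spd i (fun y => flat n (cutoff_arg J y)) x
  (- (2 * x 0 i / J) *
    (flat n.+2 (cutoff_arg J x) - n%:R * flat n.+1 (cutoff_arg J x))).
Proof.
have d1 : has_spd i (cutoff_arg J) x (- (2 * x 0 i / J)).
  have := is_derive_bracket2 i x; rewrite /has_spd => db.
  have -> : (fun h : R => cutoff_arg J (line x i h)) =
      cst (1 + J^-1) \+ (fun h => (- J^-1) *: bracket2 (line x i h)).
    by apply/funext => h /=; rewrite /cutoff_arg -[_ *: _]/(_ * _); ring.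
  apply: is_derive_eq; rewrite add0r -[LHS]/(_ * _); ring.
have := @is_derive1_comp R (flat n) (fun h => cutoff_arg J (line x i h)) 0 _ _
  (is_derive_flat n _) d1.
by rewrite line0 mulrC.
Qed.

(** On the support of the cutoff [bracket2 x <= 2 * J], so negative powers of [J] turn into decay in
    [x]. *)
Lemma powRN_le J p x : 1 <= J -> 0 <= p -> bracket2 x <= 1 + J ->
  J `^ (- (p / 2)) <= 2 `^ (p / 2) * weight (- p) x.
Proof.
move=> J1 p0 xJ; have J0 : 0 < J by rewrite (lt_le_trans ltr01).
have b0 := bracket2_gt0 x; have p20 : 0 <= p / 2 by rewrite divr_ge0.
rewrite weightN powRN ler_pdivlMr ?weight_gt0// mulrC ler_pdivrMr ?powR_gt0//.
rewrite -powRM ?(ltW J0)// ge0_ler_powR// ?nnegrE ?(ltW b0)//.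
  by rewrite mulr_ge0// ltW.
by rewrite (le_trans xJ)//; lra.
Qed.

(** Each derivative brings out a factor x_i / J. The power of [J] is absorbed by passing from [p] to
    [p + 2], and the coordinate costs one order, so the order drops by exactly 1, uniformly in
    [J]. *)
Lemma ssym_flat_cutoff r : forall n p, 0 <= p -> exists C, forall J, 1 <= J ->
  ssym r (- p) (fun x => J `^ (- (p / 2)) * flat n (cutoff_arg J x)) C.
Proof.
have base n p J x : 0 <= p -> 1 <= J ->
    `|J `^ (- (p / 2)) * flat n (cutoff_arg J x)| <=
    n`!%:R * 2 `^ (p / 2) * weight (- p) x.
  move=> p0 J1; rewrite normrM !ger0_norm ?powR_ge0 ?flat_ge0//.
  have [a0|a0] := ltP 0 (cutoff_arg J x); last first.
    by rewrite /flat ltNge a0 mulr0 !mulr_ge0 ?powR_ge0 ?weight_ge0.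
  rewrite mulrC -mulrA ler_pM ?flat_ge0 ?powR_ge0 ?flat_le// powRN_le//.
  by rewrite ltW// -cutoff_arg_gt0// (lt_le_trans ltr01).
have cont n p J : continuous (fun x => J `^ (- (p / 2)) * flat n (cutoff_arg J x)).
  by apply: continuous_mulr; [exact: cst_continuous|exact: continuous_flat_cutoff].
elim: r => [|r IH] n p p0.
  by exists (n`!%:R * 2 `^ (p / 2)) => J J1; split=> // x; exact: base.
have p20 : 0 <= p + 2 by rewrite addr_ge0.
have [C1 H1] := IH n.+2 _ p20; have [C2 H2] := IH n.+1 _ p20.
pose C' := 2 ^+ r * 1 * (2 ^+ r * `|- 2| * C1 + 2 ^+ r * `|2 * n%:R| * C2).
have C10 : 0 <= C1 by exact: ssym_ge0 (H1 1 (lexx _)).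
have C20 : 0 <= C2 by exact: ssym_ge0 (H2 1 (lexx _)).
have C'0 : 0 <= C' by rewrite !(mulr_ge0, addr_ge0).
have K0 : 0 <= n`!%:R * 2 `^ (p / 2) :> R by rewrite mulr_ge0 ?powR_ge0.
exists (n`!%:R * 2 `^ (p / 2) + C') => J J1.
have J0 : 0 < J by rewrite (lt_le_trans ltr01).
split=> //.
  by move=> x; rewrite (le_trans (base _ _ _ _ p0 J1))// ler_wpM2r ?weight_ge0// lerDl.
exists (fun i x => x 0 i *
  ((- 2) * (J `^ (- ((p + 2) / 2)) * flat n.+2 (cutoff_arg J x)) +
   (2 * n%:R) * (J `^ (- ((p + 2) / 2)) * flat n.+1 (cutoff_arg J x)))).
  move=> i x; have := has_spd_flat_cutoff n J i x; rewrite /has_spd => d.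
  rewrite (_ : (fun h => _) = (fun h => J `^ (- (p / 2)) *:
    flat n (cutoff_arg J (line x i h))))//.
  apply: is_derive_eq; rewrite -[LHS]/(_ * _).
  have -> : - ((p + 2) / 2) = - (p / 2) + (- 1) by field.
  rewrite powRD; last by apply/implyP => _; rewrite gt_eqF.
  by rewrite powR_inv1 ?(ltW J0)//; ring.
move=> i.
have := ssymM (ssym_coord R r i)
  (ssymD (ssymZ (- 2) (H1 J J1)) (ssymZ (2 * n%:R) (H2 J J1))).
by apply: ssym_le; [lra|rewrite lerDr].
Qed.

(** The factor [expR 1] normalises the value at the origin to 1. *)
Definition cutoff J x : R := expR 1 * flat 0 (cutoff_arg J x).

Lemma cutoff_eq0 J x i : 1 <= J -> J < `|x 0 i| -> cutoff J x = 0.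
Proof.
move=> J1 Jx; have J0 : 0 < J by rewrite (lt_le_trans ltr01).
rewrite /cutoff /flat cutoff_arg_gt0// ifF ?mulr0//.
apply/negbTE; rewrite -leNgt (le_trans _ (bracket2_coord x i))// lerD2l.
rewrite -[_ ^+ 2]ger0_norm ?sqr_ge0// normrX (le_trans (ltW Jx))//.
by rewrite expr2 ler_peMl// (le_trans J1)// ltW.
Qed.

Lemma ssym_cutoff r : exists C, forall J, 1 <= J -> ssym r 0 (cutoff J) C.
Proof.
have [C H] := ssym_flat_cutoff r 0 (lexx 0).
exists (2 ^+ r * `|expR 1| * C) => J J1; have := ssymZ (expR 1) (H J J1).
rewrite oppr0; congr (ssym r 0 _ _); apply/funext => x.
by rewrite mul0r oppr0 powRr0 mul1r.
Qed.

(** For [s <= 1 / 2] the difference is at most [s / (1 - s) <= 2 * s]; for larger [s] it is at most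
    1. *)
Lemma expR_flat_le s : 0 <= s -> `|expR 1 * flat 0 (1 - s) - 1| <= 2 * s :> R.
Proof.
move=> s0; rewrite /flat; case: ifPn => [s1|]; last first.
  by rewrite -leNgt mulr0 sub0r normrN normr1 => ?; lra.
rewrite expr0 invr1 mul1r -expRD.
have y0 : 0 < 1 - s by [].
have e1 : 1 - (1 - s)^-1 = - (s / (1 - s)) by field; rewrite gt_eqF.
rewrite e1; have t0 : 0 <= s / (1 - s) by rewrite divr_ge0// ltW.
have h1 := expR_ge1Dx (- (s / (1 - s))).
have h2 : expR (- (s / (1 - s))) <= 1 by rewrite expR_le1 oppr_le0.
rewrite ler0_norm ?subr_le0// opprB.
have h3 := expR_ge0 (- (s / (1 - s))).
have [s2|s2] := leP s (1 / 2); last by lra.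
apply: (@le_trans _ _ (s / (1 - s))); first by lra.
by rewrite ler_pdivrMr//; nra.
Qed.

Lemma ssym_cutoffB1 r d : 0 < d <= 2 -> exists C, forall J, 1 <= J ->
  ssym r d (fun x => J `^ (d / 2) * (cutoff J x - 1)) C.
Proof.
move=> /andP[d0 d2].
have d20 : 0 <= d / 2 by rewrite divr_ge0// ltW.
have base J x : 1 <= J -> `|J `^ (d / 2) * (cutoff J x - 1)| <= 4 * weight d x.
  move=> J1; have J0 : 0 < J by rewrite (lt_le_trans ltr01).
  have b0 := bracket2_gt0 x; have b1 := bracket2_ge1 x.
  rewrite normrM ger0_norm ?powR_ge0//.
  have [xJ|xJ] := ltP (bracket2 x) (1 + J); last first.
    rewrite /cutoff /flat cutoff_arg_gt0// ltNge xJ /= mulr0 sub0r normrN normr1.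
    rewrite mulr1 (@le_trans _ _ (weight d x))//; last first.
      by rewrite ler_peMl ?weight_ge0//; lra.
    by rewrite ge0_ler_powR// ?nnegrE ?(ltW J0) ?(ltW b0)//; lra.
  have s0 : 0 <= (bracket2 x - 1) / J by rewrite divr_ge0 ?subr_ge0// ltW.
  rewrite (le_trans (ler_wpM2l (powR_ge0 _ _) (expR_flat_le s0)))//.
  have p0 : 0 <= 2 - d by lra.
  have := powRN_le J1 p0 (ltW xJ).
  rewrite (_ : - ((2 - d) / 2) = d / 2 + - 1); last by field.
  rewrite powRD; last by apply/implyP => _; rewrite gt_eqF.
  rewrite powR_inv1 ?(ltW J0)// opprB weightD weightN weight2.
  have : 2 `^ ((2 - d) / 2) <= 2 :> R.
    by rewrite -[leRHS]powRr1// ler_powR ?ler1n//; lra.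
  set A := J `^ _; set T := 2 `^ _; set W := weight d x => T2 HJ.
  have W0 : 0 <= W by exact: weight_ge0.
  have A0 : 0 <= A / J by rewrite divr_ge0 ?powR_ge0// ltW.
  rewrite (_ : A * _ = 2 * (bracket2 x - 1) * (A / J)); last by ring.
  apply: (@le_trans _ _ (2 * bracket2 x * (A / J))).
    by rewrite ler_wpM2r//; lra.
  have := ler_wpM2l (ltW b0) HJ.
  rewrite (_ : bracket2 x * (T * (W / bracket2 x)) = T * W); last by field; rewrite gt_eqF.
  by have := ler_wpM2r W0 T2; lra.
have cont J : continuous (fun x => J `^ (d / 2) * (cutoff J x - 1)).
  apply: continuous_mulr; first exact: cst_continuous.
  apply: continuous_addr; last exact: cst_continuous.
  by apply: continuous_mulr; [exact: cst_continuous|exact: continuous_flat_cutoff].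
case: r => [|r]; first by exists 4 => J J1; split=> // x; exact: base.
have p0 : 0 <= 2 - d by lra.
have [C H] := ssym_flat_cutoff r 2 p0.
have C0 : 0 <= C by exact: ssym_ge0 (H 1 (lexx _)).
pose C' := 2 ^+ r * 1 * (2 ^+ r * `|- 2 * expR 1| * C).
have C'0 : 0 <= C' by rewrite !mulr_ge0.
exists (4 + C') => J J1.
have J0 : 0 < J by rewrite (lt_le_trans ltr01).
split=> //.
  by move=> x; rewrite (le_trans (base _ _ J1))// ler_wpM2r ?weight_ge0// lerDl.
exists (fun i x => x 0 i *
  ((- 2 * expR 1) * (J `^ (- ((2 - d) / 2)) * flat 2 (cutoff_arg J x)))).
  move=> i x; have := has_spd_flat_cutoff 0 J i x; rewrite /has_spd => d1.
  rewrite (_ : (fun h => _) = (fun h => (J `^ (d / 2) * expR 1) *: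
    flat 0 (cutoff_arg J (line x i h))) \+ cst (- J `^ (d / 2))); last first.
    by apply/funext => h /=; rewrite /cutoff -[_ *: _]/(_ * _); ring.
  apply: is_derive_eq; rewrite subr0 -[LHS]/(_ * _).
  rewrite (_ : - ((2 - d) / 2) = d / 2 + - 1); last by field.
  rewrite powRD; last by apply/implyP => _; rewrite gt_eqF.
  by rewrite powR_inv1 ?(ltW J0)//; ring.
move=> i; have := ssymM (ssym_coord R r i) (ssymZ (- 2 * expR 1) (H J J1)).
by apply: ssym_le; [lra|rewrite lerDr].
Qed.

End Cutoff.

(** * Vector-valued symbols *)

Section ScalarMultiples.
Context (R : realType) (V : tvsType R[i]) (Q : set (V -> R)) (k : nat).
Hypotheses (defQ : defining_system Q) (hV : hausdorff_space V).
Implicit Types (F G : 'rV[R]_k -> V) (x : 'rV[R]_k) (i j : 'I_k).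
Implicit Types (a : 'rV[R]_k -> R) (d s rho : R).

Let seminormQ q : Q q -> is_seminorm q. Proof. by case: defQ => + _ _; apply. Qed.

Definition smul a F : 'rV[R]_k -> V := fun x => (a x)%:C *: F x.

Lemma smul_linear a (c : R[i]) F G :
  smul a (c *: F + G) = c *: smul a F + smul a G.
Proof.
apply/funext => x; rewrite /smul -[(c *: F + G) x]/(c *: F x + G x).
by rewrite scalerDr complex_scale_comm.
Qed.

Lemma smulBl a b F : smul a F - smul b F = smul (fun x => a x - b x) F.
Proof.
apply/funext => x; rewrite /smul -[LHS]/((a x)%:C *: F x - (b x)%:C *: F x).
by rewrite -scalerBl rmorphB.
Qed.

Lemma supported_smul A a F : supported_in A F -> supported_in A (smul a F).
Proof.
move=> sF x /= aF0; apply: sF => /=; apply: contra_neq aF0 => F0.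
by rewrite /smul F0 scaler0.
Qed.

Lemma continuous_smul a F : continuous a -> continuous F -> continuous (smul a F).
Proof.
move=> ca cF x; apply/(cvg_seminormP defQ (nbhs_filter x)) => q Qq e e0.
have sq := seminormQ Qq; have qF := seminorm_ge0 sq (F x).
have qF1 : 0 < q (F x) + 1 by rewrite ltr_wpDl.
have a1 : 0 < `|a x| + 1 by rewrite ltr_wpDl.
have e20 : 0 < e / 2 by rewrite divr_gt0.
have /cvgrPdist_lt ca' := ca x.
have H1 := ca' 1 ltr01; have H2 := ca' _ (divr_gt0 e20 qF1).
have /(cvg_seminormP defQ (nbhs_filter x))/(_ q Qq _ (divr_gt0 e20 a1)) H3 := cF x.
apply: filterS (filterI H1 (filterI H2 H3)) => y [/= h1 [h2 h3]].
have -> : smul a F y - smul a F x =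
    (a y)%:C *: (F y - F x) + (a y - a x)%:C *: F x.
  by rewrite scalerBr rmorphB scalerBl addrA subrK.
rewrite (le_lt_trans (seminorm_subadd sq _ _))// [e]splitr.
rewrite ler_ltD// (seminormZr sq).
  apply: (@le_trans _ _ ((`|a x| + 1) * q (F y - F x))).
    rewrite ler_wpM2r ?(seminorm_ge0 sq)// -[a y](subrK (a x)) addrC.
    by rewrite (le_trans (ler_normD _ _))// lerD2l distrC ltW.
  by rewrite mulrC -ler_pdivlMr// ltW.
apply: (@le_lt_trans _ _ (`|a y - a x| * (q (F x) + 1))).
  by rewrite ler_wpM2l// lerDl.
by rewrite -ltr_pdivlMr// distrC.
Qed.

Lemma has_pd_smul a F i x (r : R) (v : V) :
  has_spd i a x r -> has_pd Q i F x v ->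
  has_pd Q i (smul a F) x (r%:C *: F x + (a x)%:C *: v).
Proof.
move=> /is_derive_epsP da dF q Qq e e0; have sq := seminormQ Qq.
have qF := seminorm_ge0 sq (F x); have qv := seminorm_ge0 sq v.
(* The remainder of the product splits into three parts, and [K] adds up the factors with which [e1]
   enters their bounds. The condition [e1 <= 1] keeps the increments of [a] under control. *)
pose K := `|a x| + `|r| + 1 + q (F x) + (`|r| + 1) * q v.
have K1 : 1 <= K.
  by rewrite /K; have := normr_ge0 (a x); have := normr_ge0 r; nra.
have K0 : 0 < K by rewrite (lt_le_trans ltr01).
pose e1 := Num.min 1 (e / K).
have e10 : 0 < e1 by rewrite lt_min ltr01 divr_gt0.
have [d1 d10 ha] := da _ e10; have [d2 d20 hF] := dF q Qq _ e10.
exists (Num.min (Num.min d1 d2) e1); first by rewrite lt_min e10 lt_min d10 d20.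
move=> h; rewrite lt_min => /andP[+ /ltW he].
rewrite lt_min => /andP[/ha {}ha /hF {}hF].
rewrite !add0r line0 in ha hF *.
set y := line x i h in ha hF *.
have -> : smul a F y - smul a F x - h%:C *: (r%:C *: F x + (a x)%:C *: v) =
    (a y)%:C *: (F y - F x - h%:C *: v) + (a y - a x - h * r)%:C *: F x +
    (a y - a x)%:C *: (h%:C *: v).
  have tel (X Y Z W U T : V) : X - W - (U + T) = X - Y - Z + (Y - W - U) + (Z - T).
    by rewrite opprD [X - Y - Z + _]addrACA (subrKA Y) -[RHS]addrA [- Z - U]addrC (subrKA Z).
  rewrite /smul !scalerBr !rmorphB rmorphM !scalerBl !scalerDr !scalerA.
  by rewrite [h%:C * (a x)%:C]mulrC -tel.
have ah : `|a y - a x| <= (`|r| + 1) * `|h|.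
  rewrite -[_ - _](subrK (h * r)) (le_trans (ler_normD _ _))// normrM addrC.
  rewrite mulrDl mulrC lerD2l (le_trans ha)// ler_wpM2r// ge_min lexx//.
have e11 : e1 <= 1 by rewrite ge_min lexx.
have ay : `|a y| <= `|a x| + `|r| + 1.
  rewrite -[a y](subrK (a x)) addrC (le_trans (ler_normD _ _))// -addrA lerD2l.
  rewrite (le_trans ah)// ler_piMr ?addr_ge0//; exact: le_trans he e11.
have eK : e1 * K <= e by rewrite -ler_pdivlMr// ge_min lexx orbT.
apply: (@le_trans _ _ (e1 * K * `|h|)); last by rewrite ler_wpM2r.
rewrite (_ : e1 * K * `|h| = (`|a x| + `|r| + 1) * (e1 * `|h|) +
  e1 * `|h| * q (F x) + (`|r| + 1) * `|h| * (e1 * q v)); last by rewrite /K; ring.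
rewrite (le_trans (seminorm_subadd sq _ _))// lerD//.
  rewrite (le_trans (seminorm_subadd sq _ _))// lerD// (seminormZr sq).
    by rewrite ler_pM// (seminorm_ge0 sq).
  by rewrite ler_wpM2r.
rewrite !(seminormZr sq) ler_pM ?mulr_ge0//.
by rewrite ler_wpM2r.
Qed.

Lemma Ck_smul r d a C F : ssym r d a C -> Ck r F -> Ck r (smul a F).
Proof.
elim: r d a F => [|r IH] d a F sa CF.
  split=> //; apply: continuous_smul; last exact: Ck_continuous CF.
  exact: ssym_continuous sa.
have [ca _ [D hD sD]] := sa.
apply: (CkS defQ hV (G := fun i => 1 *: smul (D i) F + smul a (partial i F))).
- by apply: continuous_smul => //; exact: Ck_continuous CF.
- move=> i x; have := has_pd_smul (hD i x) (Ck_has_pd defQ hV i x CF).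
  by rewrite scale1r.
- move=> i; apply: (Ck_linear defQ hV).
    exact: IH (sD i) (Ck_pred defQ hV CF).
  exact: IH (ssym_pred sa) (Ck_partial i CF).
Qed.

(** More than smoothness: the derivatives have polynomial growth of symbol type. The order may
    depend on [r], which is enough for products with smooth functions. *)
Definition smooth_scalar a := forall r, exists d C, ssym r d a C.

Lemma smooth_smul a F : smooth_scalar a -> smooth F -> smooth (smul a F).
Proof. by move=> sa sF r; have [d [C]] := sa r => /Ck_smul; apply. Qed.

(** The derivatives are iterated in arbitrary succession instead of being indexed by multi-indices,
    so that the product rule can be applied by recursion on [r]. One constant [A] serves all of
    them. *)
Fixpoint vsym (q : V -> R) rho r s F (A : R) : Prop :=
  (forall x, q (F x) <= A * weight s x) /\
  if r is r'.+1 then forall i, vsym q rho r' (s - rho) (partial i F) A else True.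

Lemma vsym_bound q rho r s F A x : vsym q rho r s F A -> q (F x) <= A * weight s x.
Proof. by case: r => [|r] []. Qed.

Lemma vsym_ge0 q rho r s F A : Q q -> vsym q rho r s F A -> 0 <= A.
Proof.
move=> Qq /(vsym_bound 0)/(le_trans (seminorm_ge0 (seminormQ Qq) _)).
by rewrite pmulr_lge0// weight_gt0.
Qed.

Lemma vsym_le q rho rho' r s s' F A A' : Q q -> rho' <= rho -> s <= s' -> A <= A' ->
  vsym q rho r s F A -> vsym q rho' r s' F A'.
Proof.
move=> Qq rr + AA'; elim: r s s' F => [|r IH] s s' F ss' sF;
  have A0 := vsym_ge0 Qq sF; case: sF => bF HF; split=> //;
  try by move=> x; rewrite (le_trans (bF x))// ler_pM ?weight_ge0// weight_le.
by move=> i; apply: IH (HF i); rewrite lerB.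
Qed.

Lemma vsym_pred q rho r s F A : vsym q rho r.+1 s F A -> vsym q rho r s F A.
Proof.
by elim: r s F => [|r IH] s F [bF HF]; split=> // i; apply: IH; exact: HF.
Qed.

Lemma vsym_lt q rho r r' s F A : (r <= r')%N ->
  vsym q rho r' s F A -> vsym q rho r s F A.
Proof.
move=> /subnK <-; elim: (r' - r)%N => [//|l IH]; rewrite addSn.
by move=> /vsym_pred.
Qed.

Lemma vsym_linear q rho r s (c : R[i]) F G A A' : Q q -> Ck r F -> Ck r G ->
  vsym q rho r s F A -> vsym q rho r s G A' ->
  vsym q rho r s (c *: F + G) (complex.Re `|c| * A + A').
Proof.
move=> Qq; have sq := seminormQ Qq.
elim: r s F G => [|r IH] s F G CF CG [bF HF] [bG HG]; split=> //;
  try by move=> x; rewrite mulrDl -mulrA (le_trans (seminorm_subadd sq _ _))//;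
    rewrite lerD// (seminormZ sq) ler_wpM2l// normc_Re_ge0.
move=> i; rewrite (partial_linear defQ hV).
- exact: IH (Ck_partial i CF) (Ck_partial i CG) (HF i) (HG i).
- by move=> x; exact: (Ck_has_pd defQ hV i x CF).
- by move=> x; exact: (Ck_has_pd defQ hV i x CG).
Qed.

Lemma vsym0 q rho r s (A : R) : Q q -> 0 <= A -> vsym q rho r s 0 A.
Proof.
move=> Qq A0; elim: r s => [|r IH] s; split=> //;
  try by move=> x; rewrite (seminorm0 (seminormQ Qq)) mulr_ge0// weight_ge0.
by move=> i; rewrite (partial0 defQ hV).
Qed.

Lemma partial_smul r d a C F i : ssym r.+1 d a C -> Ck 1 F -> exists2 D,
  ssym r (d - 1) D C & partial i (smul a F) = 1 *: smul D F + smul a (partial i F).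
Proof.
move=> [_ _ [D hD sD]] CF; exists (D i); first exact: sD.
apply/funext => x; rewrite scale1r; apply: (partialE defQ hV).
by have := has_pd_smul (hD i x) (Ck_has_pd defQ hV i x CF).
Qed.

(** A derivative that falls on [a] lowers the order by 1, hence by at least [rho], because
    [rho <= 1]. The factor [2 ^+ r] is that of the Leibniz rule. *)
Lemma vsym_smul q rho r d s a C F A : Q q -> rho <= 1 ->
  ssym r d a C -> Ck r F -> vsym q rho r s F A ->
  vsym q rho r (d + s) (smul a F) (2 ^+ r * C * A).
Proof.
move=> Qq rho1; have sq := seminormQ Qq.
elim: r d s a F => [|r IH] d s a F sa CF sF;
  have C0 := ssym_ge0 sa; have A0 := vsym_ge0 Qq sF.
  split=> // x; rewrite expr0 mul1r (seminormZr sq) weightD mulrACA.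
  by rewrite ler_pM ?(seminorm_ge0 sq) ?(ssym_bound x sa) ?(vsym_bound x sF).
split.
  move=> x; rewrite (seminormZr sq) weightD.
  rewrite [leRHS](_ : _ = 2 ^+ r.+1 * (C * weight d x * (A * weight s x)));
    last by ring.
  apply: (@le_trans _ _ (C * weight d x * (A * weight s x))).
    by rewrite ler_pM ?(seminorm_ge0 sq) ?(ssym_bound x sa) ?(vsym_bound x sF).
  by rewrite ler_peMl ?mulr_ge0 ?weight_ge0// exprn_ege1// ler1n.
move=> i; have CF1 : Ck 1 F.
  by elim: (r) CF => // l IHl /(Ck_pred defQ hV)/IHl.
have [D sD ->] := partial_smul i sa CF1.
have CFr := Ck_pred defQ hV CF; have CdF := Ck_partial i CF.
have H1 : vsym q rho r (d + s - rho) (smul D F) (2 ^+ r * C * A).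
  apply: (vsym_le Qq (lexx rho) _ (lexx _)) (IH _ _ _ _ sD CFr (vsym_pred sF)).
  by lra.
have H2 : vsym q rho r (d + s - rho) (smul a (partial i F)) (2 ^+ r * C * A).
  by rewrite -addrA; apply: IH (ssym_pred sa) CdF _; case: sF => _; apply.
have := vsym_linear 1 Qq (Ck_smul sD CFr) (Ck_smul (ssym_pred sa) CdF) H1 H2.
by congr vsym; rewrite normr1 /= exprS; ring.
Qed.

Lemma vsym_iter q rho r n s F A i : vsym q rho (n + r) s F A ->
  vsym q rho r (s - rho * n%:R) (iter n (partial i) F) A.
Proof.
elim: n r => [|n IH] r; first by rewrite mulr0 subr0.
rewrite addSnnS => /IH [_ /(_ i)] /=; congr vsym.
by rewrite -natr1; ring.
Qed.

Lemma vsym_pderiv q rho r s F A (mu : multi_index k) x :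
  vsym q rho r s F A -> (\sum_(i < k) mu i <= r)%N ->
  q (pderiv mu F x) <= A * weight (s - rho * (\sum_(i < k) mu i)%N%:R) x.
Proof.
move=> sF mur; rewrite /pderiv -[index_enum _]enumT.
(* The induction along the list of directions carries [n] spare derivatives. *)
suff H n : vsym q rho (\sum_(i <- enum 'I_k) mu i + n) s F A ->
    vsym q rho n (s - rho * (\sum_(i <- enum 'I_k) mu i)%N%:R)
      (foldr (fun i G => iter (mu i) (partial i) G) F (enum 'I_k)) A.
  apply: vsym_bound; apply: (H 0%N); rewrite addn0.
  by apply: vsym_lt sF; rewrite enumT.
elim: (enum 'I_k) n => [|i l IH] n; first by rewrite !big_nil mulr0 subr0.
rewrite !big_cons -addnA addnCA => /IH /= /(vsym_iter i); congr vsym.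
by rewrite natrD; ring.
Qed.

(** By the commutation of partial derivatives, every iterated derivative is the [pderiv] of a
    multi-index. *)
Lemma vsym_of_pderiv q rho r s F (A : R) : smooth F ->
  (forall mu : multi_index k, (\sum_(i < k) mu i <= r)%N -> forall x,
    q (pderiv mu F x) <= A * weight (s - rho * (\sum_(i < k) mu i)%N%:R) x) ->
  vsym q rho r s F A.
Proof.
move=> sF HF.
pose z : multi_index k := [ffun=> 0%N].
have z0 : (\sum_(i < k) z i)%N = 0%N by rewrite big1// => i _; rewrite ffunE.
have Fz : F = pderiv z F.
  rewrite /pderiv; elim: (enum 'I_k) => //= i l <-.
  by rewrite ffunE.
suff H n (nu : multi_index k) : ((\sum_(i < k) nu i)%N + n <= r)%N ->
    vsym q rho n (s - rho * (\sum_(i < k) nu i)%N%:R) (pderiv nu F) A.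
  rewrite Fz; have := H r z; rewrite z0 mulr0 subr0; exact.
elim: n nu => [|n IH] nu nur.
  by split=> // x; apply: HF; rewrite addn0 in nur.
split=> [x|i]; first by apply: HF; rewrite (leq_trans _ nur)// leq_addr.
rewrite (partial_pderiv defQ hV)//.
have := IH (incr_index nu i); rewrite sum_incr_index addSnnS => /(_ nur).
by congr vsym; rewrite -natr1; ring.
Qed.

End ScalarMultiples.

(** * The phase function *)

Section Phase.
Context (R : realType) (n : nat) (B : {biscalar 'rV[R]_n}).
Implicit Types (z : 'rV[R]_(n + n)) (i j l : 'I_(n + n)).

Local Notation unit_row := (delta_mx (0 : 'I_1)).

Definition phase_form z : R := B (lsubmx z) (rsubmx z).

Definition phase_grad j z : R :=
  B (lsubmx (unit_row j)) (rsubmx z) + B (lsubmx z) (rsubmx (unit_row j)).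

Lemma biscalarDl p p' x : B (p + p') x = B p x + B p' x.
Proof. by rewrite linearDl. Qed.
Lemma biscalarDr p x x' : B p (x + x') = B p x + B p x'.
Proof. by rewrite linearD. Qed.
Lemma biscalarZl c p x : B (c *: p) x = c * B p x.
Proof. by rewrite linearZl_LR. Qed.
Lemma biscalarZr c p x : B p (c *: x) = c * B p x.
Proof. by rewrite linearZr_LR. Qed.

Lemma phase_form_line z j h : phase_form (line z j h) =
  phase_form z + h * phase_grad j z + h ^+ 2 * phase_form (unit_row j).
Proof.
rewrite /phase_form /phase_grad /line !linearD !linearZ /=.
rewrite !(biscalarDl, biscalarDr, biscalarZl, biscalarZr).
ring.
Qed.

Lemma phase_grad_linear j c z z' :
  phase_grad j (c *: z + z') = c * phase_grad j z + phase_grad j z'.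
Proof.
rewrite /phase_grad !linearD !linearZ /=.
rewrite !(biscalarDl, biscalarDr, biscalarZl, biscalarZr).
ring.
Qed.

Lemma row_linear_sum m (f : 'rV[R]_m -> R) :
  (forall c (u v : 'rV[R]_m), f (c *: u + v) = c * f u + f v) ->
  forall u : 'rV[R]_m, f u = \sum_l u 0 l * f (unit_row l).
Proof.
move=> fL z; have f0 : f 0 = 0.
  by have := fL (-1) 0 0; rewrite scaler0 addr0 mulN1r addNr.
rewrite {1}[z]row_sum_delta; elim/big_rec2 : _ => // l y u _ <-.
by rewrite fL.
Qed.

Lemma phase_form_sum z : phase_form z = 
  \sum_(a < n) \sum_(b < n) z 0 (lshift n a) * (z 0 (rshift n b) *
    B (unit_row a) (unit_row b)).
Proof.
rewrite /phase_form (@row_linear_sum _ (fun p => B p (rsubmx z))).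
  apply: eq_bigr => a _; rewrite mxE (@row_linear_sum _ (fun x => B (unit_row a) x)).
    by rewrite mulr_sumr; apply: eq_bigr => b _; rewrite mxE.
  by move=> c u v; rewrite biscalarDr biscalarZr.
by move=> c u v; rewrite biscalarDl biscalarZl.
Qed.

Lemma continuous_phase_form : continuous phase_form.
Proof.
rewrite (funext phase_form_sum).
apply: continuous_sumr => a; apply: continuous_sumr => b.
apply: continuous_mulr => [x|]; first exact: coord_continuous.
apply: continuous_mulr => [x|]; first exact: coord_continuous.
exact: cst_continuous.
Qed.

Lemma has_spd_phase_form j z : has_spd j phase_form z (phase_grad j z).
Proof.
rewrite /has_spd (_ : (fun h => _) = cst (phase_form z) \+
  (fun h => phase_grad j z *: h) \+
  (fun h => phase_form (unit_row j) *: (h * h))).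
  apply: is_derive_eq.
  by rewrite !scale0r !addr0 add0r scaler0 addr0 scaler1.
by apply/funext => h; rewrite phase_form_line /= -![_ *: _]/(_ * _); ring.
Qed.

Lemma has_spd_cos_phase j z : has_spd j (fun y => cos (phase_form y)) z
  (- sin (phase_form z) * phase_grad j z).
Proof.
have := @is_derive1_comp R cos (fun h => phase_form (line z j h)) 0 _ _
  (is_derive_cos _) (has_spd_phase_form j z).
by rewrite line0.
Qed.

Lemma has_spd_sin_phase j z : has_spd j (fun y => sin (phase_form y)) z
  (cos (phase_form z) * phase_grad j z).
Proof.
have := @is_derive1_comp R sin (fun h => phase_form (line z j h)) 0 _ _
  (is_derive_sin _) (has_spd_phase_form j z).
by rewrite line0.
Qed.

Lemma continuous_cos_phase : continuous (fun y => cos (phase_form y)).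
Proof.
move=> x; apply: (@continuous_comp _ _ _ phase_form (@cos R)).
  exact: continuous_phase_form.
exact: continuous_cos.
Qed.

Lemma continuous_sin_phase : continuous (fun y => sin (phase_form y)).
Proof.
move=> x; apply: (@continuous_comp _ _ _ phase_form (@sin R)).
  exact: continuous_phase_form.
exact: continuous_sin.
Qed.

(** The gradient is [z *m M]. If it vanishes, its first block shows that [rsubmx z] is annihilated
    by the form, its second block that [lsubmx z] is. Hence [M] is invertible, and its inverse
    expresses the coordinates by the gradient. *)
Lemma coord_phase_grad : nondegenerate_form B ->
  exists T : 'M[R]_(n + n), forall l z, z 0 l = \sum_j T l j * phase_grad j z.
Proof.
move=> [Bl Br].
pose M : 'M[R]_(n + n) := \matrix_(l, j) phase_grad j (unit_row l).
have zM z j : (z *m M) 0 j = phase_grad j z.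
  rewrite (row_linear_sum (phase_grad_linear j)) mxE; apply: eq_bigr => l _.
  by rewrite mxE.
have uM : M \in unitmx.
  rewrite -row_free_unit -kermx_eq0; apply/rowV0P => z /sub_kermxP zM0.
  have g0 j : phase_grad j z = 0 by rewrite -zM zM0 mxE.
  have r0 : rsubmx z = 0.
    apply: Br => p; rewrite (@row_linear_sum _ (fun p => B p (rsubmx z))).
      rewrite big1// => a _; have := g0 (lshift n a).
      rewrite /phase_grad (_ : lsubmx _ = unit_row a).
        rewrite (_ : rsubmx (unit_row _) = 0) ?linear0 ?addr0 => [->|]; first by rewrite mulr0.
        by apply/rowP => b; rewrite !mxE eq_rlshift andbF.
      by apply/rowP => b; rewrite !mxE (inj_eq (@lshift_inj _ _)).
    by move=> c u v; rewrite biscalarDl biscalarZl.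
  have l0 : lsubmx z = 0.
    apply: Bl => x; rewrite (@row_linear_sum _ (fun x => B (lsubmx z) x)).
      rewrite big1// => a _; have := g0 (rshift n a).
      by rewrite /phase_grad r0 linear0 add0r (_ : rsubmx _ = unit_row a) => [->|];
        [rewrite mulr0|apply/rowP => b; rewrite !mxE (inj_eq (@rshift_inj _ _))].
    by move=> c u v; rewrite biscalarDr biscalarZr.
  by rewrite -[z]hsubmxK l0 r0 row_mx0.
exists (\matrix_(l, j) invmx M j l) => l z.
rewrite -{1}[z](mulmxK uM) mxE; apply: eq_bigr => j _.
by rewrite zM mxE mulrC.
Qed.

End Phase.

Section PhaseIntegrals.
Context (R : realType) (V : tvsType R[i]) (Q : set (V -> R)) (n : nat).
Context (B : {biscalar 'rV[R]_n}).
Hypotheses (defQ : defining_system Q) (hV : hausdorff_space V).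
Hypothesis complV : sequentially_complete V.
Local Notation k := (n + n)%N.
Implicit Types (F G : 'rV[R]_k -> V) (x : 'rV[R]_k) (i j l : 'I_k).

Let seminormQ q : Q q -> is_seminorm q. Proof. by case: defQ => + _ _; apply. Qed.

Definition phase_mul F : 'rV[R]_k -> V := fun z => phase B z *: F z.

Lemma phaseE z :
  phase B z = (cos (phase_form B z))%:C + 'i%C * (sin (phase_form B z))%:C.
Proof. by rewrite [LHS]complexE. Qed.

Lemma phase_mulE F : phase_mul F =
  'i%C *: smul (fun z => sin (phase_form B z)) F + smul (fun z => cos (phase_form B z)) F.
Proof.
apply/funext => z; rewrite /phase_mul phaseE scalerDl addrC -scalerA.
by [].
Qed.

Lemma phase_mul_linear (c : R[i]) F G :
  phase_mul (c *: F + G) = c *: phase_mul F + phase_mul G.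
Proof.
apply/funext => z; rewrite /phase_mul -[(c *: F + G) z]/(c *: F z + G z).
by rewrite scalerDr complex_scale_comm.
Qed.

Lemma continuous_phase_mul F : continuous F -> continuous (phase_mul F).
Proof.
move=> cF; rewrite phase_mulE; apply: (continuous_linear defQ).
  by apply: (continuous_smul defQ) => //; exact: continuous_sin_phase.
by apply: (continuous_smul defQ) => //; exact: continuous_cos_phase.
Qed.

Lemma supported_phase_mul a F : supported_in a F -> supported_in a (phase_mul F).
Proof.
move=> sF x /= pF0; apply: sF => /=; apply: contra_neq pF0 => F0.
by rewrite /phase_mul F0 scaler0.
Qed.

Lemma seminorm_phase_mul q F x : Q q -> q (phase_mul F x) = q (F x).
Proof.
move=> Qq; rewrite (seminormZ (seminormQ Qq)) /phase normc_def /=.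
by rewrite cos2Dsin2 sqrtr1 mul1r.
Qed.

Lemma has_pd_phase_mul F i x (v : V) : has_pd Q i F x v ->
  has_pd Q i (phase_mul F) x
    ('i%C *: ((phase_grad B i x)%:C *: phase_mul F x) + phase B x *: v).
Proof.
move=> dF; rewrite [X in has_pd Q i X]phase_mulE.
have := has_pd_linear defQ 'i%C
  (has_pd_smul defQ (has_spd_sin_phase B i x) dF)
  (has_pd_smul defQ (has_spd_cos_phase B i x) dF).
congr has_pd.
rewrite scalerDr addrACA /phase_mul !scalerA -!scalerDl.
congr (_ *: _ + _ *: _); rewrite phaseE //.
  have ii : 'i%C * 'i%C = - 1 :> R[i] by rewrite -expr2 sqr_i.
  have id (c S s : R[i]) : 'i%C * (c * S) + - s * S = 'i%C * S * (c + 'i%C * s).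
    rewrite (_ : - s * S = ('i%C * 'i%C) * (s * S)); last by rewrite ii; ring.
    by ring.
  by rewrite !rmorphM rmorphN; exact: id.
by rewrite addrC.
Qed.

End PhaseIntegrals.

(** * Integration by parts *)

Section IntegrationByParts.
Context (R : realType) (V : tvsType R[i]) (Q : set (V -> R)) (n : nat).
Context (B : {biscalar 'rV[R]_n}).
Hypotheses (defQ : defining_system Q) (hV : hausdorff_space V).
Hypothesis complV : sequentially_complete V.
Local Notation k := (n + n)%N.
Implicit Types (F G : 'rV[R]_k -> V) (x : 'rV[R]_k) (i j l : 'I_k) (a : R).

Let seminormQ q : Q q -> is_seminorm q. Proof. by case: defQ => + _ _; apply. Qed.

Definition phase_int F : V := integral_Rk (phase_mul B F).

Lemma phase_int_linear a (c : R[i]) F G : 0 < a ->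
    continuous F -> supported_in a F -> continuous G -> supported_in a G ->
  phase_int (c *: F + G) = c *: phase_int F + phase_int G.
Proof.
move=> a0 cF sF cG sG; rewrite /phase_int phase_mul_linear.
by apply: (integral_linear defQ hV complV c a0);
  [exact: (continuous_phase_mul defQ)|exact: supported_phase_mul
  |exact: (continuous_phase_mul defQ)|exact: supported_phase_mul].
Qed.

Definition C0inf_in a F : Prop := smooth F /\ supported_in a F.

Lemma C0inf_in0 a : C0inf_in a 0.
Proof. by split; [exact: (smooth0 k defQ hV)|move=> x /=; rewrite eqxx]. Qed.

Lemma C0inf_in_linear a (c : R[i]) F G : C0inf_in a F -> C0inf_in a G ->
  C0inf_in a (c *: F + G).
Proof.
move=> [sF aF] [sG aG]; split; first exact: (smooth_linear defQ hV).
exact: supported_linear.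
Qed.

Lemma C0inf_inZ a (c : R[i]) F : C0inf_in a F -> C0inf_in a (c *: F).
Proof.
by move=> aF; rewrite -[c *: F]addr0; exact: C0inf_in_linear aF (C0inf_in0 a).
Qed.

Lemma C0inf_in_sum a (I : Type) (s : seq I) (f : I -> 'rV[R]_k -> V) :
  (forall e, C0inf_in a (f e)) -> C0inf_in a (\sum_(e <- s) f e).
Proof.
move=> af; elim/big_rec : _ => [|e F _ aF]; first exact: C0inf_in0.
by rewrite -[f e]scale1r; exact: C0inf_in_linear.
Qed.

Lemma C0inf_in_smul a b F : smooth_scalar b -> C0inf_in a F ->
  C0inf_in a (smul b F).
Proof.
move=> sb [sF aF]; split; first exact: (smooth_smul defQ hV).
exact: supported_smul.
Qed.

Lemma C0inf_in_partial a j F : C0inf_in a F -> C0inf_in a (partial j F).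
Proof.
move=> [sF aF]; split; first exact: smooth_partial.
by apply: (supported_pd defQ hV aF (j := j)) => x; exact: (smooth_has_pd defQ hV).
Qed.

Lemma C0inf_phase_int_linear a (c : R[i]) F G : 0 < a ->
    C0inf_in a F -> C0inf_in a G ->
  phase_int (c *: F + G) = c *: phase_int F + phase_int G.
Proof.
move=> a0 [sF aF] [sG aG]; apply: (phase_int_linear c a0) => //;
  exact: smooth_continuous.
Qed.

Lemma phase_int0 a : 0 < a -> phase_int 0 = 0.
Proof.
move=> a0; have := C0inf_phase_int_linear (-1) a0 (C0inf_in0 a) (C0inf_in0 a).
by rewrite scaler0 addr0 scaleN1r addNr.
Qed.

Lemma phase_intZ a (c : R[i]) F : 0 < a -> C0inf_in a F ->
  phase_int (c *: F) = c *: phase_int F.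
Proof.
move=> a0 aF; rewrite -[c *: F]addr0 (C0inf_phase_int_linear _ a0)//.
  by rewrite (phase_int0 a0) addr0.
exact: C0inf_in0.
Qed.

Lemma phase_int_sum a (I : Type) (s : seq I) (f : I -> 'rV[R]_k -> V) : 0 < a ->
  (forall e, C0inf_in a (f e)) ->
  phase_int (\sum_(e <- s) f e) = \sum_(e <- s) phase_int (f e).
Proof.
move=> a0 af; elim: s => [|e s IH]; first by rewrite !big_nil (phase_int0 a0).
rewrite !big_cons -IH -[f e]scale1r (C0inf_phase_int_linear _ a0) ?scale1r//.
exact: C0inf_in_sum.
Qed.

Lemma smooth_scalar_coord i : smooth_scalar (fun x : 'rV[R]_k => x 0 i).
Proof. by move=> r; exists 1, 1; exact: ssym_coord. Qed.

Lemma smooth_scalar_bracket2V : smooth_scalar (fun x : 'rV[R]_k => (bracket2 x)^-1).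
Proof. by move=> r; have [C] := ssym_bracket2V R k r; exists (- 2), C. Qed.

Lemma smooth_scalar_phase_grad j : smooth_scalar (phase_grad B j).
Proof.
move=> r; exists 1, (\sum_(l < k) 2 ^+ r * `|phase_grad B j (delta_mx 0 l)| * 1).
rewrite [X in ssym _ _ X](_ : _ =
    fun x => \sum_l phase_grad B j (delta_mx 0 l) * x 0 l); last first.
  apply/funext => x; rewrite (row_linear_sum (phase_grad_linear B j)).
  by apply: eq_bigr => l _; rewrite mulrC.
elim: (index_enum _) => [|l s IH].
  rewrite big_nil; under eq_fun do rewrite big_nil; exact: ssym0.
rewrite big_cons; under eq_fun do rewrite big_cons.
exact: (ssymD (ssymZ _ (ssym_coord R r l)) IH).
Qed.

(** The integral of the [j]-th derivative of the phase times [F] vanishes, and the derivative of the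
    phase is 'i times its [j]-th gradient component times the phase. *)
Lemma phase_int_partial a j F : 0 < a -> C0inf_in a F ->
  phase_int (partial j F) = - 'i%C *: phase_int (smul (phase_grad B j) F).
Proof.
move=> a0 aF; have [sF supF] := aF.
have aS := C0inf_in_smul (smooth_scalar_phase_grad j) aF.
have aP := C0inf_in_partial j aF.
have := @integral_partial_eq0 R V Q k defQ hV complV a (phase_mul B F)
  (phase_mul B ('i%C *: smul (phase_grad B j) F + partial j F)) j a0
  (supported_phase_mul (B := B) supF).
have -> : integral_Rk (phase_mul B ('i%C *: smul (phase_grad B j) F + partial j F)) =
    'i%C *: phase_int (smul (phase_grad B j) F) + phase_int (partial j F).
  exact: (C0inf_phase_int_linear 'i%C a0 aS aP).
move=> H; apply/eqP; rewrite scaleNr -addr_eq0 addrC; apply/eqP/H => [x|].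
  have := has_pd_phase_mul B defQ (smooth_has_pd defQ hV j x sF).
  congr has_pd; rewrite phase_mul_linear.
  by rewrite /phase_mul /smul [_%:C *: (phase _ _ *: _)]complex_scale_comm.
apply: (continuous_phase_mul defQ); apply: (continuous_linear defQ).
  by case: aS => /smooth_continuous.
by case: aP => /smooth_continuous.
Qed.

Context (T : 'M[R]_k).
Hypothesis TP : forall l x, x 0 l = \sum_j T l j * phase_grad B j x.

Definition ibp_term F (lj : 'I_k * 'I_k) : 'rV[R]_k -> V :=
  ((T lj.1 lj.2)%:C * 'i%C) *:
    partial lj.2 (smul (fun x => x 0 lj.1) (smul (fun x => (bracket2 x)^-1) F)).

(* The transpose of (1 + sum_l x_l D_l) composed with the division by
   1 + |x|^2, where D_l = -i sum_j T_lj d_j multiplies the phase by x_l. *)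
Definition ibp_op F : 'rV[R]_k -> V :=
  smul (fun x => (bracket2 x)^-1) F + \sum_lj ibp_term F lj.

Lemma C0inf_in_ibp_term a F lj : C0inf_in a F -> C0inf_in a (ibp_term F lj).
Proof.
move=> aF; apply/C0inf_inZ/C0inf_in_partial/C0inf_in_smul.
  exact: smooth_scalar_coord.
by apply: C0inf_in_smul => //; exact: smooth_scalar_bracket2V.
Qed.

Lemma C0inf_in_ibp_op a F : C0inf_in a F -> C0inf_in a (ibp_op F).
Proof.
move=> aF; rewrite /ibp_op -[smul _ _]scale1r; apply: C0inf_in_linear.
  by apply: C0inf_in_smul => //; exact: smooth_scalar_bracket2V.
by apply: C0inf_in_sum => lj; exact: C0inf_in_ibp_term.
Qed.

(** With G = F / (1 + |x|^2) one has F = G + sum_l x_l x_l G. One of the two factors x_l is written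
    by means of the gradient of the phase and traded for a derivative. *)
Lemma phase_int_ibp_op a F : 0 < a -> C0inf_in a F ->
  phase_int (ibp_op F) = phase_int F.
Proof.
move=> a0 aF; have aW := C0inf_in_smul smooth_scalar_bracket2V aF.
set G := smul (fun x => (bracket2 x)^-1) F in aW.
have aG l := C0inf_in_smul (smooth_scalar_coord l) aW.
have aGG l := C0inf_in_smul (smooth_scalar_coord l) (aG l).
have FE : F = 1 *: G +
    \sum_l smul (fun x => x 0 l) (smul (fun x => x 0 l) G).
  apply/funext => x; rewrite scale1r -[RHS]/(G x + (\sum_l _ : _ -> V) x).
  rewrite fct_sumE /smul /G /smul.
  under eq_bigr do rewrite !scalerA; rewrite -scaler_suml -scalerDl.
  under eq_bigr do rewrite -!rmorphM; rewrite -rmorph_sum -rmorphD -[LHS]scale1r.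
  congr (_ *: _); under eq_bigr do rewrite -expr2.
  rewrite -mulr_suml -{1}[_^-1]mul1r -mulrDl -bracket2E divff//.
  by rewrite gt_eqF// bracket2_gt0.
rewrite [in RHS]FE /ibp_op -/G -[G in LHS]scale1r.
have aT lj := C0inf_in_ibp_term lj aF.
rewrite (C0inf_phase_int_linear 1 a0 aW (C0inf_in_sum _ aT)).
rewrite (C0inf_phase_int_linear 1 a0 aW (C0inf_in_sum _ aGG)).
congr (_ + _); rewrite (phase_int_sum _ a0 aT) (phase_int_sum _ a0 aGG).
rewrite -(pair_bigA _ (fun l j => phase_int (ibp_term F (l, j)))) /=.
apply: eq_bigr => l _.
have -> : smul (fun x => x 0 l) (smul (fun x => x 0 l) G) =
    \sum_j (T l j)%:C *: smul (phase_grad B j) (smul (fun x => x 0 l) G).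
  apply/funext => x; rewrite fct_sumE {1}/smul {1}TP rmorph_sum scaler_suml.
  by apply: eq_bigr => j _; rewrite rmorphM -scalerA.
have aS j := C0inf_in_smul (smooth_scalar_phase_grad j) (aG l).
rewrite (phase_int_sum _ a0) => [|j]; last exact: C0inf_inZ.
apply: eq_bigr => j _; rewrite (phase_intZ _ a0)// /ibp_term (phase_intZ _ a0) /=;
  last exact: C0inf_in_partial.
rewrite (phase_int_partial _ a0)// scalerA -mulrA mulrN -expr2 sqr_i opprK mulr1.
by [].
Qed.

End IntegrationByParts.

(** * The seminorm estimate for oscillatory integrals *)

Section Estimate.
Context (R : realType) (V : tvsType R[i]) (Q : set (V -> R)) (n : nat).
Context (B : {biscalar 'rV[R]_n}).
Hypotheses (defQ : defining_system Q) (hV : hausdorff_space V).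
Hypothesis complV : sequentially_complete V.
Local Notation k := (n + n)%N.
Implicit Types (F G : 'rV[R]_k -> V) (x : 'rV[R]_k) (i j l : 'I_k) (a : R).

Let seminormQ q : Q q -> is_seminorm q. Proof. by case: defQ => + _ _; apply. Qed.

Context (q : V -> R) (rho : R) (Qq : Q q) (rho1 : rho <= 1).

Lemma vsymZ r s (c : R[i]) F A : Ck r F -> vsym q rho r s F A ->
  vsym q rho r s (c *: F) (complex.Re `|c| * A).
Proof.
move=> CF sF; rewrite -[c *: F]addr0 -[_ * A]addr0.
apply: (vsym_linear defQ hV) => //; first exact: (smooth0 k defQ hV).
exact: (vsym0 k defQ hV).
Qed.

(** The constant [K] serves every order [s], so that these bounds can be composed. *)
Definition bounded_op (r' r : nat) (t : R)
    (op : ('rV[R]_k -> V) -> 'rV[R]_k -> V) : Prop :=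
  exists2 K, 0 <= K & forall s F A, smooth F -> vsym q rho r' s F A ->
    vsym q rho r (s - t) (op F) (K * A).

Lemma bounded_op_sum r' r t (I : Type) (e : seq I)
    (op : I -> ('rV[R]_k -> V) -> 'rV[R]_k -> V) :
  (forall y, bounded_op r' r t (op y)) ->
  (forall y F, smooth F -> smooth (op y F)) ->
  bounded_op r' r t (fun F => \sum_(y <- e) op y F).
Proof.
move=> bO sO; elim: e => [|l e [K K0 HK]].
  exists 0 => // s F A sF _; rewrite big_nil mul0r.
  exact: (vsym0 k defQ hV).
have [K' K'0 HK'] := bO l; exists (K' + K); first exact: addr_ge0.
move=> s F A sF vF; rewrite big_cons -[op l F]scale1r mulrDl.
have := vsym_linear defQ hV 1 Qq (sO l _ sF r) (smooth_sum defQ hV _ _ _ r)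
  (HK' s F A sF vF) (HK s F A sF vF).
rewrite normr1 mul1r; apply => l'; exact: sO.
Qed.

Context (T : 'M[R]_k).

(** The orders add up to -2 + 1 - rho = -(1 + rho): division by [bracket2], one coordinate, one
    derivative. *)
Lemma bounded_ibp_term r lj : bounded_op r.+1 r (1 + rho)
  (fun F => ibp_term T F lj).
Proof.
case: lj => l j; have [C HC] := ssym_bracket2V R k r.+1.
have C0 := ssym_ge0 HC.
exists (complex.Re `|(T l j)%:C * 'i%C : R[i]| * (2 ^+ r.+1 * 1 * (2 ^+ r.+1 * C))).
  by rewrite !mulr_ge0// normc_Re_ge0.
move=> s F A sF vF.
have sW := smooth_smul defQ hV (@smooth_scalar_bracket2V R n) sF.
have sG := smooth_smul defQ hV (smooth_scalar_coord R l) sW.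
have v1 := vsym_smul defQ hV Qq rho1 HC (sF _) vF.
have v2 := vsym_smul defQ hV Qq rho1 (ssym_coord R r.+1 l) (sW _) v1.
rewrite /ibp_term -[X in vsym _ _ _ _ _ X]mulrA; apply: vsymZ; first exact: smooth_partial.
have [_ /(_ j)] := v2; congr vsym; first by ring.
by ring.
Qed.

Lemma bounded_ibp_op r : bounded_op r.+1 r (1 + rho) (ibp_op T).
Proof.
have [C HC] := ssym_bracket2V R k r; have C0 := ssym_ge0 HC.
have [K K0 HK] : bounded_op r.+1 r (1 + rho) (fun F => \sum_lj ibp_term T F lj).
  apply: bounded_op_sum => [lj|lj F sF]; first exact: bounded_ibp_term.
  apply: (smoothZ defQ hV); apply: smooth_partial.
  apply: (smooth_smul defQ hV); first exact: smooth_scalar_coord.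
  by apply: (smooth_smul defQ hV) => //; exact: smooth_scalar_bracket2V.
exists (2 ^+ r * C + K); first by rewrite addr_ge0// mulr_ge0.
move=> s F A sF vF.
have sW := smooth_smul defQ hV (@smooth_scalar_bracket2V R n) sF.
rewrite /ibp_op -[smul _ _]scale1r mulrDl.
have v1 : vsym q rho r (s - (1 + rho)) (smul (fun x => (bracket2 x)^-1) F)
    (2 ^+ r * C * A).
  apply: (vsym_le defQ Qq (lexx rho) _ (lexx _)) (vsym_smul defQ hV Qq rho1 HC (sF _)
    (vsym_pred vF)).
  by have := rho1; lra.
have := vsym_linear defQ hV 1 Qq (sW r) _ v1 (HK s F A sF vF).
rewrite normr1 mul1r; apply; apply: (smooth_sum defQ hV) => lj.
apply: (smoothZ defQ hV); apply: smooth_partial.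
apply: (smooth_smul defQ hV); first exact: smooth_scalar_coord.
by apply: (smooth_smul defQ hV) => //; exact: smooth_scalar_bracket2V.
Qed.

Lemma iter_ibp_op N : exists2 K, 0 <= K & forall a s F A, C0inf_in a F ->
  vsym q rho N s F A ->
  vsym q rho 0 (s - (1 + rho) * N%:R) (iter N (ibp_op T) F) (K * A).
Proof.
(* Each application of the operator uses up one derivative, so the induction keeps [r] spare
   ones. *)
suff : forall r, exists2 K, 0 <= K & forall a s F A, C0inf_in a F ->
    vsym q rho (N + r) s F A ->
    vsym q rho r (s - (1 + rho) * N%:R) (iter N (ibp_op T) F) (K * A).
  by move=> /(_ 0%N); rewrite addn0.
elim: N => [|N IH] r.
  by exists 1 => // a s F A _; rewrite mulr0 subr0 mul1r.
have [K K0 HK] := IH r.+1; have [K' K'0 HK'] := bounded_ibp_op r.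
exists (K' * K); first exact: mulr_ge0.
move=> a s F A aF; rewrite addSnnS => /(HK _ _ _ _ aF)/HK' H.
have : smooth (iter N (ibp_op T) F).
  suff [] : C0inf_in a (iter N (ibp_op T) F) by [].
  by elim: (N) => //= m; exact: (C0inf_in_ibp_op defQ hV).
move=> /H /=; rewrite mulrA; congr vsym.
by rewrite -natr1; ring.
Qed.

Hypothesis rhoN1 : -1 < rho.
Hypothesis TP : forall l x, x 0 l = \sum_j T l j * phase_grad B j x.

Lemma phase_int_estimate (m : R) : exists N : nat, exists2 K, 0 <= K &
  forall a F A, 0 < a -> C0inf_in a F -> vsym q rho N m F A ->
    q (phase_int B F) <= K * A.
Proof.
have rho0 : 0 < 1 + rho by rewrite -ltrBlDl sub0r.
(* Enough steps to bring the order below [- (2 * k%:R)], where [weight_le_prod] provides the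
   integrable majorant. *)
pose N := Num.bound `|(m + 2 * k%:R) / (1 + rho)|.
have HN : m - (1 + rho) * N%:R <= - (2 * k%:R).
  rewrite lerBlDl -lerBlDr opprK [(1 + rho) * _]mulrC -ler_pdivrMr//.
  by apply: le_trans (ler_norm _) _; rewrite ltW// archi_boundP.
have [K K0 HK] := iter_ibp_op N.
exists N; exists (K * (3 * pi) ^+ k).
  by rewrite mulr_ge0// exprn_ge0// mulr_ge0// pi_ge0.
move=> a F A a0 aF vF.
have [aG ->] : C0inf_in a (iter N (ibp_op T) F) /\
    phase_int B F = phase_int B (iter N (ibp_op T) F).
  elim: (N) => //= l [aG ->]; split; first exact: (C0inf_in_ibp_op defQ hV).
  by rewrite (phase_int_ibp_op defQ hV complV TP a0).
have [sG supG] := aG.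
rewrite mulrAC; apply: (integral_bound defQ hV complV Qq a0).
- exact/(continuous_phase_mul defQ)/smooth_continuous.
- exact: supported_phase_mul.
move=> x; rewrite (seminorm_phase_mul B defQ)//.
have vG := HK _ _ _ _ aF vF; have KA0 := vsym_ge0 defQ Qq vG.
rewrite (le_trans (vsym_bound x vG))// ler_wpM2l//.
exact: le_trans (weight_le x HN) (weight_le_prod x).
Qed.

End Estimate.

(** * The oscillatory integral *)

(** Local upper bounds suffice: the near-covering form of compactness is applied to the filter of
    large numbers [M]. *)
Lemma compact_upper_bound (R : realType) (T : topologicalType) (K : set T)
    (f : T -> R) : compact K ->
    (forall x, K x -> exists M, \forall y \near x, f y <= M) ->
  exists M, forall x, K x -> f x <= M.
Proof.
move=> /compact_near_coveringP cK fM.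
have fil : Filter (pinfty_nbhs R) by typeclasses eauto.
have := cK R (pinfty_nbhs R) (fun M x => f x <= M) fil.
case=> [x /fM[M HM]|M [Mr /(_ (M + 1))]].
  exists ([set y | f y <= M], [set N | M <= N]) => /=.
    by split=> //; exact: (nbhs_pinfty_ge (num_real M)).
  by move=> [y N] [/= h1 h2]; exact: le_trans h1 h2.
by rewrite ltrDl ltr01 => /(_ isT) H; exists (M + 1) => x /H.
Qed.

(** * Symbol seminorms and bounds on finitely many derivatives *)

Section SymbolBounds.
Context (R : realType) (V : tvsType R[i]) (Q : set (V -> R)) (k : nat).
Hypotheses (defQ : defining_system Q) (hV : hausdorff_space V).
Implicit Types (F G : 'rV[R]_k -> V) (m rho : Q -> R) (mu : multi_index k).
Implicit Types (q : Q).

Lemma valQ q : Q (\val q). Proof. by have := valP q; rewrite inE. Qed.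

Definition degree mu : R := (\sum_(i < k) mu i)%N%:R.

Lemma symbol_normE m rho q mu F : symbol_norm m rho (q, mu) F =
  ereal_sup (range (fun x : 'rV[R]_k =>
    ((weight (m q - rho q * degree mu) x)^-1 * \val q (pderiv mu F x))%:E)).
Proof.
rewrite /symbol_norm; congr ereal_sup.
apply: (congr1 (fun f : 'rV[R]_k -> \bar R => range f)); apply/funext => x.
by rewrite /weight -powRN; congr ((_ `^ _ * _)%:E); rewrite /degree; field.
Qed.

Lemma symbol_norm_leP m rho q mu F (A : R) : (symbol_norm m rho (q, mu) F <= A%:E)%E <->
  forall x, \val q (pderiv mu F x) <= A * weight (m q - rho q * degree mu) x.
Proof.
rewrite symbol_normE; split=> [H x|H].
  rewrite mulrC -ler_pdivrMl ?weight_gt0// -lee_fin (le_trans _ H)//.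
  by apply: ereal_sup_ubound; exists x.
apply: ge_ereal_sup => _ [x _ <-]; rewrite lee_fin.
by rewrite ler_pdivrMl ?weight_gt0// mulrC.
Qed.

Lemma symbol_norm_lty m rho q mu F : (symbol_norm m rho (q, mu) F < +oo)%E ->
  exists2 A, 0 <= A &
  forall x, \val q (pderiv mu F x) <= A * weight (m q - rho q * degree mu) x.
Proof.
case E : (symbol_norm m rho (q, mu) F) => [A| |]// _.
  have /symbol_norm_leP H : (symbol_norm m rho (q, mu) F <= A%:E)%E by rewrite E.
  exists `|A| => // x; rewrite (le_trans (H x))// ler_wpM2r ?weight_ge0//.
  exact: ler_norm.
have /symbol_norm_leP H : (symbol_norm m rho (q, mu) F <= 0%:E)%E by rewrite E leNye.
by exists 0.
Qed.

(** A finite type that covers all multi-indices of degree at most [r]; it makes sums and finite sets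
    of seminorms available. *)
Definition index_of_bounded r (f : {ffun 'I_k -> 'I_r.+1}) : multi_index k :=
  [ffun i => f i : nat].

Lemma bounded_index r mu : (\sum_(i < k) mu i <= r)%N ->
  exists f : {ffun 'I_k -> 'I_r.+1}, mu = index_of_bounded f.
Proof.
move=> mur; have mui i : (mu i <= r)%N.
  by apply: leq_trans mur; rewrite (bigD1 i)//= leq_addr.
exists [ffun i => inord (mu i)]; apply/ffunP => i.
by rewrite !ffunE inordK// ltnS.
Qed.

Lemma symbols_vsym m rho F q r : symbols m rho F ->
  exists A, vsym (\val q) (rho q) r (m q) F A.
Proof.
move=> [sF HF].
have /choice[A HA] mu : exists A, 0 <= A /\
    forall x, \val q (pderiv mu F x) <= A * weight (m q - rho q * degree mu) x.
  by have [A A0 H] := symbol_norm_lty (HF (q, mu)); exists A.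
(* The constants are nonnegative, so their sum dominates each of them. *)
exists (\sum_(f : {ffun 'I_k -> 'I_r.+1}) A (index_of_bounded f)).
apply: (vsym_of_pderiv defQ hV) => // mu /bounded_index[f ->] x.
have [_ /(_ x)] := HA (index_of_bounded f); move/le_trans; apply.
rewrite ler_wpM2r ?weight_ge0// (bigD1 f)//= lerDl sumr_ge0// => g _.
by have [] := HA (index_of_bounded g).
Qed.

Lemma vsym_symbol_norm m rho F q mu (A : R) r : (\sum_(i < k) mu i <= r)%N ->
  vsym (\val q) (rho q) r (m q) F A -> (symbol_norm m rho (q, mu) F <= A%:E)%E.
Proof. by move=> mur vF; apply/symbol_norm_leP => x; exact: vsym_pderiv vF mur. Qed.

Lemma symbols_of_vsym m rho F : smooth F ->
  (forall q r, exists A, vsym (\val q) (rho q) r (m q) F A) -> symbols m rho F.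
Proof.
move=> sF HF; split=> // -[q mu]; have [A vF] := HF q (\sum_(i < k) mu i)%N.
by apply: le_lt_trans (vsym_symbol_norm (leqnn _) vF) _; rewrite ltry.
Qed.

Lemma symbols_linear m rho (c : R[i]) F G :
  symbols m rho F -> symbols m rho G -> symbols m rho (c *: F + G).
Proof.
move=> mF mG; have [[sF _] [sG _]] := (mF, mG).
apply: symbols_of_vsym => [|q r]; first exact: (smooth_linear defQ hV).
have [A vF] := symbols_vsym q r mF; have [A' vG] := symbols_vsym q r mG.
exists (complex.Re `|c| * A + A'); apply: (vsym_linear defQ hV) => //.
exact: valQ.
Qed.

Lemma symbols_le m rho m' rho' F : (forall q, m q <= m' q) ->
  (forall q, rho' q <= rho q) -> symbols m rho F -> symbols m' rho' F.
Proof.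
move=> mm rr mF; apply: symbols_of_vsym => [|q r]; first by case: mF.
have [A vF] := symbols_vsym q r mF; exists A.
exact: (vsym_le defQ (valQ q) (rr q) (mm q) (lexx _) vF).
Qed.

Lemma near_symbol_nbhs m rho F q r (e : R) : smooth F -> 0 < e ->
  symbol_nbhs m rho F [set G | symbols m rho G /\
    vsym (\val q) (rho q) r (m q) (G - F) e].
Proof.
move=> sF e0.
exists (range (fun f : {ffun 'I_k -> 'I_r.+1} => (q, index_of_bounded f)), e) => /=.
  by split=> //; apply: finite_image; exact: finite_finset.
move=> G [mG HG]; split=> //; have [sG _] := mG.
apply: (vsym_of_pderiv defQ hV); first exact: (smoothB defQ hV).
move=> mu /bounded_index[f ->]; apply/symbol_norm_leP/ltW/HG.
by exists f.
Qed.

Lemma cvg_symbol_nbhs m rho F (u : nat -> 'rV[R]_k -> V) :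
  (forall j, symbols m rho (u j)) ->
  (forall q mu (e : R), 0 < e ->
    \forall j \near \oo, (symbol_norm m rho (q, mu) (u j - F)%R < e%:E)%E) ->
  u @ \oo `=>` symbol_nbhs m rho F.
Proof.
move=> mu Hu U [[D e] /= [finD e0] DU].
have : \forall j \near \oo, (\bigcap_(i in D)
    [set j | (symbol_norm m rho i (u j - F)%R < e%:E)%E]) j.
  have [X ->] := finite_fsetP.1 finD.
  by apply: filter_bigI => -[q nu] _; exact: Hu.
by apply: filterS => j Hj; apply: DU; split=> // i Di; exact: Hj.
Qed.

Lemma C0inf_supported F : C0inf F <-> smooth F /\ exists2 a, 0 < a & supported_in a F.
Proof.
split=> [[sF cF]|[sF [a a0 aF]]]; split=> //.
  have [x Kx|M HM] := @compact_upper_bound R _ _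
      (fun x : 'rV[R]_k => \sum_i `|x 0 i|) cF.
    have := continuous_sumr (s := index_enum 'I_k) (fun i (y : 'rV[R]_k) =>
      @continuous_comp _ _ _ (fun z : 'rV[R]_k => z 0 i) (@Num.norm R R) y
      (@coord_continuous R 1 k 0 i y) (@norm_continuous R R (y 0 i))).
    move=> /(_ x) /cvgrPdist_lt /(_ 1 ltr01) H.
    exists (\sum_i `|x 0 i| + 1); apply: filterS H => y /= H.
    by move: H; rewrite ltr_distlC => /andP[_ /ltW].
  exists (Num.max 1 M); first by rewrite lt_max ltr01.
  move=> x /= Fx i; rewrite le_max; apply/orP; right.
  apply: le_trans (HM x _); last exact: subset_closure.
  by rewrite (bigD1 i)//= lerDl sumr_ge0.
have cK : compact [set x : 'rV[R]_k | forall i, `[- a, a]%classic (x 0 i)].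
  by apply: (@rV_compact _ _ (fun=> `[- a, a]%classic)) => i; exact: segment_compact.
apply: (subclosed_compact _ cK); first exact: closed_closure.
have clK := compact_closed (@norm_hausdorff _ _) cK.
rewrite [X in _ `<=` X]((closure_id _).1 clK).
apply: closure_subset => x /aF /= xa i.
by rewrite /= in_itv /= -ler_norml.
Qed.

End SymbolBounds.

(** * Approximation by cutoffs and the extension of [I0] *)

Section OscillatoryIntegral.
Context (R : realType) (V : tvsType R[i]) (Q : set (V -> R)) (n : nat).
Context (B : {biscalar 'rV[R]_n}).
Hypotheses (defQ : defining_system Q) (hV : hausdorff_space V).
Hypothesis complV : sequentially_complete V.
Hypothesis Bnondeg : nondegenerate_form B.
Local Notation k := (n + n)%N.
Implicit Types (F G : 'rV[R]_k -> V) (x : 'rV[R]_k) (m rho : Q -> R) (q : Q).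

Let seminormQ (p : V -> R) : Q p -> is_seminorm p. Proof. by case: defQ => + _ _; apply. Qed.

Lemma C0infP F : C0inf F <-> exists2 a, 0 < a & C0inf_in a F.
Proof.
split=> [/C0inf_supported[sF [a a0 aF]]|[a a0 [sF aF]]]; first by exists a.
by apply/C0inf_supported; split=> //; exists a.
Qed.

Lemma C0inf_linear (c : R[i]) F G : C0inf F -> C0inf G -> C0inf (c *: F + G).
Proof.
move=> /C0infP[a a0 [sF aF]] /C0infP[b b0 [sG bG]]; apply/C0infP.
exists (Num.max a b); first by rewrite lt_max a0.
apply: (C0inf_in_linear defQ hV); split=> //.
  by apply: supported_le aF; rewrite le_max lexx.
by apply: supported_le bG; rewrite le_max lexx orbT.
Qed.

Lemma C0infB F G : C0inf F -> C0inf G -> C0inf (F - G).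
Proof. by move=> cF cG; rewrite addrC -scaleN1r; exact: C0inf_linear. Qed.

Lemma I0_linear (c : R[i]) F G : C0inf F -> C0inf G ->
  I0 B (c *: F + G) = c *: I0 B F + I0 B G.
Proof.
move=> /C0infP[a a0 [sF aF]] /C0infP[b b0 [sG bG]].
have ab0 : 0 < Num.max a b by rewrite lt_max a0.
rewrite complex_scale_comm -scalerDr; congr (_ *: _).
apply: (C0inf_phase_int_linear B defQ hV complV c ab0); split=> //.
  by apply: supported_le aF; rewrite le_max lexx.
by apply: supported_le bG; rewrite le_max lexx orbT.
Qed.

Lemma I0B F G : C0inf F -> C0inf G -> I0 B (F - G) = I0 B F - I0 B G.
Proof.
by move=> cF cG; rewrite addrC -scaleN1r I0_linear// scaleN1r addrC.
Qed.

Lemma I0_estimate q (m rho : R) : -1 < rho <= 1 ->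
  exists N : nat, exists2 K, 0 <= K & forall F A, C0inf F ->
    vsym (\val q) rho N m F A -> \val q (I0 B F) <= K * A.
Proof.
move=> /andP[rhoN1 rho1]; have [T TP] := coord_phase_grad Bnondeg.
have sq := seminormQ (valQ q).
have [N [K K0 HK]] := phase_int_estimate defQ hV complV (valQ q) rho1 rhoN1 TP m.
exists N; exists (`|(2 * pi) ^- n| * K); first by rewrite mulr_ge0.
move=> F A /C0infP[a a0 aF] vF.
by rewrite (seminormZr sq) -mulrA ler_wpM2l// (HK a).
Qed.

(** With [u = v] this is the Cauchy property; with two sequences it is the independence of the limit
    from the approximation. *)
Lemma approximates_I0_close m rho F u v q (e : R) : is_type rho -> smooth F ->
    approximates m rho u F -> approximates m rho v F -> 0 < e ->
  exists N, forall i j, (N <= i)%N -> (N <= j)%N ->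
    \val q (I0 B (u i) - I0 B (v j)) < e.
Proof.
move=> Trho sF [cu uF] [cv vF] e0.
have [N [K K0 HK]] := I0_estimate q (m q) (Trho q).
(* The difference [u i - v j] passes through [F], which doubles the error; the added 1 allows
   [K = 0] and makes the inequality strict. *)
have K1 : 0 < 2 * K + 1 by rewrite ltr_wpDl// mulr_ge0.
have e1 := divr_gt0 e0 K1.
have [N1 _ H1] := uF _ (near_symbol_nbhs defQ hV m rho q N sF e1).
have [N2 _ H2] := vF _ (near_symbol_nbhs defQ hV m rho q N sF e1).
exists (maxn N1 N2) => i j; rewrite !geq_max => /andP[/H1[[su _] Hu] _].
move=> /andP[_ /H2[[sv _] Hv]].
rewrite -I0B//.
have : vsym (\val q) (rho q) N (m q) (u i - v j) (2 * (e / (2 * K + 1))).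
  have := vsym_linear defQ hV (-1) (valQ q) (smoothB defQ hV sv sF N)
    (smoothB defQ hV su sF N) Hv Hu.
  rewrite normrN normr1; congr vsym; last by rewrite /=; ring.
  by rewrite scaleN1r opprB addrC subrKA.
move=> /(HK _ _ (C0infB (cu i) (cv j)))/le_lt_trans; apply.
rewrite [ltLHS](_ : _ = e * (2 * K) / (2 * K + 1)); last by ring.
by rewrite ltr_pdivrMr// ltr_pM2l// ltrDl.
Qed.

(** The chosen value is the limit along some approximating sequence [w], and the images of [u] and
    [w] under [I0] become arbitrarily close. *)
Lemma approximates_cvg m rho F u : is_type rho -> smooth F ->
  approximates m rho u F -> (I0 B \o u) @ \oo --> osc_integral B m rho F.
Proof.
move=> Trho sF uF.
have qE (p : V -> R) : Q p -> exists q : Q, \val q = p.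
  by move=> Qp; exists (exist _ p (mem_set Qp)).
have cvgC w : approximates m rho w F -> exists v : V, (I0 B \o w) @ \oo --> v.
  move=> wF; apply: complV; apply: (seminorm_cauchyP defQ) => q /qE[q' <-] e e0.
  exact: (approximates_I0_close q' Trho sF wF wF e0).
have [v uv] := cvgC u uF.
rewrite /osc_integral; set P := [set _ | _].
have : P (xget 0 P) by apply: xgetPex; exists v; exists u.
case=> w wF wv; suff <- : v = xget 0 P by [].
apply: (cvg_seminorm_unique defQ hV) uv _.
apply/(cvg_seminormP defQ) => q /[dup] Qq /qE[q' qq'] e e0.
have sq := seminormQ Qq; have e20 : 0 < e / 2 by rewrite divr_gt0.
have /(cvg_seminormP defQ)/(_ q Qq _ e20) Hw := wv.
have [N HN] := approximates_I0_close q' Trho sF uF wF e20.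
have H : \forall j \near \oo, q (I0 B (u j) - I0 B (w j)) < e / 2.
  by exists N => // j /= Nj; rewrite -qq'; exact: HN.
apply: filterS (filterI H Hw) => j /= [h1 h2].
rewrite (le_lt_trans (seminorm_dist sq (I0 B (w j)) _ _))//.
by rewrite [e]splitr ltrD.
Qed.

(** The parameter [j.+1] satisfies the condition [1 <= J] of the cutoff estimates. No order or type
    enters the construction. *)
Definition cutoff_seq F (j : nat) : 'rV[R]_k -> V := smul (cutoff j.+1%:R) F.

Lemma natS_ge1 j : 1 <= j.+1%:R :> R. Proof. by rewrite ler1n. Qed.

Lemma smooth_scalar_cutoff j : smooth_scalar (@cutoff R k j.+1%:R).
Proof.
by move=> r; have [C HC] := ssym_cutoff R k r; exists 0, C; exact/HC/natS_ge1.
Qed.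

Lemma C0inf_cutoff_seq F j : smooth F -> C0inf (cutoff_seq F j).
Proof.
move=> sF; apply/C0infP; exists j.+1%:R; first by rewrite ltr0n.
split; first by apply: (smooth_smul defQ hV) => //; exact: smooth_scalar_cutoff.
move=> x /= Fx i; rewrite leNgt; apply/negP => jx; move/negP: Fx; apply.
by rewrite /cutoff_seq /smul (cutoff_eq0 (natS_ge1 j) jx) scale0r.
Qed.

(** Uniformity in [j] at the unchanged order [s] is what later gives continuity in the topology of
    the original symbol space. *)
Lemma vsym_cutoff_seq (r : nat) : exists2 K : R, 0 <= K &
  forall q (rho s : R) F A j, rho <= 1 -> smooth F ->
    vsym (\val q) rho r s F A -> vsym (\val q) rho r s (cutoff_seq F j) (K * A).
Proof.
have [C HC] := ssym_cutoff R k r.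
exists (2 ^+ r * C); first by rewrite mulr_ge0// (ssym_ge0 (HC 1 (lexx _))).
move=> q rho s F A j rho1 sF vF.
have := vsym_smul defQ hV (valQ q) rho1 (HC _ (natS_ge1 j)) (sF r) vF.
by rewrite add0r.
Qed.

Lemma powR_nat_unbounded (p M : R) : 0 < p ->
  \forall j \near \oo, M < j.+1%:R `^ p.
Proof.
move=> p0; pose b := Num.bound (`|M| `^ p^-1).
exists b => // j /= bj; apply: le_lt_trans (ler_norm _) _.
rewrite -[X in X < _](powRr1 (normr_ge0 M)) -[X in _ `^ X < _](mulVf (lt0r_neq0 p0)).
rewrite powRrM gt0_ltr_powR// ?nnegrE ?powR_ge0//.
apply: (@lt_le_trans _ _ b%:R); first by rewrite archi_boundP// powR_ge0.
by rewrite ler_nat ltnW.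
Qed.

Lemma cutoff_seq_diff_small q r (rho m m' : R) F A (e : R) : rho <= 1 -> m < m' ->
    smooth F -> vsym (\val q) rho r m F A -> 0 < e ->
  \forall j \near \oo, vsym (\val q) rho r m' (cutoff_seq F j - F) e.
Proof.
move=> rho1 mm' sF vF e0; have A0 := vsym_ge0 defQ (valQ q) vF.
pose d := Num.min 1 (m' - m).
have d0 : 0 < d by rewrite lt_min ltr01 subr_gt0.
have d2 : 0 < d <= 2 by rewrite d0 ge_min (ler1n _ 2).
have [C HC] := @ssym_cutoffB1 R k r d d2.
have C0 : 0 <= C by exact: ssym_ge0 (HC 1 (lexx _)).
have d20 : 0 < d / 2 by rewrite divr_gt0.
pose K := 2 ^+ r * (2 ^+ r * C) * A.
have K0 : 0 <= K by rewrite !mulr_ge0.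
apply: filterS (powR_nat_unbounded (K / e) d20) => j; rewrite ltr_pdivrMr// => HK.
set J := j.+1%:R in HK; have J0 : 0 < J `^ (d / 2) by rewrite powR_gt0// ltr0n.
have h1 : ssym r d (fun x => cutoff J x - 1) (2 ^+ r * (J `^ (d / 2))^-1 * C).
  have := ssymZ (J `^ (d / 2))^-1 (HC J (natS_ge1 j)).
  rewrite gtr0_norm ?invr_gt0//; congr ssym; apply/funext => x.
  by rewrite mulKf// gt_eqF.
have := vsym_smul defQ hV (valQ q) rho1 h1 (sF r) vF.
have -> : smul (fun x => cutoff J x - 1) F = cutoff_seq F j - F.
  rewrite -smulBl; congr (_ - _); apply/funext => x.
  by rewrite /smul scale1r.
apply: (vsym_le defQ (valQ q)) => //.
  by rewrite -lerBrDr ge_min lexx orbT.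
rewrite (_ : _ * _ * A = K / J `^ (d / 2)); last by rewrite /K; ring.
by rewrite ler_pdivrMr// mulrC ltW.
Qed.

Lemma cutoff_seq_approximates m rho m' rho' F : is_type rho ->
  admissible m rho m' rho' -> symbols m rho F ->
  approximates m' rho' (cutoff_seq F) F.
Proof.
move=> Trho [mm' rr'] mF; have [sF _] := mF.
have rho1 q : rho q <= 1 by have /andP[] := Trho q.
have r'r q : rho' q <= rho q by have /andP[] := rr' q.
split; first by move=> j; exact: C0inf_cutoff_seq.
apply: cvg_symbol_nbhs => [j|q mu e e0].
  apply: (symbols_le defQ hV (fun q => ltW (mm' q)) r'r).
  apply: symbols_of_vsym.
    by apply: (smooth_smul defQ hV) => //; exact: smooth_scalar_cutoff.
  move=> q r; have [A vF] := symbols_vsym defQ hV q r mF.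
  have [K K0 HK] := vsym_cutoff_seq r; exists (K * A).
  exact: HK.
have [A vF] := symbols_vsym defQ hV q (\sum_(i < k) mu i)%N mF.
have e20 : 0 < e / 2 by rewrite divr_gt0.
apply: filterS (cutoff_seq_diff_small (rho1 q) (mm' q) sF vF e20) => j vj.
have {}vj := vsym_le defQ (valQ q) (r'r q) (lexx _) (lexx _) vj.
apply: le_lt_trans (vsym_symbol_norm (leqnn _) vj) _.
by rewrite lte_fin ltr_pdivrMr// mulr_natr mulr2n ltrDl.
Qed.

Lemma admissible_type m rho m' rho' : is_type rho -> admissible m rho m' rho' ->
  is_type rho'.
Proof.
move=> Trho [_ rr'] q; have /andP[h1 h2] := rr' q; have /andP[_ h3] := Trho q.
by rewrite h1 (le_trans h2).
Qed.

Lemma cutoff_seq_cvg m rho m' rho' F : is_type rho ->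
  admissible m rho m' rho' -> symbols m rho F ->
  (I0 B \o cutoff_seq F) @ \oo --> osc_integral B m' rho' F.
Proof.
move=> Trho adm mF; apply: approximates_cvg.
- exact: admissible_type adm.
- by case: mF.
- exact: cutoff_seq_approximates adm mF.
Qed.

Lemma cutoff_seq_linear (c : R[i]) F G j :
  cutoff_seq (c *: F + G) j = c *: cutoff_seq F j + cutoff_seq G j.
Proof. exact: smul_linear. Qed.

Lemma osc_integral_linear m rho m' rho' (c : R[i]) F G : is_type rho ->
  admissible m rho m' rho' -> symbols m rho F -> symbols m rho G ->
  osc_integral B m' rho' (c *: F + G) =
  c *: osc_integral B m' rho' F + osc_integral B m' rho' G.
Proof.
move=> Trho adm mF mG; have mFG := symbols_linear defQ hV c mF mG.
apply: (cvg_seminorm_unique defQ hV) (cutoff_seq_cvg Trho adm mFG) _.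
have -> : I0 B \o cutoff_seq (c *: F + G) =
    fun j => c *: (I0 B \o cutoff_seq F) j + (I0 B \o cutoff_seq G) j.
  apply/funext => j /=; rewrite cutoff_seq_linear I0_linear//.
    by apply: C0inf_cutoff_seq; case: mF.
  by apply: C0inf_cutoff_seq; case: mG.
apply: (cvg_seminormD defQ); last exact: cutoff_seq_cvg adm mG.
by apply: (cvg_seminormZ defQ); exact: cutoff_seq_cvg adm mF.
Qed.

(** The integral is reached through the larger space, but the cutoffs of [F] obey the estimate for
    [m] and [rho] with a constant independent of [j], and the bound survives the limit. *)
Lemma osc_integral_bound m rho m' rho' q : is_type rho ->
    admissible m rho m' rho' ->
  exists N : nat, exists2 K, 0 <= K & forall F A, symbols m rho F ->
    vsym (\val q) (rho q) N (m q) F A ->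
    \val q (osc_integral B m' rho' F) <= K * A.
Proof.
move=> Trho adm.
have [N [K K0 HK]] := I0_estimate q (m q) (Trho q).
have [K' K'0 HK'] := vsym_cutoff_seq N.
exists N; exists (K * K'); first exact: mulr_ge0.
move=> F A mF vF; have [sF _] := mF.
apply: (cvg_seminorm_le defQ _ (valQ q) (cutoff_seq_cvg Trho adm mF)).
apply: nearW => j /=; rewrite -mulrA; apply: HK; first exact: C0inf_cutoff_seq.
by apply: HK' => //; have /andP[] := Trho q.
Qed.

Lemma osc_integral_continuous m rho m' rho' F : is_type rho ->
  admissible m rho m' rho' -> symbols m rho F ->
  osc_integral B m' rho' @ symbol_nbhs m rho F --> osc_integral B m' rho' F.
Proof.
move=> Trho adm mF; have [sF _] := mF.
have fil : Filter (symbol_nbhs m rho F) by exact: seminorm_nbhs_filter.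
apply/(cvg_seminormP defQ fil) => q Qq e e0.
have [N [K K0 HK]] := osc_integral_bound (exist _ q (mem_set Qq) : Q) Trho adm.
have K1 : 0 < K + 1 by rewrite ltr_wpDl.
have := near_symbol_nbhs defQ hV m rho (exist _ q (mem_set Qq) : Q) N sF
  (divr_gt0 e0 K1).
apply: (@filterS _ (symbol_nbhs m rho F)) => G /= [mG vG].
have mGF : symbols m rho (G - F).
  by rewrite addrC -scaleN1r; exact: symbols_linear.
have -> : osc_integral B m' rho' G - osc_integral B m' rho' F =
    osc_integral B m' rho' (G - F).
  rewrite (_ : G - F = (-1) *: F + G); last by rewrite scaleN1r addrC.
  rewrite (osc_integral_linear _ Trho adm)//.
  by rewrite scaleN1r addrC.
apply: le_lt_trans (HK _ _ mGF vG) _.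
rewrite [ltLHS](_ : _ = e * K / (K + 1)); last by ring.
by rewrite ltr_pdivrMr// ltr_pM2l// ltrDl.
Qed.

Lemma C0inf_symbols m rho F : C0inf F -> symbols m rho F.
Proof.
move=> /C0infP[a a0 aF]; have [sF _] := aF; split=> // -[q mu].
have sq := seminormQ (valQ q).
have [sG supG] : C0inf_in a (pderiv mu F).
  rewrite /pderiv; elim: (enum 'I_k) => //= i s.
  by elim: (mu i) => //= l IH /IH; exact: (C0inf_in_partial defQ hV).
have cG := smooth_continuous sG.
pose s := m q - rho q * degree R mu.
have cK : compact [set x : 'rV[R]_k | forall i, `[- a, a]%classic (x 0 i)].
  by apply: (@rV_compact _ _ (fun=> `[- a, a]%classic)) => i; exact: segment_compact.
have [x Kx|M HM] := @compact_upper_bound R _ _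
    (fun x => \val q (pderiv mu F x)) cK.
  have [d d0 Hd] := (continuous_seminormP defQ _).1 cG x _ (valQ q) _ ltr01.
  exists (\val q (pderiv mu F x) + 1); apply/nbhs_rVP; exists d => // y /Hd h.
  rewrite -[pderiv mu F y](subrK (pderiv mu F x)) addrC.
  by rewrite (le_trans (seminorm_subadd sq _ _))// lerD2l ltW.
(* An upper bound of [bracket2] on the cube that contains the support; as the sign of [s] is
   unknown, the weight is controlled through [|s|]. *)
pose b := 1 + \sum_(i < k) a ^+ 2.
have : (symbol_norm m rho (q, mu) F <= (`|M| * b `^ (`|s| / 2))%:E)%E.
  apply/symbol_norm_leP => x.
  have [->|Gx] := eqVneq (pderiv mu F x) 0.
    by rewrite (seminorm0 sq) !mulr_ge0 ?weight_ge0 ?powR_ge0.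
  have xa := supG x Gx.
  apply: (@le_trans _ _ (`|M| * 1)).
    rewrite mulr1 (le_trans _ (ler_norm M))// HM// => i.
    by rewrite /= in_itv /= -ler_norml.
  have w1 : weight (- s) x * weight s x = 1 by rewrite -weightD addNr weight0.
  rewrite -mulrA ler_wpM2l// -[leLHS]w1 ler_wpM2r ?weight_ge0//.
  apply: (@le_trans _ _ (weight `|s| x)).
    by apply: weight_le; rewrite -normrN ler_norm.
  rewrite /weight ge0_ler_powR ?nnegrE ?divr_ge0 ?(ltW (bracket2_gt0 x))//.
    by rewrite addr_ge0// sumr_ge0// => i _; exact: sqr_ge0.
  rewrite bracket2E lerD2l ler_sum// => i _.
  by rewrite -[leLHS]ger0_norm ?sqr_ge0// normrX lerXn2r ?nnegrE// ltW.
by move/le_lt_trans; apply; rewrite ltry.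
Qed.

(** The constant sequence [F] is an admissible approximation. *)
Lemma osc_integral_C0inf m rho F : is_type rho -> C0inf F ->
  osc_integral B m rho F = I0 B F.
Proof.
move=> Trho cF; have mF : symbols m rho F by exact: C0inf_symbols.
have [sF _] := mF.
have aF : approximates m rho (fun=> F) F.
  split=> //; apply: cvg_symbol_nbhs => // q mu e e0; apply: nearW => _.
  apply: (@le_lt_trans _ _ 0%:E); last by rewrite lte_fin.
  apply/symbol_norm_leP => x; rewrite subrr (pderiv0 defQ hV) mul0r.
  by rewrite (seminorm0 (seminormQ (valQ q))).
have H := approximates_cvg Trho sF aF.
apply: (cvg_seminorm_unique defQ hV) H _; exact: cvg_cst.
Qed.

End OscillatoryIntegral.

Theorem theorem3p2 (R : realType) (V : tvsType R[i]) (Q : set (V -> R))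
    (n : nat) (B : {biscalar 'rV[R]_n}) :
  hausdorff_space V -> sequentially_complete V -> defining_system Q ->
  nondegenerate_form B ->
  (* the extension of I0 is well defined *)
  (forall m rho m' rho' : Q -> R, is_type rho -> admissible m rho m' rho' ->
     forall F, symbols m rho F ->
       (exists u, approximates m' rho' u F) /\
       (forall u, approximates m' rho' u F ->
          (I0 B \o u) @ \oo --> osc_integral B m' rho' F)) /\
  (* (i) *)
  (forall m rho m1 rho1 m2 rho2 : Q -> R, is_type rho ->
     admissible m rho m1 rho1 -> admissible m rho m2 rho2 ->
     forall F, symbols m rho F ->
       osc_integral B m1 rho1 F = osc_integral B m2 rho2 F) /\
  (* (ii) *)
  (forall m rho m' rho' : Q -> R, is_type rho -> admissible m rho m' rho' ->
     (forall (c : R[i]) F G, symbols m rho F -> symbols m rho G ->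
        osc_integral B m' rho' (c *: F + G) =
        c *: osc_integral B m' rho' F + osc_integral B m' rho' G) /\
     (forall F, symbols m rho F ->
        osc_integral B m' rho' @ symbol_nbhs m rho F -->
        osc_integral B m' rho' F)) /\
  (* (iii) *)
  (forall m rho m' rho' : Q -> R, is_type rho -> admissible m rho m' rho' ->
     forall F, C0inf F -> osc_integral B m' rho' F = I0 B F) /\
  (* (iv) *)
  (forall m rho m' rho' m1 rho1 m2 rho2 : Q -> R, is_type rho -> is_type rho' ->
     admissible m rho m1 rho1 -> admissible m' rho' m2 rho2 ->
     forall F, symbols m rho F -> symbols m' rho' F ->
       osc_integral B m1 rho1 F = osc_integral B m2 rho2 F).
Proof.
move=> hV complV defQ Bnondeg.
(* Both integrals are limits of the same sequence, the [I0] of the cutoffs of [F]. This is (iv), and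
   (i) is the case of equal orders and types. *)
have indep (m rho m' rho' m1 rho1 m2 rho2 : Q -> R) (F : 'rV[R]_(n + n) -> V) :
    is_type rho -> is_type rho' ->
    admissible m rho m1 rho1 -> admissible m' rho' m2 rho2 ->
    symbols m rho F -> symbols m' rho' F ->
    osc_integral B m1 rho1 F = osc_integral B m2 rho2 F.
  move=> Tr Tr' adm adm' mF mF'.
  have H1 := cutoff_seq_cvg defQ hV complV Bnondeg Tr adm mF.
  have H2 := cutoff_seq_cvg defQ hV complV Bnondeg Tr' adm' mF'.
  exact: (cvg_seminorm_unique defQ hV _ H1 H2).
split=> [m rho m' rho' Tr adm F mF|].
  split; first by exists (cutoff_seq F); exact: cutoff_seq_approximates adm mF.
  move=> u; apply: approximates_cvg => //; first exact: admissible_type adm.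
  by case: mF.
split=> [m rho m1 rho1 m2 rho2 Tr adm1 adm2 F mF|].
  exact: (indep m rho m rho m1 rho1 m2 rho2 F Tr Tr adm1 adm2 mF mF).
split=> [m rho m' rho' Tr adm|].
  split=> [c F G mF mG|F mF]; first exact: osc_integral_linear adm mF mG.
  exact: osc_integral_continuous adm mF.
split=> [m rho m' rho' Tr adm F cF|].
  by apply: osc_integral_C0inf => //; exact: admissible_type adm.
by move=> m rho m' rho' m1 rho1 m2 rho2 Tr Tr' adm adm' F mF mF'; exact: indep adm adm' mF mF'.
Qed.
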